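(* Let $X=X(\mathbb T)$ be a Banach lattice satisfying Assumption A, and let $r,s\in\mathbb N$ with $2r\ge s$. Let $(G_n)_{n\in\mathbb N}$ be linear sampling operators with $G_nf\in\mathcal T_n$ for all $f\in X$, $n\in\mathbb N$ (i.e. $G_n:X_n\to\mathcal T_n$), for which there are constants $K_1,K_3>0$ such that for all $n\in\mathbb N$ $$\|G_nf\|_X\le K_1\|f\|_{X_n}\ \ (f\in X),\qquad \|T-G_nT\|_X\le K_3n^{-s}\|T^{(s)}\|_X\ \ (T\in\mathcal T_n).$$ Then for all $f\in X$ and all $\alpha\in(0,s)$ the following are equivalent: (i) $\|f-G_nf\|_X+\|f-G_nf\|_{X_n}=\mathcal O(n^{-\alpha})$ as $n\to\infty$; (ii) $\|(I-\dot A_{\gamma/n})^sf\|_X+\|(I-A_{\gamma/n})^rf\|_{X_n}=\mathcal O(n^{-\alpha})$ as $n\to\infty$.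
   Context: $\mathbb T$ is the unit circle identified with $[-\pi,\pi)$ (functions on $\mathbb T$ are $2\pi$-periodic), with normalized Lebesgue measure $\mu$. A Banach lattice $X=X(\mathbb T)$ is a Banach space of measurable functions on $\mathbb T$ such that: 1) if $f$ is measurable, $g\in X$ and $|f|\le|g|$, then $f\in X$ and $\|f\|_X\le\|g\|_X$; 2) if $f_n\in X$, $\sup_n\|f_n\|_X<\infty$ and $0\le f_n\uparrow f$, then $f\in X$ and $\|f_n\|_X\to\|f\|_X$; 3) for every measurable $E$ with $\mu(E)<\infty$, $\chi_E\in X$ and there is $c_E>0$ with $\int_E|f|\,d\mu\le c_E\|f\|_X$. Functions in $X$ are regarded as finite-valued and defined at every point, not as equivalence classes. Steklov averages: $A_hf(x)=\frac1h\int_{x-h/2}^{x+h/2}f(t)\,dt$ and $\dot A_hf(x)=A_hf(x+\tfrac h2)$ for $h>0$; $I$ is the identity. Assumption A: $A_hf\in X$ for all $f\in X$, $h>0$, and $\sup_{h>0,\,\|f\|_X\le1}\|A_hf\|_X<\infty$. $\mathcal T_n$ is the set of trigonometric polynomials of degree at most $n$. $(\Phi_n)$ are linear subspaces of $X$ with $\Phi_m\subset\Phi_n$ for $m\le n$, $\Phi_0=\{0\}$, satisfying $\|\varphi^{(q)}\|_X\le(Bn)^q\|\varphi\|_X$ for all $q\in\mathbb N$, $\varphi\in\Phi_n$, with a constant $B=B_X>0$. (If $X$ is translation-invariant, spline spaces of smoothness $s$ are also admitted, with this inequality required only for $q\le s$.) Sampling operators: $G_nf(x)=\sum_{k=1}^{m_n}f(x_{k,n})\varphi_{k,n}(x)$,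 $n\in\mathbb N$, where $\varphi_{k,n}\in\Phi_n$ are $2\pi$-periodic and $x_k=x_{k,n}\in\mathbb T$ are nodes such that for some fixed $\gamma,\gamma'>0$, $\frac{\gamma}{n}\le x_{k+1,n}-x_{k,n}\le\frac{\gamma'}{n}$ for $k=1,\dots,m_n$, with $x_{m_n+1,n}=2\pi+x_{1,n}$. The constant $\gamma$ in the claim is this one. The discrete semi-norm is $\|f\|_{X_n}=\big\|\sum_{k=1}^{m_n}|f(x_k)|\chi_{[x_k,x_{k+1})}\big\|_X$. *)

(* Defs.v *)
(* Real-valued functions on the circle are modelled as 2pi-periodic functions
   R -> R over an arbitrary R : realType; their values are defined everywhere,
   while the lattice and norm axioms are read almost everywhere, as usual for
   spaces of measurable functions. *)
From HB Require Import structures.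
From mathcomp Require Import all_boot all_order all_algebra.
From mathcomp Require Import all_classical all_reals all_analysis.
Set Implicit Arguments.
Unset Strict Implicit.
Unset Printing Implicit Defensive.
Import Order.TTheory GRing.Theory Num.Theory.
Import numFieldNormedType.Exports.
Local Open Scope classical_set_scope.
Local Open Scope ring_scope.

(* R with the Lebesgue (not only Borel) sigma-algebra. *)
Notation lebesgueTypeR R := (caratheodory_type ((@wlength R idfun)^*)%mu).

Section Circle.
Context {R : realType}.

Lemma measurable_period :
  measurable (`[- pi, pi[%classic : set (lebesgueTypeR R)).
Proof.
apply: sub_caratheodory.
exact: (measurable_itv (`[- pi, pi[ : interval R)).
Qed.

Lemma inv2pi_ge0 : 0 <= (2 * pi : R)^-1.
Proof. by rewrite invr_ge0 mulr_ge0// pi_ge0. Qed.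

(* Normalized Lebesgue measure of the circle, as a measure on R concentrated
   on [-pi, pi). *)
Definition circle_measure : {measure set (lebesgueTypeR R) -> \bar R} :=
  mscale (NngNum inv2pi_ge0)
    (mrestr (@completed_lebesgue_measure R) measurable_period).

Definition circle_fun (f : R -> R) : Prop := forall x, f (x + 2 * pi) = f x.

Definition circle_set (E : set R) : Prop := forall x, E (x + 2 * pi) <-> E x.

Definition circle_measurable_fun (f : R -> R) : Prop :=
  circle_fun f /\ measurable_fun [set: lebesgueTypeR R] f.

(* The trace on the circle of [a, b), i.e. the union of its 2pi-translates. *)
Definition circle_co (a b : R) : set R :=
  [set t | exists j : int, a <= t + j%:~R * (2 * pi) < b].

(* X is the set of functions of the space, N its norm (a seminorm on
   functions, vanishing exactly on the null functions). *)
Record banach_lattice (X : set (R -> R)) (N : (R -> R) -> R) : Prop :=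
  BanachLattice {
    bl_measurable : forall f, X f -> circle_measurable_fun f ;
    bl_add : forall f g, X f -> X g -> X (f \+ g) ;
    bl_scale : forall (c : R) f, X f -> X (fun x => c * f x) ;
    bl_norm_triangle : forall f g, X f -> X g -> N (f \+ g) <= N f + N g ;
    bl_norm_scale : forall (c : R) f, X f ->
      N (fun x => c * f x) = `|c| * N f ;
    bl_norm_eq0 : forall f, X f ->
      (N f = 0 <-> {ae circle_measure, forall x, f x = 0}) ;
    bl_complete : forall u : nat -> R -> R, (forall n, X (u n)) ->
      (forall e : R, 0 < e -> exists M : nat, forall m n : nat,
        (M <= m)%N -> (M <= n)%N -> N (u m \- u n) < e) ->
      exists2 f, X f & N (u n \- f) @[n --> \oo] --> (0 : R) ;
    bl_ideal : forall f g, circle_measurable_fun f -> X g ->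
      {ae circle_measure, forall x, `|f x| <= `|g x|} ->
      X f /\ N f <= N g ;
    bl_fatou : forall (u : nat -> R -> R) f,
      (forall n, X (u n)) -> circle_measurable_fun f ->
      (exists C : R, forall n, N (u n) <= C) ->
      {ae circle_measure, forall x,
        (forall n, 0 <= u n x <= u n.+1 x) /\
        (u n x @[n --> \oo] --> f x)} ->
      X f /\ (N (u n) @[n --> \oo] --> N f) ;
    bl_indic : forall E : set (lebesgueTypeR R),
      measurable E -> circle_set E -> (circle_measure E < +oo)%E ->
      X \1_E /\ exists2 c : R, 0 < c & forall f, X f ->
        (\int[circle_measure]_(x in E) `|f x|%:E <= (c * N f)%:E)%E
  }.

Definition steklov (h : R) (f : R -> R) : R -> R := fun x =>
  h^-1 * \int[@completed_lebesgue_measure R]_(t in `[x - h / 2, x + h / 2]) f t.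

Definition steklov_dot (h : R) (f : R -> R) : R -> R :=
  fun x => steklov h f (x + h / 2).

Definition assumptionA (X : set (R -> R)) (N : (R -> R) -> R) : Prop :=
  (forall h f, 0 < h -> X f -> X (steklov h f)) /\
  exists C : R, forall h f, 0 < h -> X f -> N f <= 1 -> N (steklov h f) <= C.

(* (I - A)^r f *)
Definition diff_iter (A : (R -> R) -> R -> R) (r : nat) (f : R -> R) : R -> R :=
  iter r (fun g => g \- A g) f.

Definition trig_poly (n : nat) : set (R -> R) :=
  [set T | exists a b : nat -> R, T = fun x =>
    \sum_(0 <= k < n.+1) (a k * cos (k%:R * x) + b k * sin (k%:R * x))].

(* The nodes of level n are x 1, ..., x m; x m.+1 is x 1 shifted by 2pi. *)
Record sampling_nodes (gamma gamma' : R) (n m : nat) (x : nat -> R) : Prop :=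
  SamplingNodes {
    nodes_gt0 : (0 < m)%N ;
    nodes_circle : forall k, (1 <= k <= m)%N -> - pi <= x k < pi ;
    nodes_wrap : x m.+1 = 2 * pi + x 1%N ;
    nodes_gap : forall k, (1 <= k <= m)%N ->
      gamma / n%:R <= x k.+1 - x k <= gamma' / n%:R
  }.

(* Membership of phi k in T_n need not be assumed separately: X contains the
   indicator of x k + 2pi Z, so it follows from sampling_op f being in T_n for
   all f in X. *)
Definition sampling_op (m : nat) (x : nat -> R) (phi : nat -> R -> R)
    (f : R -> R) : R -> R :=
  fun t => \sum_(1 <= k < m.+1) f (x k) * phi k t.

Definition discrete_norm (N : (R -> R) -> R) (m : nat) (x : nat -> R)
    (f : R -> R) : R :=
  N (fun t => \sum_(1 <= k < m.+1)
       `|f (x k)| * \1_(circle_co (x k) (x k.+1)) t).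

End Circle.

(* Main.v *)
Require Import Defs.
From mathcomp Require Import all_boot all_order all_algebra.
From mathcomp Require Import all_classical all_reals all_analysis.
From mathcomp Require Import ring lra measurable_realfun.
Import Order.TTheory GRing.Theory Num.Theory.
Set Implicit Arguments.
Unset Strict Implicit.
Unset Printing Implicit Defensive.
Import numFieldNormedType.Exports.
Local Open Scope classical_set_scope.
Local Open Scope ring_scope.

(** Write h = gamma/n, A' for the forward Steklov average at scale h, A for
    the centred one, D for differentiation and N for the lattice norm. The
    theorem holds because each of (i) and (ii) provides trigonometric
    polynomials T_n of degree n with N (f - T_n) = O(n^-alpha), and such
    polynomials automatically satisfy N (D^s T_n) = O(n^(s-alpha)). The
    second fact is where alpha < s enters: by Bernstein's inequality,
    comparing T_n with T_(n/b) gives N (D^s T_n) <= N (D^s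
    T_(n/b)) + O(n^(s-alpha)), and since s - alpha > 0 this recursion sums
    as a geometric series (lacunary, inverse_rate).

    What remains is local. On smooth functions, I - A' gains a factor O(h)
    at the cost of one derivative, and I - A a factor O(h^2) at the cost of
    two (norm_sub_steklov_dot, norm_sub_steklov), and the discrete norm is
    at most N g + O(1/n) N (D g) (dnorm_smooth). Hence on polynomials of
    degree n both differences of (ii) are O(n^-s) N (D^s T), where s <= 2r
    lets Bernstein's inequality absorb the surplus derivatives, and the
    discrete norm is O(1) N (T). For arbitrary g in X the discrete norm of A
    g is O(N g), as the nodes have spacing about h (dnorm_steklov);
    consequently g and (I - A)^r g have discrete norms that differ by O(N g)
    (dnorm_diff_iter_near).

    (i) implies (ii): take T_n = G_n f. Split f as (f - G_n f) + G_n f in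
    both differences; the first summand is controlled by (i), the second by
    the bound of N (D^s G_n f).

    (ii) implies (i): one must first construct T_n (direct_rate). The
    operator U = I - (I - A')^s equals A' P with P a polynomial in A', thus
    U^2 = A'^2 P^2 gains one derivative at the cost of O(1/h), while
    N (f - U f) is the first term of (ii). A power W_n of U therefore maps X
    to s times differentiable functions, with f - W_n f = O(n^-alpha); the
    lacunary recursion bounds N (D^s W_n f) by O(n^(s-alpha)), and s-fold
    iteration of the Jackson means of W_n f yields T_n. Then G_n f is
    compared with T_n by the two hypotheses on G_n: the error of G_n on T_n
    is O(n^-s) N (D^s T_n), and G_n (f - T_n) is bounded by the discrete
    norm of f - T_n, hence by the discrete norms of (I - A)^r f and
    (I - A)^r T_n and by N (f - T_n).

    X need not be translation invariant, so convolution inequalities of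
    Young type fail. Every estimate is instead reduced to a pointwise bound
    by an average, or by a sum of averages, of |g| over intervals around x,
    to which Assumption A applies. For the kernels in Bernstein's and
    Jackson's inequalities this is done by cutting the circle into dyadic
    shells around x (kernel_bound). *)

(** * Integrals over intervals for the completed Lebesgue measure *)

Section LebesgueIntegral.
Context {R : realType}.
Notation lam := (@completed_lebesgue_measure R).
Notation leb := (@lebesgue_measure R).
Implicit Types (f g : R -> R) (a b c x y h : R).

Lemma borel_lebesgue_measurable (A : set R) :
  measurable (A : set (measurableTypeR R)) -> measurable (A : set (lebesgueTypeR R)).
Proof. exact: sub_caratheodory. Qed.

Lemma lebesgue_measurable_itv (i : interval R) :
  measurable ([set` i] : set (lebesgueTypeR R)).
Proof. by apply: borel_lebesgue_measurable; exact: measurable_itv. Qed.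

Lemma measurable_id_lebesgue :
  measurable_fun [set: lebesgueTypeR R] (id : lebesgueTypeR R -> measurableTypeR R).
Proof. by move=> _ Y mY; rewrite setTI; exact: borel_lebesgue_measurable. Qed.

Lemma continuous_lebesgue_measurable g : continuous g ->
  measurable_fun [set: lebesgueTypeR R] g.
Proof.
move=> cg; move: (@continuous_measurable_fun _ g cg) => mg _ Y mY.
by rewrite setTI; apply: borel_lebesgue_measurable; rewrite -[_ @^-1` _]setTI; apply: mg.
Qed.

Lemma lebesgue_completed (A : set R) : leb A = lam A.
Proof. by []. Qed.

(** Borel and Lebesgue measurable sets live on two types with the same carrier.
    The identity from the larger sigma-algebra to the smaller one is
    measurable, and its image measure is the Borel one; this carries the
    calculus known for the Borel measure over to the completed measure. *)
Lemma integral_pushforward_id (D : set R) (u : R -> \bar R) :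
  (\int[leb]_(x in D) u x =
   \int[pushforward lam (id : lebesgueTypeR R -> measurableTypeR R)]_(x in D) u x)%E.
Proof.
pose m : {measure set (measurableTypeR R) -> \bar R} :=
  measure_function_pushforward__canonical__measure_function_Measure lam
    measurable_id_lebesgue.
exact: (@eq_measure_integral _ (measurableTypeR R) R D m).
Qed.

Lemma integrable_continuous g a b : continuous g ->
  lam.-integrable (`[a, b] : set (lebesgueTypeR R)) (EFin \o g).
Proof.
move=> cg.
have : leb.-integrable `[a, b] (EFin \o g).
  apply: continuous_compact_integrable; first exact: segment_compact.
  exact: continuous_subspaceT.
move=> /integrableP[mg ig]; apply/integrableP; split.
  apply/measurable_EFinP; apply: measurable_funTS.
  exact: continuous_lebesgue_measurable.
have <- : (\int[leb]_(x in `[a, b]) `|(EFin \o g) x| =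
   \int[lam]_(x in `[a, b]) `|(EFin \o g) x|)%E; last by [].
rewrite (integral_pushforward_id _ (fun x => `|(EFin \o g) x|%E)).
rewrite (@ge0_integral_pushforward _ _ (lebesgueTypeR R) (measurableTypeR R) R _ measurable_id_lebesgue)//.
by apply: measurableT_comp.
Qed.

Lemma integral_continuous g a b : continuous g ->
  (\int[lam]_(x in `[a, b]) (g x)%:E = \int[leb]_(x in `[a, b]) (g x)%:E)%E.
Proof.
move=> cg; apply/esym.
rewrite (integral_pushforward_id _ (EFin \o g)).
rewrite (@integral_pushforward _ _ (lebesgueTypeR R) (measurableTypeR R) R _ measurable_id_lebesgue)//.
- by apply/measurable_EFinP; exact: continuous_measurable_fun.
- exact: integrable_continuous.
Qed.

Lemma lam_set1 x : lam [set x] = 0%E.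
Proof. exact: (@lebesgue_measure_set1 R x). Qed.

Lemma lam_itv_cc a b : a <= b -> lam `[a, b] = (b - a)%:E.
Proof.
move=> ab; rewrite -lebesgue_completed lebesgue_measure_itv/= lte_fin.
by move: ab; rewrite le_eqVlt => /orP[/eqP->|->]; rewrite ?ltxx ?subrr// EFinB.
Qed.

Lemma integral_point f b c : b <= c -> lam.-integrable `[b, c] (EFin \o f) ->
  (\int[lam]_(x in [set b]) (f x)%:E = 0)%E.
Proof.
move=> bc fi.
have mb : measurable ([set b] : set (lebesgueTypeR R)).
  exact: borel_lebesgue_measurable.
have mf : measurable_fun ([set b] : set (lebesgueTypeR R)) (EFin \o f).
  have := @measurable_int _ (lebesgueTypeR R) R lam _ _ fi.
  apply: (@measurable_funS _ _ (lebesgueTypeR R) _ `[b, c]).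
    exact: lebesgue_measurable_itv.
  by move=> _ ->; rewrite /= in_itv/= lexx bc.
exact: (@null_set_integral _ (lebesgueTypeR R) R lam _ _ mb mf (lam_set1 b)).
Qed.

Lemma integrable_subitv f a b c d : a <= c -> d <= b ->
  lam.-integrable `[a, b] (EFin \o f) -> lam.-integrable `[c, d] (EFin \o f).
Proof.
move=> ac db; apply: (@integrableS _ (lebesgueTypeR R) R lam).
- exact: lebesgue_measurable_itv.
- exact: lebesgue_measurable_itv.
- by apply: subset_itv; rewrite bnd_simp.
Qed.

Lemma Rintegral_itv_split a b c f : a <= b -> b <= c ->
  lam.-integrable `[a, c] (EFin \o f) ->
  \int[lam]_(x in `[a, c]) f x = \int[lam]_(x in `[a, b]) f x + \int[lam]_(x in `[b, c]) f x.
Proof.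
move=> ab bc fi.
have E : `[a, c]%classic = `[a, b] `|` `]b, c].
  by rewrite -itv_bndbnd_setU//= ?bnd_simp.
have F : `[b, c]%classic = [set b] `|` `]b, c].
  by rewrite setU1itv// bnd_simp.
have fbc := integrable_subitv ab (lexx c) fi.
have mo := lebesgue_measurable_itv `]b, c].
have mc := lebesgue_measurable_itv `[a, b].
have mb := borel_lebesgue_measurable (measurable_set1 b).
rewrite F (@Rintegral_setU _ (lebesgueTypeR R) R lam _ _ _ mb mo); first last.
- by apply/disj_setPS => y [/=] ->; rewrite in_itv/= ltxx.
- by rewrite -F.
rewrite [X in _ = _ + (X + _)](_ : _ = 0) ?add0r; last first.
  by rewrite /Rintegral (integral_point bc fbc).
rewrite {1}E (@Rintegral_setU _ (lebesgueTypeR R) R lam _ _ _ mc mo)//.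
- by rewrite -E.
- apply/disj_setPS => y [/=]; rewrite 2!in_itv/= => /andP[_ yx] /andP[].
  by rewrite ltNge yx.
Qed.

Lemma is_derive_continuous f g : (forall x, is_derive x 1 f (g x)) -> continuous f.
Proof.
move=> fg x; apply/differentiable_continuous/derivable1_diffP.
by have [] := fg x.
Qed.

Lemma Rintegral_FTC2 a b G g : a <= b -> continuous g ->
  (forall x, is_derive x 1 G (g x)) ->
  \int[lam]_(x in `[a, b]) g x = G b - G a.
Proof.
move=> ab cg dG; have cG := is_derive_continuous dG.
rewrite /Rintegral integral_continuous//.
case: ltgtP ab => // [ab|<-] _; last first.
  by rewrite set_itv1 integral_set1 subrr.
rewrite (@continuous_FTC2 _ _ G)//.
- exact: continuous_subspaceT.
- split; first by move=> x _; have [] := dG x.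
  + exact/cvg_at_right_filter/cG.
  + exact/cvg_at_left_filter/cG.
- by move=> x _; have [_ <-] := dG x; rewrite derive1E.
Qed.

(** A single primitive on the whole line is obtained from signed integrals
    based at 0. Near x0 it differs by a constant from the integral based at a
    point a to the left of both 0 and x0, to which the fundamental theorem of
    calculus applies. *)
Lemma continuous_primitive g : continuous g ->
  exists G : R -> R, forall x, is_derive x 1 G (g x).
Proof.
move=> cg.
exists (fun x => \int[lam]_(t in `[0, x]) g t - \int[lam]_(t in `[x, 0]) g t) => x0.
pose a := Num.min 0 x0 - 1.
pose Ga x := \int[leb]_(t in `[a, x]) g t.
have GaE x : Ga x = \int[lam]_(t in `[a, x]) g t.
  by rewrite /Ga /Rintegral integral_continuous.
have a0 : a < 0 by rewrite /a ltrBlDr add0r gt_min ltr01.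
have ax0 : a < x0 by rewrite /a ltrBlDr gt_min ltrDl ltr01 orbT.
have [d1 d2] : derivable Ga x0 1 /\ derive1 Ga x0 = g x0.
  apply: (@continuous_FTC1_closed _ _ _ _ (x0 + 1)) => //; first by rewrite ltrDl.
  - apply: continuous_compact_integrable; first exact: segment_compact.
    exact: continuous_subspaceT.
  - exact: cg.
have dGa : is_derive x0 1 (fun x => Ga x - Ga 0) (g x0).
  have : is_derive x0 1 Ga (g x0) by apply: DeriveDef; [exact: d1|rewrite -derive1E].
  move=> ?; apply: is_derive_eq; by rewrite subr0.
apply: (near_eq_is_derive _ dGa).
near=> x.
have ax : a < x by near: x; exact: lt_nbhsr.
rewrite !GaE; have [x0'|x0'] := leP 0 x.
  rewrite [X in _ = _ - X](_ : _ = 0); last first.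
    case: ltgtP x0' => // [x0'|<-] _.
      by rewrite set_itv_ge ?Rintegral_set0// bnd_simp -ltNge.
    by rewrite set_itv1 /Rintegral (@integral_point g 0 0)//; exact: integrable_continuous.
  rewrite (@Rintegral_itv_split a 0 x)//; [ring|exact: ltW|exact: integrable_continuous].
rewrite [X in _ = X - _](_ : _ = 0); last first.
  by rewrite set_itv_ge ?Rintegral_set0// bnd_simp -ltNge.
rewrite (@Rintegral_itv_split a x 0)//; [ring|exact: ltW|exact: ltW|exact: integrable_continuous].
Unshelve. all: by end_near. Qed.

Definition locint f := forall a b, lam.-integrable `[a, b] (EFin \o f).

Definition itg f a b : R := \int[lam]_(x in `[a, b]) f x.

Lemma steklovE h f x : steklov h f x = h^-1 * itg f (x - h / 2) (x + h / 2).
Proof. by []. Qed.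

Lemma continuous_locint g : continuous g -> locint g.
Proof. by move=> cg a b; exact: integrable_continuous. Qed.

Lemma locintD f g : locint f -> locint g -> locint (f \+ g).
Proof.
move=> fi gi a b.
exact: (@integrableD _ (lebesgueTypeR R) R lam _ (lebesgue_measurable_itv _) _ _ (fi a b) (gi a b)).
Qed.

Lemma locintZ c f : locint f -> locint (fun x => c * f x).
Proof.
move=> fi a b.
exact: (@integrableZl _ (lebesgueTypeR R) R lam _ (lebesgue_measurable_itv _) c _ (fi a b)).
Qed.

Lemma locint_abs f : locint f -> locint (fun x => `|f x|).
Proof.
move=> fi a b.
exact: (@integrable_norm _ (lebesgueTypeR R) R lam _ _ (fi a b)).
Qed.

Lemma itgD f g a b : locint f -> locint g ->
  itg (f \+ g) a b = itg f a b + itg g a b.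
Proof.
move=> fi gi.
exact: (@RintegralD _ (lebesgueTypeR R) R lam _ _ _ (lebesgue_measurable_itv _) (fi a b) (gi a b)).
Qed.

Lemma itgZ c f a b : locint f -> itg (fun x => c * f x) a b = c * itg f a b.
Proof.
move=> fi.
exact: (@RintegralZl _ (lebesgueTypeR R) R lam _ _ _ (lebesgue_measurable_itv _) (fi a b)).
Qed.

Lemma itgB f g a b : locint f -> locint g ->
  itg (f \- g) a b = itg f a b - itg g a b.
Proof.
move=> fi gi.
exact: (@RintegralB _ (lebesgueTypeR R) R lam _ _ _ (lebesgue_measurable_itv _) (fi a b) (gi a b)).
Qed.

Lemma itg_le f g a b : locint f -> locint g ->
  (forall x, a <= x <= b -> f x <= g x) -> itg f a b <= itg g a b.
Proof.
move=> fi gi fg.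
apply: (@le_Rintegral _ (lebesgueTypeR R) R lam _ _ _ (lebesgue_measurable_itv _) (fi a b) (gi a b)).
by move=> x; rewrite /= in_itv/=; exact: fg.
Qed.

Lemma itg_ge0 f a b : (forall x, 0 <= f x) -> 0 <= itg f a b.
Proof.
by move=> f0; apply: (@Rintegral_ge0 _ (lebesgueTypeR R) R lam) => x _; exact: f0.
Qed.

Lemma itg_abs f a b : locint f -> `|itg f a b| <= itg (fun x => `|f x|) a b.
Proof.
move=> fi.
exact: (@le_normr_Rintegral _ (lebesgueTypeR R) R lam _ _ (lebesgue_measurable_itv _) (fi a b)).
Qed.

Lemma itg_cst c a b : a <= b -> itg (fun=> c) a b = c * (b - a).
Proof.
move=> ab; rewrite /itg (@Rintegral_cst _ (lebesgueTypeR R) R lam _ (lebesgue_measurable_itv _)).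
by congr (_ * _); exact: (congr1 fine (lam_itv_cc ab)).
Qed.

Lemma itg_split a b c f : locint f -> a <= b -> b <= c ->
  itg f a c = itg f a b + itg f b c.
Proof. by move=> fi ab bc; exact: Rintegral_itv_split ab bc (fi a c). Qed.

Lemma itg_sub f a b c d : locint f -> (forall x, 0 <= f x) ->
  a <= c -> c <= d -> d <= b -> itg f c d <= itg f a b.
Proof.
move=> fi f0 ac cd db.
rewrite (itg_split fi ac (le_trans cd db)) (itg_split fi cd db).
by rewrite addrCA lerDl addr_ge0// itg_ge0.
Qed.

Lemma itg_FTC2 a b G g : a <= b -> continuous g ->
  (forall x, is_derive x 1 G (g x)) -> itg g a b = G b - G a.
Proof. exact: Rintegral_FTC2. Qed.

(** Absolute continuity of the integral, uniformly for subintervals of a fixed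
    compact interval. It makes averages of merely integrable functions
    continuous. *)
Lemma itg_small f c d (e : R) : locint f -> 0 < e ->
  exists2 del : R, 0 < del & forall x y, c <= x -> x <= y -> y <= d ->
    y - x < del -> itg (fun t => `|f t|) x y < e.
Proof.
move=> fi e0.
pose I := `[c, d]%classic : set (lebesgueTypeR R).
have mI : measurable I by exact: lebesgue_measurable_itv.
have ri : lam.-integrable setT (EFin \o (f \_ I)).
  rewrite -restrict_EFin.
  exact: (iffLR (@integrable_mkcond _ (lebesgueTypeR R) R lam _ _ mI) (fi c d)).
(* the absolute continuity available for functions integrable on the whole line
   is applied to f cut off outside [c, d] *)
have [del [del0 H]] := @integral_normr_continuous _ (lebesgueTypeR R) R lam _ ri e e0.
exists del => // x y cx xy yd yxd.
have -> : itg (fun t => `|f t|) x y = \int[lam]_(t in `[x, y]) `|(f \_ I) t|.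
  apply: eq_Rintegral => t; rewrite inE/= in_itv/= => /andP[xt ty].
  by rewrite patchE mem_set//= /I/= in_itv/= (le_trans cx xt) (le_trans ty yd).
apply: H; first exact: lebesgue_measurable_itv.
apply: (@le_lt_trans _ _ (y - x)%:E); last by rewrite lte_fin.
by have /eqP := lam_itv_cc xy; rewrite eq_le => /andP[].
Qed.

End LebesgueIntegral.

(** * Translation invariance and integrals of periodic functions *)

Section Translation.
Context {R : realType}.
Notation lam := (@completed_lebesgue_measure R).
Notation hl := (@wlength R idfun).
Implicit Types (f g : R -> R) (a b c x y h : R).
Local Open Scope ereal_scope.

Definition shift c : R -> R := fun x => (x + c)%R.

Lemma preimage_shift_oc c a b :
  shift c @^-1` `]a, b]%classic = `](a - c)%R, (b - c)%R]%classic.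
Proof.
by apply/seteqP; split=> x /=; rewrite !in_itv/= /shift ltrBlDr lerBrDr.
Qed.

(** The outer measure is an infimum over countable covers by half-open
    intervals; the translates of a cover form a cover of the same total length.
    *)
Lemma outer_shift_le c (A : set R) : (hl^*)%mu (shift c @^-1` A) <= (hl^*)%mu A.
Proof.
apply: ereal_inf_le_tmp => _ [F [mF AF] <-].
exists (fun k => shift c @^-1` F k).
  split.
    by move=> k; have [[a b] _ <-] := mF k; rewrite preimage_shift_oc; exact: is_ocitv.
  by move=> x /AF [k _ Fk]; exists k.
apply: eq_eseriesr => k _; have [[a b] _ <-] := mF k.
rewrite preimage_shift_oc !wlength_itv/= !lte_fin ltrD2r.
by case: ifPn => // _; rewrite -!EFinB opprB addrA subrK.
Qed.

Lemma preimage_shiftK c (A : set R) : shift c @^-1` (shift (- c) @^-1` A) = A.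
Proof. by apply/seteqP; split=> x /=; rewrite /shift addrK. Qed.

Lemma preimage_shiftNK c (A : set R) : shift (- c) @^-1` (shift c @^-1` A) = A.
Proof. by apply/seteqP; split=> x /=; rewrite /shift subrK. Qed.

Lemma outer_shift c (A : set R) : (hl^*)%mu (shift c @^-1` A) = (hl^*)%mu A.
Proof.
apply/eqP; rewrite eq_le outer_shift_le/=.
by rewrite -{1}(preimage_shiftNK c A) outer_shift_le.
Qed.

(** Translation invariance of the outer measure transports Caratheodory's
    condition, tested on a set Y, to the same condition tested on a translate
    of Y. *)
Lemma measurable_shift c : measurable_fun [set: lebesgueTypeR R]
  (shift c : lebesgueTypeR R -> lebesgueTypeR R).
Proof.
move=> _ A mA; rewrite setTI.
suff H : (hl^*)%mu.-caratheodory (shift c @^-1` A) by exact: H.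
move=> Y.
have E (B : set R) : Y `&` shift c @^-1` B = shift c @^-1` (shift (- c) @^-1` Y `&` B).
  by rewrite preimage_setI preimage_shiftK.
have H := mA (shift (- c) @^-1` Y).
transitivity ((hl^*)%mu (shift (- c) @^-1` Y)); first exact/esym/outer_shift.
have EC : ~` (shift c @^-1` A) = shift c @^-1` (~` A) by [].
by rewrite EC !E !(outer_shift c); exact: H.
Qed.

Lemma integral_shift c (D : set R) (u : R -> \bar R) :
  measurable (D : set (lebesgueTypeR R)) ->
  measurable_fun (D : set (lebesgueTypeR R)) u -> (forall x, 0 <= u x) ->
  \int[lam]_(x in D) u x = \int[lam]_(x in shift c @^-1` D) u (x + c)%R.
Proof.
move=> mD mu u0.
have /= := @ge0_integral_pushforward _ _ (lebesgueTypeR R) (lebesgueTypeR R) R _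
  (measurable_shift c) lam D u mD mu (fun y _ => u0 y).
move=> <-.
pose m : {measure set (lebesgueTypeR R) -> \bar R} :=
  measure_function_pushforward__canonical__measure_function_Measure lam
    (measurable_shift c).
apply: (@eq_measure_integral _ (lebesgueTypeR R) R D m) => A mA _.
exact/esym/outer_shift.
Qed.

Lemma integrable_setU f (A B : set R) :
  measurable (A : set (lebesgueTypeR R)) -> measurable (B : set (lebesgueTypeR R)) ->
  measurable_fun [set: lebesgueTypeR R] f ->
  lam.-integrable A (EFin \o f) -> lam.-integrable B (EFin \o f) ->
  lam.-integrable (A `|` B) (EFin \o f).
Proof.
move=> mA mB mf /integrableP[_ fA] fB.
have mf' D : measurable_fun (D : set (lebesgueTypeR R)) (EFin \o f).
  by apply: (@measurable_funTS _ _ (lebesgueTypeR R)); exact/measurable_EFinP.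
have mBA : measurable ((B `\` A) : set (lebesgueTypeR R)) by exact: measurableD.
have /integrableP[_ fBA] := @integrableS _ (lebesgueTypeR R) R lam B (B `\` A) _ mB mBA (@subDsetl _ B A) fB.
apply/integrableP; split; first exact: mf'.
have -> : A `|` B = A `|` (B `\` A) by rewrite setUDr setDv setD0.
rewrite (@ge0_integral_setU _ (lebesgueTypeR R) R lam A (B `\` A) mA mBA).
- exact: lte_add_pinfty.
- by apply: (@measurableT_comp _ _ _ (lebesgueTypeR R)); last exact: mf'.
- by move=> x _; exact: abse_ge0.
- by apply/disj_setPS => x [/= Ax []].
Qed.

End Translation.

Section Periodic.
Context {R : realType}.
Notation lam := (@completed_lebesgue_measure R).
Implicit Types (f g : R -> R) (a b c x y h : R).

Lemma circle_fun_int f (j : int) x : circle_fun f -> f (x + j%:~R * (2 * pi)) = f x.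
Proof.
move=> pf.
have pn (n : nat) y : f (y + n%:R * (2 * pi)) = f y.
  elim: n y => [|n IH] y; first by rewrite mul0r addr0.
  by rewrite -natr1 mulrDl mul1r addrA pf IH.
case: j => n; first exact: pn.
by rewrite NegzE mulrNz mulNr -[LHS](pn n.+1) subrK.
Qed.

(** The window [-pi, pi) is enlarged by one period on each side at every step,
    as the union of its translates by -2pi, 0 and 2pi. *)
Lemma integrable_period f : circle_measurable_fun f ->
  lam.-integrable `[(- pi), pi[ (EFin \o f) -> locint f.
Proof.
move=> [pf mf] fi.
have mI a b : measurable (`[a, b[%classic : set (lebesgueTypeR R)).
  exact: lebesgue_measurable_itv.
have mf' D : measurable_fun (D : set (lebesgueTypeR R)) (EFin \o f).
  by apply: (@measurable_funTS _ _ (lebesgueTypeR R)); exact/measurable_EFinP.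
have sh (j : int) a b : lam.-integrable `[a, b[ (EFin \o f) ->
    lam.-integrable `[(a + j%:~R * (2 * pi)), (b + j%:~R * (2 * pi))[ (EFin \o f).
  move=> /integrableP[_ fab]; apply/integrableP; split; first exact: mf'.
  have mfa D : measurable_fun (D : set (lebesgueTypeR R)) (fun x => `|(EFin \o f) x|%E).
    by apply: (@measurableT_comp _ _ _ (lebesgueTypeR R)); last exact: mf'.
  rewrite (integral_shift (j%:~R * (2 * pi)) (mI _ _) (mfa _) (fun x => abse_ge0 (EFin (f x)))).
  rewrite (_ : _ @^-1` _ = `[a, b[%classic); last first.
    by apply/seteqP; split=> x /=; rewrite !in_itv/= /shift lerD2r ltrD2r.
  apply: le_lt_trans fab; rewrite le_eqVlt; apply/orP; left; apply/eqP.
  by apply: eq_integral => x _; rewrite /= circle_fun_int.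
have H (n : nat) : lam.-integrable
    `[(- pi - n%:R * (2 * pi)), (pi + n%:R * (2 * pi))[ (EFin \o f).
  elim: n => [|n IH]; first by rewrite mul0r subr0 addr0.
  pose a : R := - pi - n%:R * (2 * pi); pose b : R := pi + n%:R * (2 * pi).
  have {}IH : lam.-integrable `[a, b[ (EFin \o f) by exact: IH.
  have ab : a + 2 * pi <= b.
    rewrite /a /b; have : 0 <= (n%:R : R) * (2 * pi) by rewrite !mulr_ge0 ?pi_ge0.
    lra.
  have pi0 := @pi_gt0 R.
  have -> : `[(- pi - n.+1%:R * (2 * pi)), (pi + n.+1%:R * (2 * pi))[%classic =
     `[(a - 2 * pi), (b - 2 * pi)[ `|` `[a, b[ `|` `[(a + 2 * pi), (b + 2 * pi)[ :> set R.
    rewrite -natr1 mulrDl mul1r.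
    apply/seteqP; split=> x /=; rewrite !in_itv/=.
      move=> /andP[x1 x2]; have [x3|x3] := ltP x a.
        by left; left; apply/andP; split; move: ab x1 x2 x3; rewrite /a /b; lra.
      have [x4|x4] := ltP x b; first by left; right.
      by right; apply/andP; split; move: ab x1 x2 x3 x4; rewrite /a /b; lra.
    rewrite /a /b in ab *.
    by case=> [[]|] /andP[x1 x2]; apply/andP; split; lra.
  apply: integrable_setU; rewrite ?/setU/=; [|exact: mI|exact: mf| |].
  - by apply: (@measurableU _ (lebesgueTypeR R)); exact: mI.
  - apply: integrable_setU; [exact: mI|exact: mI|exact: mf| |exact: IH].
    by have := sh (-1) _ _ IH; rewrite mulN1r.
  - by have := sh 1 _ _ IH; rewrite mul1r.
move=> a b.
have [n Hn] : exists n : nat, `|a| + `|b| < n%:R :> R.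
  exists (Num.truncn (`|a| + `|b|)).+1; exact: truncnS_gt.
have pi1 := @pi_ge2 R.
have na : `|a| + `|b| <= n%:R * (2 * pi).
  rewrite (le_trans (ltW Hn))// ler_peMr//; lra.
apply: (@integrableS _ (lebesgueTypeR R) R lam _ _ _ _ _ _ (H n)) => //.
  exact: lebesgue_measurable_itv.
move=> x /=; rewrite !in_itv/= => /andP[ax xb].
have := ler_norm (- a); have := ler_norm b; rewrite normrN => n1 n2.
have := normr_ge0 a; have := normr_ge0 b => n3 n4.
by apply/andP; split; lra.
Qed.

End Periodic.

(** * Banach lattices on the circle *)

Section Lattice.
Context {R : realType}.
Notation lam := (@completed_lebesgue_measure R).
Context (X : set (R -> R)) (N : (R -> R) -> R).
Context (hX : banach_lattice X N).
Implicit Types (f g : R -> R) (a b c x y h : R).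

Lemma lat_dom f g : circle_measurable_fun f -> X g ->
  (forall x, `|f x| <= `|g x|) -> X f /\ N f <= N g.
Proof. by move=> mf Xg fg; apply: (bl_ideal hX) => //; exact: aeW. Qed.

Lemma lat_add f g : X f -> X g -> X (f \+ g).
Proof. exact: (bl_add hX). Qed.

Lemma lat_scale c f : X f -> X (fun x => c * f x).
Proof. exact: (bl_scale hX). Qed.

Lemma lat_sub f g : X f -> X g -> X (f \- g).
Proof.
move=> Xf Xg; have := lat_add Xf (lat_scale (-1) Xg).
by congr X; apply/funext => x /=; rewrite mulN1r.
Qed.

Lemma norm_add f g : X f -> X g -> N (f \+ g) <= N f + N g.
Proof. exact: (bl_norm_triangle hX). Qed.

Lemma norm_scale c f : X f -> N (fun x => c * f x) = `|c| * N f.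
Proof. exact: (bl_norm_scale hX). Qed.

Lemma norm_sub f g : X f -> X g -> N (f \- g) <= N f + N g.
Proof.
move=> Xf Xg.
have -> : f \- g = f \+ (fun x => (-1) * g x) by apply/funext => x /=; rewrite mulN1r.
apply: le_trans (norm_add Xf (lat_scale (-1) Xg)) _.
by rewrite norm_scale// normrN1 mul1r.
Qed.

Lemma norm_ge0 f : X f -> 0 <= N f.
Proof.
move=> Xf; have := norm_sub Xf Xf.
have -> : f \- f = (fun x => 0 * f x) by apply/funext => x /=; rewrite mul0r subrr.
by rewrite norm_scale// normr0 mul0r -mulr2n pmulrn_lge0.
Qed.

Lemma norm_triangle f g : X f -> X g -> N f <= N g + N (f \- g).
Proof.
move=> Xf Xg; apply: le_trans (norm_add Xg (lat_sub Xf Xg)).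
by rewrite le_eqVlt; apply/orP; left; apply/eqP; congr N; apply/funext => x /=; rewrite addrC subrK.
Qed.

Lemma lat_abs f : X f -> X (fun x => `|f x|).
Proof.
move=> Xf; have [pf mf] := bl_measurable hX Xf.
apply: (proj1 (lat_dom (f := fun x => `|f x|) _ Xf _)) => [|x]; last by rewrite normr_id.
split; first by move=> x; rewrite pf.
by apply: (@measurableT_comp _ _ _ (lebesgueTypeR R)) => //; exact: measurable_normr.
Qed.

Lemma norm_abs f : X f -> N (fun x => `|f x|) = N f.
Proof.
move=> Xf; have Xa := lat_abs Xf.
apply/eqP; rewrite eq_le; apply/andP; split.
- apply: (proj2 (lat_dom (bl_measurable hX Xa) Xf _)) => x; by rewrite normr_id.
- apply: (proj2 (lat_dom (bl_measurable hX Xf) Xa _)) => x; by rewrite normr_id.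
Qed.

Lemma circle_measure_finite (E : set (lebesgueTypeR R)) : measurable E ->
  (circle_measure E < +oo)%E.
Proof.
move=> mE; apply: (@le_lt_trans _ _ (circle_measure setT)).
  by apply: le_measure; rewrite ?inE//; exact: measurableT.
pose I : set (lebesgueTypeR R) := `[(- pi), pi[%classic.
have -> : circle_measure [set: lebesgueTypeR R] =
    (((2 * pi)^-1)%:E * lam ([set: lebesgueTypeR R] `&` I))%E by [].
have L : lam `[(- pi), pi[%classic = (pi - - pi)%:E.
  rewrite -[LHS]lebesgue_completed lebesgue_measure_itv/= lte_fin.
  by rewrite ifT// (lt_trans (_ : _ < 0)) ?oppr_lt0 ?pi_gt0.
by rewrite setTI [lam I]L -EFinM ltry.
Qed.

Lemma lat_indic (E : set (lebesgueTypeR R)) : measurable E -> circle_set E ->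
  X \1_E.
Proof.
by move=> mE cE; have [] := bl_indic hX mE cE (circle_measure_finite mE).
Qed.

Lemma lat_cst c : X (fun=> c).
Proof.
have X1 : X \1_(setT : set (lebesgueTypeR R)) by apply: lat_indic => //; exact: measurableT.
have := lat_scale c X1; congr X; apply/funext => x.
by rewrite indicE in_setT mulr1.
Qed.

Lemma lat_bounded f c : circle_measurable_fun f -> (forall x, `|f x| <= c) -> X f.
Proof.
move=> mf fc; apply: (proj1 (lat_dom mf (lat_cst c) _)) => x.
exact: le_trans (fc x) (ler_norm c).
Qed.

Lemma norm0 : N (fun=> 0) = 0.
Proof.
by have := norm_scale 0 (lat_cst 0); rewrite normr0 !mul0r.
Qed.

Lemma circle_shift a x : exists j : int, a <= x + j%:~R * (2 * pi) < a + 2 * pi.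
Proof.
have pi0 : 0 < 2 * pi :> R by rewrite mulr_gt0// pi_gt0.
exists (- Num.floor ((x - a) / (2 * pi))).
rewrite mulrNz mulNr.
have /andP[l u] := floor_itv ((x - a) / (2 * pi)).
move: l u; rewrite ler_pdivlMr// ltr_pdivrMr//.
rewrite (_ : (_ + 1)%:~R = (Num.floor ((x - a) / (2 * pi)))%:~R + 1); last by rewrite intrD.
by move=> l u; apply/andP; split; lra.
Qed.

Lemma continuous_circle_bounded g : circle_fun g -> continuous g ->
  exists c, forall x, `|g x| <= c.
Proof.
move=> pg cg; have pi0 := @pi_gt0 R.
have [||z _ zP] := @EVT_max R (fun x => `|g x|) (- pi) pi.
- lra.
- by apply: continuous_subspaceT => x; apply: continuous_comp; [exact: cg|exact: norm_continuous].
exists `|g z| => x.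
have [j /andP[j1 j2]] := circle_shift (- pi) x.
rewrite -(circle_fun_int j x pg); apply: zP; rewrite in_itv/= j1/=; lra.
Qed.

Lemma lat_continuous g : circle_fun g -> continuous g -> X g.
Proof.
move=> pg cg; have [c gc] := continuous_circle_bounded pg cg.
by apply: lat_bounded gc; split => //; exact: continuous_lebesgue_measurable.
Qed.

(** The integral axiom for the whole circle bounds the integral of |f| over one
    period. *)
Lemma lat_locint f : X f -> locint f.
Proof.
move=> Xf; have [pf mf] := bl_measurable hX Xf.
apply: integrable_period => //.
have [_ [c c0 H]] := @bl_indic _ _ _ hX (setT : set (lebesgueTypeR R))
  (@measurableT _ (lebesgueTypeR R)) (fun x => conj (fun i => i) (fun i => i))
  (circle_measure_finite (@measurableT _ (lebesgueTypeR R))).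
have {H} := H f Xf.
pose I : set (lebesgueTypeR R) := `[(- pi), pi[%classic.
have mI : measurable I by exact: lebesgue_measurable_itv.
have mE : measurable_fun [set: lebesgueTypeR R] (EFin \o f) by exact/measurable_EFinP.
have mf' D : measurable_fun (D : set (lebesgueTypeR R)) (fun x => `|f x|%:E).
  by apply: (@measurable_funTS _ _ (lebesgueTypeR R)); apply: (@measurableT_comp _ _ _ (lebesgueTypeR R) _ _ abse _ (EFin \o f)) => //; exact: abse_measurable.
move=> H; apply/integrableP; split.
  exact: (@measurable_funTS _ _ (lebesgueTypeR R)).
have le1 : (\int[circle_measure]_(x in I) `|f x|%:E <= (c * N f)%:E)%E.
  apply: le_trans H; apply: (@ge0_subset_integral _ (lebesgueTypeR R)) => //; exact: measurableT.
have E : (\int[circle_measure]_(x in I) `|f x|%:E =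
   ((2 * pi)^-1)%:E * \int[lam]_(x in I) `|f x|%:E)%E.
  rewrite -(@ge0_integral_mscale _ (lebesgueTypeR R) R lam I mI (NngNum (@inv2pi_ge0 R)) (fun x => `|f x|%:E))//.
  apply: (@eq_measure_integral _ (lebesgueTypeR R)) => A mA AI.
  have -> : circle_measure A = (((2 * pi)^-1)%:E * lam (A `&` I))%E by [].
  by rewrite setIidl.
have pi0 : 0 < (2 * pi)^-1 :> R by rewrite invr_gt0 mulr_gt0// pi_gt0.
rewrite E in le1.
rewrite (_ : (\int[lam]_(x in I) `|(EFin \o f) x| = \int[lam]_(x in I) `|f x|%:E)%E) //.
rewrite -(@lte_pmul2l _ ((2 * pi)^-1)%:E) ?lte_fin//.
by rewrite gt0_muley ?lte_fin//; exact: le_lt_trans le1 (ltry _).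
Qed.

End Lattice.

(** * Averages over shifted windows and smooth periodic functions *)

Section Averages.
Context {R : realType}.
Implicit Types (f g : R -> R) (a b c x y h : R).

(** All Steklov averages are averages over a window [x + a, x + b] that moves
    with x; the centred and the forward one differ only by the choice of a and
    b. *)
Definition avg a b f : R -> R := fun x => (b - a)^-1 * itg f (x + a) (x + b).

Lemma avg_steklov a b f x : avg a b f x = steklov (b - a) f (x + (a + b) / 2).
Proof.
rewrite steklovE /avg.
have -> : x + (a + b) / 2 - (b - a) / 2 = x + a by field.
by have -> : x + (a + b) / 2 + (b - a) / 2 = x + b by field.
Qed.

Lemma steklov_avg h : steklov h = avg (- (h / 2)) (h / 2) :> ((R -> R) -> R -> R).
Proof.
apply/funext => f; apply/funext => x.
rewrite avg_steklov.
have -> : h / 2 - - (h / 2) = h by field.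
by rewrite addNr mul0r addr0.
Qed.

Lemma steklov_dot_avg h : steklov_dot h = avg 0 h :> ((R -> R) -> R -> R).
Proof.
apply/funext => f; apply/funext => x.
by rewrite avg_steklov /steklov_dot subr0 add0r.
Qed.

Lemma avgB a b f g : locint f -> locint g -> avg a b (f \- g) = avg a b f \- avg a b g.
Proof. by move=> fi gi; apply/funext => x; rewrite /avg/= itgB// mulrBr. Qed.

Lemma avgZ a b c f : locint f -> avg a b (fun x => c * f x) = (fun x => c * avg a b f x).
Proof. by move=> fi; apply/funext => x; rewrite /avg/= itgZ// mulrCA. Qed.

(** The mechanism by which everything is brought under Assumption A: an
    integral over any interval inside the window of length H around c is at
    most H times the centred average of |f| at c. *)
Lemma le_itg_steklov f a b c H : locint f -> 0 < H -> a <= b ->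
  c - H / 2 <= a -> b <= c + H / 2 ->
  `|itg f a b| <= H * steklov H (fun x => `|f x|) c.
Proof.
move=> fi H0 ab ca bc; apply: le_trans (itg_abs _ _ fi) _.
rewrite steklovE mulrA divff ?gt_eqF// mul1r.
by apply: itg_sub => //; exact: locint_abs.
Qed.

Lemma steklov_ge0 h f x : 0 < h -> (forall t, 0 <= f t) -> 0 <= steklov h f x.
Proof. by move=> h0 f0; rewrite steklovE mulr_ge0 ?invr_ge0 ?(ltW h0)//; exact: itg_ge0. Qed.

Lemma continuous_avg f a b : locint f -> a <= b -> continuous (avg a b f).
Proof.
move=> fi ab x0.
suff cF : {for x0, continuous (fun x => itg f (x + a) (x + b))}.
  by apply: cvgM; [exact: cvg_cst|exact: cF].
pose L := x0 + a - 1; pose M := x0 + b + 1.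
apply/cvgrPdist_lt => e e0.
have e20 : 0 < e / 2 by rewrite divr_gt0.
have [del del0 H] := itg_small L M fi e20.
pose Q x := itg f L x.
have QP u v : L <= u -> u <= v -> v <= M -> v - u < del -> `|Q v - Q u| < e / 2.
  move=> Lu uv vM vu; rewrite /Q (itg_split fi Lu uv) addrAC subrr add0r.
  by apply: le_lt_trans (itg_abs _ _ fi) _; exact: H.
have QQ u v : L <= u <= M -> L <= v <= M -> `|v - u| < del -> `|Q v - Q u| < e / 2.
  move=> /andP[Lu uM] /andP[Lv vM]; have [uv|/ltW vu] := leP u v.
    by rewrite ger0_norm ?subr_ge0//; exact: QP.
  by rewrite distrC [X in _ -> X < _]distrC ger0_norm ?subr_ge0//; exact: QP.
near=> x.
have x1 : `|x0 - x| < 1.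
  by near: x; exact: cvgr_dist_lt (@cvg_id _ (nbhs x0)) _ ltr01.
have xd : `|x0 - x| < del.
  by near: x; exact: cvgr_dist_lt (@cvg_id _ (nbhs x0)) _ del0.
move: (x1); rewrite ltr_norml => /andP[x1l x1u].
have FE y : L <= y + a -> itg f (y + a) (y + b) = Q (y + b) - Q (y + a).
  move=> Ly; have yy : y + a <= y + b by rewrite lerD2l.
  by rewrite /Q (itg_split fi Ly yy) addrAC subrr add0r.
rewrite !FE; [|rewrite /L; lra|rewrite /L; lra].
have q1 : `|Q (x0 + b) - Q (x + b)| < e / 2.
  by apply: QQ; [rewrite /L /M; apply/andP; split; lra|rewrite /L /M; apply/andP; split; lra|rewrite opprD addrACA subrr addr0].
have q2 : `|Q (x0 + a) - Q (x + a)| < e / 2.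
  by apply: QQ; [rewrite /L /M; apply/andP; split; lra|rewrite /L /M; apply/andP; split; lra|rewrite opprD addrACA subrr addr0].
have -> : Q (x0 + b) - Q (x0 + a) - (Q (x + b) - Q (x + a)) =
  (Q (x0 + b) - Q (x + b)) - (Q (x0 + a) - Q (x + a)) by ring.
by apply: le_lt_trans (ler_normB _ _) _; rewrite (splitr e) ltrD.
Unshelve. all: by end_near. Qed.

Lemma is_derive_shift g a (dg : R) x : is_derive (x + a) 1 g dg ->
  is_derive x 1 (fun y => g (y + a)) dg.
Proof.
move=> dgx.
have := @is_derive1_comp R g (fun y : R => y + a) x dg 1 dgx.
by rewrite mulr1; apply; apply: is_derive_eq; rewrite addr0.
Qed.

Lemma is_derive_avg g a b x : a <= b -> continuous g ->
  is_derive x 1 (avg a b g) ((b - a)^-1 * (g (x + b) - g (x + a))).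
Proof.
move=> ab cg; have [G dG] := continuous_primitive cg.
have -> : avg a b g = fun x => (b - a)^-1 * (G (x + b) - G (x + a)).
  by apply/funext => y; rewrite /avg (itg_FTC2 _ cg dG)// lerD2l.
have d1 := is_derive_shift (dG (x + b)).
have d2 := is_derive_shift (dG (x + a)).
have := is_deriveZ (b - a)^-1 (is_deriveB d1 d2).
by [].
Qed.

Fixpoint smooth (p : nat) g : Prop := [/\ circle_fun g, continuous g &
  if p is q.+1 then (forall x, derivable g x 1) /\ smooth q (derive1 g) else True].

Lemma smooth_circle p g : smooth p g -> circle_fun g.
Proof. by case: p => [|p] []. Qed.

Lemma smooth_continuous p g : smooth p g -> continuous g.
Proof. by case: p => [|p] []. Qed.

Lemma smooth_locint p g : smooth p g -> locint g.
Proof. by move=> /smooth_continuous; exact: continuous_locint. Qed.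

Lemma smoothS p g : smooth p.+1 g -> smooth p g.
Proof.
elim: p g => [|p IH] g [pg cg [dg sg]]; first by split.
by split => //; split => //; exact: IH.
Qed.

Lemma smooth_leq p q g : (q <= p)%N -> smooth p g -> smooth q g.
Proof.
elim: p => [|p IH]; first by rewrite leqn0 => /eqP ->.
by rewrite leq_eqVlt => /orP[/eqP->//|qp] /smoothS; exact: IH.
Qed.

Lemma smooth_is_derive p g x : smooth p.+1 g -> is_derive x 1 g (derive1 g x).
Proof. by move=> [_ _ [dg _]]; apply: DeriveDef; [exact: dg|rewrite derive1E]. Qed.

Lemma smooth_derive1 p g : smooth p.+1 g -> smooth p (derive1 g).
Proof. by case=> _ _ []. Qed.

Lemma derive1_eq g g' : (forall x, is_derive x 1 g (g' x)) -> derive1 g = g'.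
Proof. by move=> gg'; apply/funext => x; rewrite derive1E; have [_ ->] := gg' x. Qed.

Lemma smooth_intro p g g' : circle_fun g -> (forall x, is_derive x 1 g (g' x)) ->
  smooth p g' -> smooth p.+1 g.
Proof.
move=> pg dg sg'; split=> //; first exact: is_derive_continuous dg.
by split; [move=> x; have [] := dg x|rewrite (derive1_eq dg)].
Qed.

Lemma itg_derive1 p g a b : a <= b -> smooth p.+1 g -> itg (derive1 g) a b = g b - g a.
Proof.
move=> ab sg; apply: itg_FTC2 => //; last by move=> x; exact: smooth_is_derive sg.
exact: smooth_continuous (smooth_derive1 sg).
Qed.

(** The derivative of a difference is computed together with its smoothness,
    because the smoothness at order p + 1 requires the formula for the
    derivative. *)
Lemma smoothB_derive1B p g k : smooth p g -> smooth p k -> smooth p (g \- k) /\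
  ((0 < p)%N -> derive1 (g \- k) = derive1 g \- derive1 k).
Proof.
elim: p g k => [|p IH] g k sg sk.
  split=> //; split => //; first by move=> x /=; rewrite (smooth_circle sg) (smooth_circle sk).
  by move=> x; apply: cvgB; [exact: (smooth_continuous sg)|exact: (smooth_continuous sk)].
have D x : is_derive x 1 (g \- k) ((derive1 g \- derive1 k) x).
  exact: is_deriveB (smooth_is_derive x sg) (smooth_is_derive x sk).
split; last by move=> _; exact: derive1_eq.
apply: smooth_intro D _.
  by move=> x /=; rewrite (smooth_circle sg) (smooth_circle sk).
by have [] := IH _ _ (smooth_derive1 sg) (smooth_derive1 sk).
Qed.

Lemma smoothB p g k : smooth p g -> smooth p k -> smooth p (g \- k).
Proof. by move=> sg sk; have [] := smoothB_derive1B sg sk. Qed.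

Lemma derive1B p g k : smooth p.+1 g -> smooth p.+1 k ->
  derive1 (g \- k) = derive1 g \- derive1 k.
Proof. by move=> sg sk; have [_ ->] := smoothB_derive1B sg sk. Qed.

Lemma smoothZ_derive1Z p g c : smooth p g -> smooth p (fun x => c * g x) /\
  ((0 < p)%N -> derive1 (fun x => c * g x) = fun x => c * derive1 g x).
Proof.
elim: p g => [|p IH] g sg.
  split=> //; split => //; first by move=> x /=; rewrite (smooth_circle sg).
  by move=> x; apply: cvgM; [exact: cvg_cst|exact: (smooth_continuous sg)].
have D x : is_derive x 1 (fun x => c * g x) (c * derive1 g x).
  exact: is_deriveZ (smooth_is_derive x sg).
split; last by move=> _; exact: derive1_eq.
apply: smooth_intro D _; first by move=> x /=; rewrite (smooth_circle sg).
by have [] := IH _ (smooth_derive1 sg).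
Qed.

Lemma smoothZ p c g : smooth p g -> smooth p (fun x => c * g x).
Proof. by move=> sg; have [] := smoothZ_derive1Z c sg. Qed.

Lemma derive1Z p c g : smooth p.+1 g ->
  derive1 (fun x => c * g x) = fun x => c * derive1 g x.
Proof. by move=> sg; have [_ ->] := smoothZ_derive1Z c sg. Qed.

Lemma smooth_derive1n p i g : smooth (i + p) g -> smooth p (derive1n i g).
Proof.
elim: i g => [|i IH] g // sg.
by rewrite derive1Sn; apply: IH; exact: smooth_derive1.
Qed.

Lemma derive1nB p g k : smooth p g -> smooth p k ->
  derive1n p (g \- k) = derive1n p g \- derive1n p k.
Proof.
elim: p g k => [|p IH] g k sg sk //.
rewrite !derive1Sn (derive1B sg sk) IH//; exact: smooth_derive1.
Qed.

Lemma avg_derive1 p g a b : a <= b -> smooth p.+1 g ->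
  derive1 (avg a b g) = avg a b (derive1 g).
Proof.
move=> ab sg; have cg := smooth_continuous sg.
rewrite (derive1_eq (fun x => is_derive_avg x ab cg)).
by apply/funext => x; rewrite /avg (itg_derive1 _ sg)// lerD2l.
Qed.

End Averages.

(** * Steklov averages as bounded operators commuting with differentiation *)

Section SteklovOperators.
Context {R : realType} (X : set (R -> R)) (N : (R -> R) -> R).
Context (hX : banach_lattice X N) (hA : assumptionA X N).
Implicit Types (f g : R -> R) (a b c x y h : R).

(** Assumption A bounds the norm only on the unit ball. Scaling extends it to
    nonzero norm; if N f = 0, all multiples of f lie in the unit ball, which
    forces N (steklov h f) = 0. The bound 1 <= C is a convenience that keeps
    later constants nonnegative. *)
Lemma steklov_bounded : exists2 C : R, 1 <= C &
  forall h f, 0 < h -> X f -> N (steklov h f) <= C * N f.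
Proof.
have [_ [C hC]] := hA.
exists (Num.max 1 C); first by rewrite le_max lexx.
move=> h f h0 Xf.
have XS := proj1 hA h f h0 Xf.
have SZ c : N (steklov h (fun x => c * f x)) = `|c| * N (steklov h f).
  rewrite -(norm_scale hX)//; congr N; rewrite steklov_avg avgZ//.
  exact: (lat_locint hX).
have [N0|N0] := eqVneq (N f) 0; last first.
  have Np : 0 < N f by rewrite lt_neqAle eq_sym N0 (norm_ge0 hX).
  have := hC h _ h0 (lat_scale hX (N f)^-1 Xf).
  rewrite (norm_scale hX)// SZ ger0_norm ?invr_ge0 ?(ltW Np)// mulVf// => /(_ (lexx 1)).
  rewrite ler_pdivrMl// => H.
  apply: le_trans H _; rewrite mulrC ler_wpM2r ?(ltW Np)//.
  by rewrite le_max lexx orbT.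
rewrite N0 mulr0 leNgt; apply/negP => Sp.
have H c : `|c| * N (steklov h f) <= C.
  rewrite -SZ; apply: hC => //; first exact: (lat_scale hX).
  by rewrite (norm_scale hX)// N0 mulr0.
have := H ((`|C| + 1) / N (steklov h f)).
rewrite ger0_norm ?divr_ge0 ?addr_ge0 ?(ltW Sp)// divfK ?gt_eqF//.
by have := ler_norm C; lra.
Qed.

Context (C : R) (C_ge1 : 1 <= C).
Context (steklov_le : forall h f, 0 < h -> X f -> N (steklov h f) <= C * N f).

Lemma C_gt0 : 0 < C. Proof. exact: lt_le_trans ltr01 C_ge1. Qed.

(** Membership in X comes from domination by the average of |f| over a centred
    window long enough to contain [a, b]. *)
Lemma lat_avg a b f : a < b -> X f -> X (avg a b f).
Proof.
move=> ab Xf; have fi := lat_locint hX Xf.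
pose H := 2 * (`|a| + `|b|) + (b - a).
have H0 : 0 < H.
  have := normr_ge0 a; have := normr_ge0 b; rewrite /H; lra.
have XS := proj1 hA H _ H0 (lat_abs hX Xf).
apply: (proj1 (lat_dom hX (f := avg a b f) _ (lat_scale hX ((b - a)^-1 * H) XS) _)).
- split; last by apply: continuous_lebesgue_measurable; apply: continuous_avg => //; exact: ltW.
  move=> x; rewrite !avg_steklov.
  rewrite addrAC.
  have ba : 0 < b - a by rewrite subr_gt0.
  exact: (proj1 (bl_measurable hX (proj1 hA (b - a) f ba Xf))).
- move=> x; rewrite /avg normrM ger0_norm ?invr_ge0 ?subr_ge0 ?(ltW ab)//.
  apply: le_trans (ler_norm _); rewrite -mulrA ler_wpM2l ?invr_ge0 ?subr_ge0 ?(ltW ab)//.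
  apply: le_itg_steklov => //; first by rewrite lerD2l (ltW ab).
  + have := ler_norm (- a); rewrite normrN.
    by have := normr_ge0 b; rewrite /H; lra.
  + by have := ler_norm b; have := normr_ge0 a; rewrite /H; lra.
Qed.

Lemma norm_itg_le a b H f : 0 < H -> a < b -> - (H / 2) <= a -> b <= H / 2 -> X f ->
  X (fun x => itg f (x + a) (x + b)) /\ N (fun x => itg f (x + a) (x + b)) <= H * C * N f.
Proof.
move=> H0 ab Ha bH Xf; have fi := lat_locint hX Xf.
have ba : 0 < b - a by rewrite subr_gt0.
have E : (fun x => itg f (x + a) (x + b)) = fun x => (b - a) * avg a b f x.
  by apply/funext => x; rewrite /avg mulrA divff ?gt_eqF// mul1r.
have XS := proj1 hA H _ H0 (lat_abs hX Xf).
have XI : X (fun x => itg f (x + a) (x + b)).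
  by rewrite E; apply: (lat_scale hX); exact: lat_avg.
split=> //.
have [_ le1] := lat_dom hX (bl_measurable hX XI) (lat_scale hX H XS) (fun x =>
  le_trans (le_itg_steklov (c := x) fi H0 (lerD (lexx x) (ltW ab)) (lerD (lexx x) Ha) (lerD (lexx x) bH))
   (ler_norm _)).
apply: (le_trans le1); rewrite (norm_scale hX)// gtr0_norm// -mulrA ler_pM2l//.
by rewrite -(norm_abs hX Xf); apply: steklov_le => //; exact: (lat_abs hX).
Qed.

Lemma norm_avg_le a b H f : 0 < H -> a < b -> - (H / 2) <= a -> b <= H / 2 -> X f ->
  N (avg a b f) <= H / (b - a) * C * N f.
Proof.
move=> H0 ab Ha bH Xf; have [XI le1] := norm_itg_le H0 ab Ha bH Xf.
rewrite /avg (norm_scale hX)// gtr0_norm ?invr_gt0 ?subr_gt0//.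
by rewrite -!mulrA mulrCA ler_pM2l ?invr_gt0 ?subr_gt0// mulrA.
Qed.

Lemma smooth_avg p a b g : a < b -> smooth p g -> smooth p (avg a b g).
Proof.
move=> ab; elim: p g => [|p IH] g sg.
  have Xg : X g by apply: (lat_continuous hX); [exact: smooth_circle sg|exact: smooth_continuous sg].
  split => //; first exact: (proj1 (bl_measurable hX (lat_avg ab Xg))).
  by apply: continuous_avg; [exact: smooth_locint sg|exact: ltW].
have cg := smooth_continuous sg.
have Xg : X g by apply: (lat_continuous hX); [exact: smooth_circle sg|exact: smooth_continuous sg].
split; first exact: (proj1 (bl_measurable hX (lat_avg ab Xg))).
- by apply: continuous_avg; [exact: smooth_locint sg|exact: ltW].
- split; first by move=> x; have [] := is_derive_avg x (ltW ab) cg.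
  by rewrite (avg_derive1 (ltW ab) sg); apply: IH; exact: smooth_derive1.
Qed.

Lemma smooth_lat p g : smooth p g -> X g.
Proof. by move=> sg; apply: (lat_continuous hX); [exact: smooth_circle sg|exact: smooth_continuous sg]. Qed.

(** Commutation with D lets an estimate for functions with q derivatives be
    iterated to one with r q derivatives. *)
Record smooth_op (T : (R -> R) -> R -> R) : Prop := SmoothOp {
  so_smooth : forall p g, smooth p g -> smooth p (T g) ;
  so_derive1 : forall g, smooth 1 g -> derive1 (T g) = T (derive1 g) }.

(** Operators on X with norm at most c that also preserve smoothness. Linearity
    is recorded only through differences, which is what perturbation arguments
    use. *)
Record lattice_op (T : (R -> R) -> R -> R) (c : R) : Prop := LatticeOp {
  lo_smooth_op : smooth_op T ;
  lo_ge0 : 0 <= c ;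
  lo_lat : forall f, X f -> X (T f) ;
  lo_norm : forall f, X f -> N (T f) <= c * N f ;
  lo_sub : forall f g, X f -> X g -> T (f \- g) = T f \- T g }.

Lemma so_derive1n T p g : smooth_op T -> smooth p g ->
  derive1n p (T g) = T (derive1n p g).
Proof.
move=> hT; elim: p g => [|p IH] g sg //.
by rewrite !derive1Sn (so_derive1 hT (smooth_leq _ sg))// IH//; exact: smooth_derive1.
Qed.

Lemma smooth_op_id : smooth_op id.
Proof. by []. Qed.

Lemma smooth_op_comp S T : smooth_op S -> smooth_op T -> smooth_op (fun g => S (T g)).
Proof.
move=> hS hT; split; first by move=> p g sg; apply: (so_smooth hS); exact: (so_smooth hT).
by move=> g sg; rewrite (so_derive1 hS) ?(so_derive1 hT)//; exact: (so_smooth hT).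
Qed.

Lemma smooth_op_sub S T : smooth_op S -> smooth_op T -> smooth_op (fun g => S g \- T g).
Proof.
move=> hS hT; split.
  by move=> p g sg; apply: smoothB; [exact: (so_smooth hS)|exact: (so_smooth hT)].
move=> g sg; rewrite (derive1B (so_smooth hS sg) (so_smooth hT sg)).
by rewrite (so_derive1 hS)// (so_derive1 hT).
Qed.

Lemma smooth_op_iter n T : smooth_op T -> smooth_op (iter n T).
Proof.
move=> hT; elim: n => [|n IH]; first exact: smooth_op_id.
exact: smooth_op_comp hT IH.
Qed.

Lemma lattice_op_id : lattice_op id 1.
Proof. by split=> // f _; rewrite mul1r. Qed.

Lemma lattice_op_comp S T c d : lattice_op S c -> lattice_op T d ->
  lattice_op (fun g => S (T g)) (c * d).
Proof.
move=> hS hT; have [[_ c0 lS nS bS] [_ d0 lT nT bT]] := (hS, hT).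
split.
- exact: smooth_op_comp (lo_smooth_op hS) (lo_smooth_op hT).
- exact: mulr_ge0.
- by move=> f Xf; apply: lS; exact: lT.
- move=> f Xf; apply: le_trans (nS _ (lT _ Xf)) _.
  by rewrite -mulrA ler_wpM2l// nT.
- by move=> f g Xf Xg; rewrite bT// bS//; exact: lT.
Qed.

Lemma lattice_op_sub S T c d : lattice_op S c -> lattice_op T d ->
  lattice_op (fun g => S g \- T g) (c + d).
Proof.
move=> hS hT; have [[_ c0 lS nS bS] [_ d0 lT nT bT]] := (hS, hT).
split.
- exact: smooth_op_sub (lo_smooth_op hS) (lo_smooth_op hT).
- exact: addr_ge0.
- by move=> f Xf; apply: (lat_sub hX); [exact: lS|exact: lT].
- move=> f Xf; apply: le_trans (norm_sub hX (lS _ Xf) (lT _ Xf)) _.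
  by rewrite mulrDl lerD ?nS ?nT.
- by move=> f g Xf Xg; rewrite bT// bS//; apply/funext => x /=; ring.
Qed.

Lemma lattice_op_iter n T c : lattice_op T c -> lattice_op (iter n T) (c ^+ n).
Proof.
move=> hT; elim: n => [|n IH]; first exact: lattice_op_id.
by rewrite exprS; exact: lattice_op_comp hT IH.
Qed.

Lemma lattice_op_avg a b H : 0 < H -> a < b -> - (H / 2) <= a -> b <= H / 2 ->
  lattice_op (avg a b) (H / (b - a) * C).
Proof.
move=> H0 ab Ha bH; split.
- split; first by move=> p g; exact: smooth_avg.
  by move=> g sg; exact: avg_derive1 (ltW ab) sg.
- by rewrite mulr_ge0 ?divr_ge0 ?subr_ge0 ?(ltW ab) ?(ltW H0) ?(ltW C_gt0).
- by move=> f; exact: lat_avg.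
- by move=> f; exact: norm_avg_le.
- by move=> f g Xf Xg; apply: avgB; exact: (lat_locint hX).
Qed.

Lemma lattice_op_steklov h : 0 < h -> lattice_op (steklov h) C.
Proof.
move=> h0; rewrite steklov_avg.
have E : h / (h / 2 - - (h / 2)) * C = C.
  have -> : h / 2 - - (h / 2) = h by field.
  by rewrite divff ?mul1r ?gt_eqF.
by rewrite -[in X in lattice_op _ X]E; apply: lattice_op_avg => //; lra.
Qed.

Lemma lattice_op_steklov_dot h : 0 < h -> lattice_op (steklov_dot h) (2 * C).
Proof.
move=> h0; rewrite steklov_dot_avg.
have -> : 2 * C = (2 * h) / (h - 0) * C by rewrite subr0 mulfK ?gt_eqF.
by apply: lattice_op_avg => //; lra.
Qed.

Lemma smooth_op_diff_iter A r : smooth_op A -> smooth_op (diff_iter A r).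
Proof.
by move=> hA'; apply: smooth_op_iter; apply: smooth_op_sub => //; exact: smooth_op_id.
Qed.

Lemma lattice_op_diff_iter A r c : lattice_op A c -> lattice_op (diff_iter A r) ((1 + c) ^+ r).
Proof.
by move=> hA'; apply: lattice_op_iter; apply: lattice_op_sub => //; exact: lattice_op_id.
Qed.

Lemma derive1nD p q g : derive1n (q + p) g = derive1n q (derive1n p g).
Proof. by elim: q => [|q IH] //; rewrite addSn !derive1nS IH. Qed.

(** An operator of approximation order q that commutes with D gains its factor
    at every iteration, applied each time to q further derivatives. *)
Lemma norm_iter_smooth E q r (e : R) g : smooth_op E -> 0 <= e ->
  (forall g, smooth q g -> N (E g) <= e * N (derive1n q g)) ->
  smooth (r * q) g -> N (iter r E g) <= e ^+ r * N (derive1n (r * q) g).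
Proof.
move=> hE e0 H; elim: r g => [|r IH] g sg; first by rewrite mul0n expr0 mul1r.
rewrite mulSn in sg *.
have sE : smooth (r * q) (E g).
  by apply: (so_smooth hE); apply: smooth_leq sg; rewrite leq_addl.
rewrite iterSr; apply: le_trans (IH _ sE) _.
rewrite so_derive1n //; last by apply: smooth_leq sg; rewrite leq_addl.
rewrite exprSr -mulrA ler_wpM2l ?exprn_ge0//.
apply: le_trans (H _ _) _; first by apply: smooth_derive1n; rewrite addnC.
by rewrite -derive1nD.
Qed.

End SteklovOperators.

(** * Approximation of smooth functions by their averages *)

Section LocalEstimates.
Context {R : realType} (X : set (R -> R)) (N : (R -> R) -> R).
Context (hX : banach_lattice X N) (hA : assumptionA X N).
Context (C : R) (C_ge1 : 1 <= C).
Context (steklov_le : forall h f, 0 < h -> X f -> N (steklov h f) <= C * N f).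
Implicit Types (f g : R -> R) (a b c x y h : R).

Lemma itg_bound f a b M : locint f -> a <= b ->
  (forall t, a <= t <= b -> `|f t| <= M) -> `|itg f a b| <= M * (b - a).
Proof.
move=> fi ab fM; apply: le_trans (itg_abs _ _ fi) _.
rewrite -(itg_cst M ab); apply: itg_le => //; first exact: locint_abs.
by apply: continuous_locint => x; exact: cvg_cst.
Qed.

Lemma locint_subr g a : continuous g -> locint (fun t => g t - a).
Proof.
move=> cg; apply: continuous_locint => x.
by apply: cvgB; [exact: cg|exact: cvg_cst].
Qed.

Lemma avg_sub_cst g a b x y : a < b -> continuous g ->
  avg a b g x - y = (b - a)^-1 * itg (fun t => g t - y) (x + a) (x + b).
Proof.
move=> ab cg.
have -> : (fun t => g t - y) = g \- cst y by [].
rewrite itgB; [|exact: continuous_locint|by apply: continuous_locint => z; exact: cvg_cst].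
have -> : itg (cst y) (x + a) (x + b) = y * (b - a).
  by rewrite [LHS]itg_cst ?lerD2l ?(ltW ab)//; congr (_ * _); ring.
by rewrite mulrBr mulrCA mulVf ?mulr1// subr_eq0 gt_eqF.
Qed.

Lemma norm_avg_sub_le g a b x y M : a < b -> continuous g ->
  (forall t, x + a <= t <= x + b -> `|g t - y| <= M) -> `|avg a b g x - y| <= M.
Proof.
move=> ab cg H; rewrite avg_sub_cst// normrM gtr0_norm ?invr_gt0 ?subr_gt0//.
rewrite ler_pdivrMl ?subr_gt0//.
apply: le_trans (itg_bound (locint_subr y cg) _ H) _; first by rewrite lerD2l (ltW ab).
by rewrite mulrC; have -> : x + b - (x + a) = b - a by ring.
Qed.

(** The variation of g inside a window is at most the integral of |D g| over
    that window. *)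
Lemma smooth_var g u v c H : smooth 1 g -> 0 < H ->
  c - H / 2 <= u <= c + H / 2 -> c - H / 2 <= v <= c + H / 2 ->
  `|g v - g u| <= H * steklov H (fun x => `|derive1 g x|) c.
Proof.
move=> sg H0.
wlog uv : u v / u <= v.
  move=> W hu hv; have [uv|/ltW vu] := leP u v; first exact: W.
  by rewrite distrC; exact: W.
move=> /andP[u1 u2] /andP[v1 v2].
rewrite -(itg_derive1 uv sg); apply: le_itg_steklov => //.
exact: smooth_locint (smooth_derive1 sg).
Qed.

Lemma norm_dom_steklov f g H : 0 < H -> X f -> X g ->
  (forall x, `|f x| <= H * steklov H (fun t => `|g t|) x) -> N f <= H * C * N g.
Proof.
move=> H0 Xf Xg fg.
have XS := proj1 hA H _ H0 (lat_abs hX Xg).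
have [_ le1] := lat_dom hX (bl_measurable hX Xf) (lat_scale hX H XS)
  (fun x => le_trans (fg x) (ler_norm _)).
apply: (le_trans le1); rewrite (norm_scale hX)// gtr0_norm// -mulrA ler_pM2l//.
by rewrite -(norm_abs hX Xg); apply: steklov_le => //; exact: (lat_abs hX).
Qed.

Lemma norm_sub_steklov_dot h g : 0 < h -> smooth 1 g ->
  N (g \- steklov_dot h g) <= (2 * h * C) * N (derive1 g).
Proof.
move=> h0 sg; have cg := smooth_continuous sg.
have h20 : 0 < 2 * h by lra.
have sD : smooth 1 (steklov_dot h g) by apply: (so_smooth (lo_smooth_op (lattice_op_steklov_dot hX hA C_ge1 steklov_le h0))).
apply: norm_dom_steklov => //; [exact: (smooth_lat hX (smoothB sg sD))|exact: (smooth_lat hX (smooth_derive1 sg))|move=> x].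
rewrite /= distrC steklov_dot_avg; apply: norm_avg_sub_le => // t; rewrite addr0 => /andP[t1 t2].
by apply: smooth_var => //; apply/andP; split; lra.
Qed.

(** The window is symmetric, so averaging reproduces the first-order Taylor
    polynomial of g at x; the remainder rho is estimated by integrating twice.
    One factor h comes from the length of the window, the other from the
    variation of D g, and the resulting pointwise bound is an average of |D^2
    g|. *)
Lemma norm_sub_steklov h g : 0 < h -> smooth 2 g ->
  N (g \- steklov h g) <= (h ^+ 2 * C) * N (derive1n 2 g).
Proof.
move=> h0 sg; have cg := smooth_continuous sg.
have sD : smooth 2 (steklov h g) by apply: (so_smooth (lo_smooth_op (lattice_op_steklov hX hA C_ge1 steklov_le h0))).
have s2 : smooth 0 (derive1n 2 g) by exact: (@smooth_derive1n _ 0 2 g sg).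
have Xg2 := smooth_lat hX s2.
have Xd := smooth_lat hX (smoothB sg sD).
suff H : N (fun x => h^-1 * (g \- steklov h g) x) <= h * C * N (derive1n 2 g).
  move: H; rewrite (norm_scale hX)// gtr0_norm ?invr_gt0// ler_pdivrMl//.
  by rewrite expr2 !mulrA.
apply: norm_dom_steklov => //; first exact: (lat_scale hX).
move=> x; set M := h * steklov h _ x.
rewrite normrM gtr0_norm ?invr_gt0// ler_pdivrMl//=.

pose rho t := g t - (g x + derive1 g x * (t - x)).
have dlin (t : R) : is_derive t 1 (fun t => g x + derive1 g x * (t - x)) (derive1 g x).
  have d1 : is_derive t 1 (fun t : R => t - x) 1.
    by apply: is_derive_eq; rewrite subr0.
  have d2 := is_deriveZ (derive1 g x) d1.
  have := is_deriveD (is_derive_cst (g x) t (1 : R)) d2.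
  by rewrite add0r /GRing.scale/= mulr1.
have drho (t : R) : is_derive t 1 rho (derive1 g t - derive1 g x).
  exact: is_deriveB (smooth_is_derive t sg) (dlin t).
have crho := is_derive_continuous drho.
have clin := is_derive_continuous dlin.
have sd := smooth_derive1 sg.
have cd := smooth_continuous sd.
have c1 : continuous (fun u => derive1 g u - derive1 g x).
  by move=> u; apply: cvgB; [exact: cd|exact: cvg_cst].
have rho0 : rho x = 0 by rewrite /rho subrr mulr0 addr0 subrr.
have M0 : 0 <= M.
  rewrite /M mulr_ge0 ?(ltW h0)// steklovE mulr_ge0 ?invr_ge0 ?(ltW h0)//.
  by apply: itg_ge0.
have dvar u : x - h / 2 <= u <= x + h / 2 -> `|derive1 g u - derive1 g x| <= M.
  by move=> hu; apply: smooth_var => //; apply/andP; split; lra.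
have rho_le t : x - h / 2 <= t <= x + h / 2 -> `|rho t| <= h * M.
  move=> /andP[t1 t2]; have [xt|/ltW tx] := leP x t.
    have := itg_bound (continuous_locint c1) xt (M := M).
    rewrite (itg_FTC2 xt c1 drho) rho0 subr0 => /(_ _)/le_trans; apply.
      by move=> u /andP[u1 u2]; apply: dvar; apply/andP; split; lra.
    by rewrite mulrC ler_wpM2r//; lra.
  have := itg_bound (continuous_locint c1) tx (M := M).
  rewrite (itg_FTC2 tx c1 drho) rho0 sub0r normrN => /(_ _)/le_trans; apply.
    by move=> u /andP[u1 u2]; apply: dvar; apply/andP; split; lra.
  by rewrite mulrC ler_wpM2r//; lra.
have hh : - (h / 2) < h / 2 by lra.
rewrite distrC steklov_avg.
suff -> : avg (- (h / 2)) (h / 2) g x - g x = avg (- (h / 2)) (h / 2) rho x - 0.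
  apply: norm_avg_sub_le => // t; rewrite subr0; exact: rho_le.
rewrite subr0.
have -> : rho = g \- (fun t => g x + derive1 g x * (t - x)) by [].
rewrite avgB; [|exact: continuous_locint|exact: continuous_locint].
rewrite /=; congr (_ - _).
have dP (t : R) : is_derive t 1 (fun t => g x * t + derive1 g x / 2 * (t - x) ^+ 2)
    (g x + derive1 g x * (t - x)).
  have d1 : is_derive t 1 (fun t : R => t - x) 1.
    by apply: is_derive_eq; rewrite subr0.
  have d2 := is_deriveZ (derive1 g x / 2) (is_deriveX 2 d1).
  have d3 := is_deriveZ (g x) (is_derive_id t (1 : R)).
  have H := is_deriveD d3 d2.
  apply: (@is_derive_eq _ _ _ _ _ _ _ _ H).
  by rewrite /GRing.scale/= expr1; field.
have xh : x + - (h / 2) <= x + h / 2 by lra.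
rewrite /avg (itg_FTC2 xh clin dP).
by field; lra.
Qed.

End LocalEstimates.

(** * The discrete norm *)

Section DiscreteNorm.
Context {R : realType} (X : set (R -> R)) (N : (R -> R) -> R).
Context (hX : banach_lattice X N) (hA : assumptionA X N).
Context (C : R) (C_ge1 : 1 <= C).
Context (steklov_le : forall h f, 0 < h -> X f -> N (steklov h f) <= C * N f).
Context (gamma gamma' : R) (gamma_gt0 : 0 < gamma) (gamma'_gt0 : 0 < gamma').
Context (n m : nat) (xs : nat -> R) (n_gt0 : (0 < n)%N).
Context (hx : sampling_nodes gamma gamma' n m xs).
Implicit Types (f g : R -> R) (a b c x y h : R).

Local Notation dnorm := (discrete_norm N m xs).

Lemma circle_co_measurable a b :
  measurable (circle_co a b : set (lebesgueTypeR R)).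
Proof.
have -> : circle_co a b = \bigcup_(j : int)
   `[(a - j%:~R * (2 * pi)), (b - j%:~R * (2 * pi))[%classic.
  apply/seteqP; split => x /=.
    by case=> j H; exists j => //=; rewrite in_itv/= lerBlDr ltrBrDr.
  by case=> j _; rewrite /= in_itv/= lerBlDr ltrBrDr => H; exists j.
apply: borel_lebesgue_measurable; apply: countable_bigcupT_measurable.
  exact: countableP.
by move=> j; exact: measurable_itv.
Qed.

Lemma circle_co_set a b : circle_set (circle_co a b).
Proof.
move=> x; split => -[j H].
  exists (j + 1); rewrite intrD mulrDl mulr1z mul1r.
  by rewrite (_ : x + _ = x + 2 * pi + j%:~R * (2 * pi)) //; ring.
exists (j - 1); rewrite intrB mulrBl mulr1z mul1r.
by rewrite (_ : x + 2 * pi + _ = x + j%:~R * (2 * pi)) //; ring.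
Qed.

Definition step f : R -> R :=
  fun t => \sum_(1 <= k < m.+1) `|f (xs k)| * \1_(circle_co (xs k) (xs k.+1)) t.

Lemma step_ge0 f t : 0 <= step f t.
Proof. by apply: sumr_ge0 => k _; rewrite mulr_ge0// indicE ler0n. Qed.

Lemma lat_step f : X (step f).
Proof.
rewrite /step; elim: (index_iota 1 m.+1) => [|k l IH].
  have := lat_cst hX 0; congr X; apply/funext => t; by rewrite big_nil.
have Xk := lat_scale hX `|f (xs k)| (lat_indic hX (circle_co_measurable (xs k) (xs k.+1)) (circle_co_set (xs k) (xs k.+1))).
have := lat_add hX Xk IH; congr X; apply/funext => t.
by rewrite big_cons.
Qed.

Lemma dnorm_ge0 f : 0 <= dnorm f.
Proof. exact: (norm_ge0 hX (lat_step f)). Qed.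

Lemma dnorm_le f g : (forall x, `|f x| <= `|g x|) -> dnorm f <= dnorm g.
Proof.
move=> fg; apply: (proj2 (lat_dom hX (bl_measurable hX (lat_step f)) (lat_step g) _)) => t.
rewrite !ger0_norm ?step_ge0//; apply: ler_sum => k _.
by rewrite ler_wpM2r// indicE ler0n.
Qed.

Lemma dnormB f g : dnorm (f \- g) <= dnorm f + dnorm g.
Proof.
apply: le_trans (norm_add hX (lat_step f) (lat_step g)).
apply: (proj2 (lat_dom hX (bl_measurable hX (lat_step (f \- g))) (lat_add hX (lat_step f) (lat_step g)) _)) => t.
rewrite !ger0_norm ?addr_ge0 ?step_ge0//= -big_split/=.
apply: ler_sum => k _; rewrite -mulrDl ler_wpM2r// ?ler_normB// indicE ler0n.
Qed.

Lemma dnormC f g : dnorm (f \- g) = dnorm (g \- f).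
Proof.
by apply/eqP; rewrite eq_le; apply/andP; split; apply: dnorm_le => x /=; rewrite distrC.
Qed.

Lemma dnorm_triangle f g : dnorm f <= dnorm g + dnorm (f \- g).
Proof.
rewrite addrC dnormC addrC.
have := dnormB g (g \- f).
by have -> : g \- (g \- f) = f by apply/funext => x /=; ring.
Qed.

Lemma nodes_lt i j : (1 <= i)%N -> (i < j)%N -> (j <= m.+1)%N -> xs i < xs j.
Proof.
move=> i1; elim: j => [//|j IH] ij jm.
have step1 : xs j < xs j.+1.
  have := nodes_gap hx (k := j); rewrite (leq_trans i1 ij) -ltnS jm => /(_ isT)/andP[H _].
  by rewrite -subr_gt0; apply: lt_le_trans H; rewrite divr_gt0// ltr0n.
move: ij; rewrite ltnS leq_eqVlt => /orP[/eqP->//|ij].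
by apply: lt_trans (IH ij (ltnW jm)) step1.
Qed.

Lemma nodes_le i j : (1 <= i)%N -> (i <= j)%N -> (j <= m.+1)%N -> xs i <= xs j.
Proof.
move=> i1; rewrite leq_eqVlt => /orP[/eqP->//|ij] jm.
by apply: ltW; exact: nodes_lt.
Qed.

(** The cells lie in the single period [x_1, x_1 + 2pi), so a common point of
    two arcs has the same translate in both cells, and distinct cells are
    disjoint. *)
Lemma circle_co_disjoint i j t : (1 <= i <= m)%N -> (1 <= j <= m)%N ->
  circle_co (xs i) (xs i.+1) t -> circle_co (xs j) (xs j.+1) t -> i = j.
Proof.
wlog ij : i j / (i <= j)%N.
  move=> W hi hj ci cj; have [ij|/ltnW ji] := leqP i j; first exact: W.
  exact/esym/W.
move=> /andP[i1 im] /andP[j1 jm] [a /andP[a1 a2]] [b /andP[b1 b2]].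
have x1i := nodes_le (leqnn 1) i1 (leq_trans im (leqnSn m)).
have x1j := nodes_le (leqnn 1) j1 (leq_trans jm (leqnSn m)).
have xim : xs i.+1 <= xs m.+1 by apply: nodes_le.
have xjm : xs j.+1 <= xs m.+1 by apply: nodes_le.
have wrap := nodes_wrap hx.
have pi0 := @pi_gt0 R.
have ab : a = b.
  have absd : `|(a - b)%:~R| < 1 :> R.
    rewrite ltr_norml.
    have : `|(a%:~R - b%:~R) * (2 * pi)| < 2 * pi :> R.
      by rewrite ltr_norml; apply/andP; split; lra.
    rewrite normrM (gtr0_norm (x := 2 * pi)); last by lra.
    by rewrite gtr_pMl; [rewrite ltr_norml intrB|lra].
  move: absd; rewrite -intr_norm ltrz1 => absd.
  apply/eqP; rewrite -subr_eq0 -normr_eq0 eq_le normr_ge0 andbT.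
  by rewrite -ltzD1 add0r.
subst b; apply/eqP; move: ij; rewrite leq_eqVlt => /orP[//|ij].
have := @nodes_le i.+1 j isT ij (leq_trans jm (leqnSn m)).
lra.
Qed.

(** At every t at most one term of the step function is nonzero, so a pointwise
    bound on each cell suffices. *)
Lemma dnorm_dom f g : X g -> (forall x, 0 <= g x) ->
  (forall k t, (1 <= k <= m)%N -> xs k <= t < xs k.+1 -> `|f (xs k)| <= g t) ->
  dnorm f <= N g.
Proof.
move=> Xg g0 fg; apply: (proj2 (lat_dom hX (bl_measurable hX (lat_step f)) Xg _)) => t.
rewrite (ger0_norm (step_ge0 f t)) (ger0_norm (g0 t)) /step.
have pg := proj1 (bl_measurable hX Xg).
have [[k [km kt]]|no] := pselect (exists k, (1 <= k <= m)%N /\ circle_co (xs k) (xs k.+1) t).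
  rewrite (bigD1_seq k) /=; [|by rewrite mem_index_iota ltnS|exact: iota_uniq].
  rewrite big_seq_cond big1 ?addr0.
    rewrite indicE mem_set// mulr1.
    by case: kt => j jt; rewrite -(circle_fun_int j t pg); exact: fg.
  move=> i /andP[]; rewrite mem_index_iota ltnS => im ik.
  rewrite indicE memNset ?mulr0// => it.
  by move/eqP: ik; apply; exact: circle_co_disjoint it kt.
rewrite big_seq big1 ?g0// => i; rewrite mem_index_iota ltnS => im.
by rewrite indicE memNset ?mulr0// => it; apply: no; exists i.
Qed.

Let n0 : 0 < n%:R :> R. Proof. by rewrite ltr0n. Qed.

Lemma node_gap_le k t : (1 <= k <= m)%N -> xs k <= t < xs k.+1 ->
  xs k <= t <= xs k + gamma' / n%:R.
Proof.
move=> km /andP[t1 t2]; rewrite t1/= (le_trans (ltW t2))//.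
by have /andP[_] := nodes_gap hx km; rewrite lerBlDr addrC.
Qed.

(** For t in the k-th cell, the window of length h around the node x_k lies in
    the window of length h + 2 gamma'/n around t. Thus the sampled average is
    dominated at t by an average of |f| at t. *)
Lemma dnorm_steklov f : X f ->
  dnorm (steklov (gamma / n%:R) f) <= (1 + 2 * gamma' / gamma) * C * N f.
Proof.
move=> Xf; have fi := lat_locint hX Xf.
(* H is the length of a window around any point of a cell that contains the
   window of length h around its left node *)
pose h := gamma / n%:R; pose d := gamma' / n%:R; pose H := h + 2 * d.
have h0 : 0 < h by rewrite divr_gt0.
have d0 : 0 < d by rewrite divr_gt0.
have H0 : 0 < H by rewrite /H; lra.
have XS := proj1 hA H _ H0 (lat_abs hX Xf).
have -> : (1 + 2 * gamma' / gamma) = h^-1 * H.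
  by rewrite /H /h /d; field; rewrite !gt_eqF.
have XG := lat_scale hX (h^-1 * H) XS.
apply: (@le_trans _ _ (N (fun x => h^-1 * H * steklov H (fun t => `|f t|) x))).
  apply: dnorm_dom => //.
    move=> x; apply: mulr_ge0; last exact: steklov_ge0.
    by rewrite mulr_ge0 ?invr_ge0 ?(ltW h0) ?(ltW H0).
  move=> k t km kt; have /andP[t1 t2] := node_gap_le km kt.
  rewrite steklovE normrM gtr0_norm ?invr_gt0// -[X in _ <= X]mulrA ler_wpM2l ?invr_ge0 ?(ltW h0)//.
  by apply: le_itg_steklov => //; rewrite -/h -/d in t2 *; rewrite /H; lra.
rewrite (norm_scale hX)// gtr0_norm ?mulr_gt0 ?invr_gt0// -[X in _ <= X]mulrA ler_wpM2l ?mulr_ge0 ?invr_ge0 ?(ltW h0) ?(ltW H0)//.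
by rewrite -(norm_abs hX Xf); apply: steklov_le => //; exact: (lat_abs hX).
Qed.

(** Replacing the value at the node by the value at t costs the variation of g
    across one cell. *)
Lemma dnorm_smooth g : smooth 1 g ->
  dnorm g <= N g + 2 * gamma' / n%:R * C * N (derive1 g).
Proof.
move=> sg; have Xg := smooth_lat hX sg; have Xd := smooth_lat hX (smooth_derive1 sg).
pose H := 2 * gamma' / n%:R.
have H0 : 0 < H by rewrite divr_gt0// mulr_gt0.
have XS := proj1 hA H _ H0 (lat_abs hX Xd).
have XH := lat_scale hX H XS.
have XG := lat_add hX (lat_abs hX Xg) XH.
apply: (@le_trans _ _ (N ((fun x => `|g x|) \+ (fun x => H * steklov H (fun t => `|derive1 g t|) x)))).
  apply: dnorm_dom => //.
    move=> x; rewrite addr_ge0//; apply: mulr_ge0; first exact: ltW.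
    exact: steklov_ge0.
  move=> k t km kt; have /andP[t1 t2] := node_gap_le km kt.
  rewrite /= -lerBlDl; apply: (@le_trans _ _ `|g (xs k) - g t|).
    exact: lerB_dist.
  have HE : gamma' / n%:R = H / 2 by rewrite /H; field; rewrite gt_eqF.
  by rewrite HE in t2; apply: smooth_var => //; apply/andP; split; lra.
apply: (le_trans (norm_add hX (lat_abs hX Xg) XH)).
rewrite (norm_abs hX Xg) lerD2l (norm_scale hX)// gtr0_norm// -/H -[X in _ <= X]mulrA ler_wpM2l ?(ltW H0)//.
by rewrite -(norm_abs hX Xd); apply: steklov_le => //; exact: (lat_abs hX).
Qed.

End DiscreteNorm.

(** * Trigonometric polynomials and their derivatives *)

Section TrigPoly.
Context {R : realType}.
Implicit Types (T U f g : R -> R) (a b c d x y h : R) (n m N j k : nat).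

(** Cosines with a phase span the same space as cosines and sines, and are
    closed under translation, reflection, differentiation and, up to sums,
    multiplication; this makes them the convenient generators for induction. *)
Definition wave j d : R -> R := fun x => cos (j%:R * x + d).

Lemma trig_polyD n T U : trig_poly n T -> trig_poly n U -> trig_poly n (T \+ U).
Proof.
move=> [a [b ->]] [c [d ->]]; exists (a \+ c), (b \+ d).
apply/funext => x /=; rewrite -big_split/=; apply: eq_bigr => k _; ring.
Qed.

Lemma trig_polyZ n c T : trig_poly n T -> trig_poly n (fun x => c * T x).
Proof.
move=> [a [b ->]]; exists (fun k => c * a k), (fun k => c * b k).
apply/funext => x /=; rewrite mulr_sumr; apply: eq_bigr => k _; ring.
Qed.

Lemma trig_poly_wave n j d : (j <= n)%N -> trig_poly n (wave j d).
Proof.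
move=> jn; exists (fun k => if k == j then cos d else 0), (fun k => if k == j then - sin d else 0).
apply/funext => x; rewrite (bigD1_seq j); [|by rewrite mem_index_iota ltnS|exact: iota_uniq].
rewrite /= eqxx big1 ?addr0; last by move=> k /negbTE ->; rewrite !mul0r addr0.
by rewrite /wave cosD; ring.
Qed.

(** cos (k x) and sin (k x) are the waves of frequency k with phases 0 and
    -pi/2. *)
Lemma trig_poly_ind n (P : (R -> R) -> Prop) :
  (forall T U, P T -> P U -> P (T \+ U)) -> (forall c T, P T -> P (fun x => c * T x)) ->
  (forall j d, (j <= n)%N -> P (wave j d)) -> forall T, trig_poly n T -> P T.
Proof.
move=> PD PZ PW T [a [b ->]].
have P0 : P (fun=> 0).
  by have := PZ 0 _ (PW 0%N 0 isT); congr P; apply/funext => x; rewrite mul0r.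
have H (l : seq nat) : (forall k, k \in l -> (k <= n)%N) ->
    P (fun x => \sum_(k <- l) (a k * cos (k%:R * x) + b k * sin (k%:R * x))).
  elim: l => [|k l IH] Hl.
    by have := P0; congr P; apply/funext => x; rewrite big_nil.
  have kn : (k <= n)%N by apply: Hl; rewrite mem_head.
  have := PD _ _ (PD _ _ (PZ (a k) _ (PW k 0 kn)) (PZ (b k) _ (PW k (- (pi / 2)) kn)))
    (IH (fun i il => Hl i (mem_behead (s := k :: l) il))).
  by congr P; apply/funext => x /=; rewrite big_cons /wave addr0 cosBpihalf.
by apply: H => k; rewrite mem_index_iota ltnS.
Qed.

Lemma trig_poly_leq n m T : (n <= m)%N -> trig_poly n T -> trig_poly m T.
Proof.
move=> nm; move: T; apply: trig_poly_ind.
- by move=> T U; exact: trig_polyD.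
- by move=> c T; exact: trig_polyZ.
- by move=> j d jn; apply: trig_poly_wave; exact: leq_trans nm.
Qed.

Lemma waveM j k d e : (k <= j)%N -> (wave j d \* wave k e) =
  (fun x => 2^-1 * (wave (j + k) (d + e) \+ wave (j - k) (d - e)) x).
Proof.
move=> kj; apply/funext => x; rewrite /wave/=.
rewrite natrD natrB//.
have -> : (j%:R + k%:R) * x + (d + e) = (j%:R * x + d) + (k%:R * x + e) by ring.
have -> : (j%:R - k%:R) * x + (d - e) = (j%:R * x + d) - (k%:R * x + e) by ring.
by rewrite (cosD (j%:R * x + d)) (cosB (j%:R * x + d)); field.
Qed.

Lemma trig_polyM n m T U : trig_poly n T -> trig_poly m U ->
  trig_poly (n + m) (T \* U).
Proof.
move=> + tU; move: T; apply: trig_poly_ind.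
- move=> T V tT tV; have := trig_polyD tT tV; congr (trig_poly _).
  by apply/funext => x /=; rewrite mulrDl.
- move=> c T tT; have := trig_polyZ c tT; congr (trig_poly _).
  by apply/funext => x /=; rewrite mulrA.
move=> j d jn; move: U tU; apply: trig_poly_ind.
- move=> T V tT tV; have := trig_polyD tT tV; congr (trig_poly _).
  by apply/funext => x /=; rewrite mulrDr.
- move=> c T tT; have := trig_polyZ c tT; congr (trig_poly _).
  by apply/funext => x /=; rewrite mulrCA.
move=> k e km.
wlog kj : n m j k d e jn km / (k <= j)%N.
  move=> W; have [kj|/ltnW jk] := leqP k j; first exact: W.
  have := W m n k j e d km jn jk; rewrite addnC; congr (trig_poly _).
  by apply/funext => x /=; rewrite mulrC.
rewrite waveM//; apply: trig_polyZ; apply: trig_polyD; apply: trig_poly_wave.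
  exact: leq_add.
by apply: leq_trans (leq_subr _ _) (leq_trans jn (leq_addr _ _)).
Qed.

Lemma trig_poly_reflect n T x : trig_poly n T -> trig_poly n (fun u => T (x - u)).
Proof.
move: T; apply: trig_poly_ind.
- by move=> T U; exact: trig_polyD.
- by move=> c T; exact: trig_polyZ.
move=> j d jn; have := trig_poly_wave (- (j%:R * x + d)) jn; congr (trig_poly _).
by apply/funext => u; rewrite /wave -cosN; congr cos; ring.
Qed.

Lemma is_derive_affine (c d x : R) : is_derive x 1 (fun x : R => c * x + d) c.
Proof.
have H := is_deriveD (is_deriveZ c (is_derive_id x (1 : R))) (is_derive_cst d x (1 : R)).
apply: (@is_derive_eq _ _ _ _ _ _ _ _ H).
by rewrite /GRing.scale/= mulr1 addr0.
Qed.

Lemma is_derive_cos_affine (c d x : R) :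
  is_derive x 1 (fun x : R => cos (c * x + d)) (- c * sin (c * x + d)).
Proof.
have H := @is_derive1_comp R cos _ x _ _ (is_derive_cos _) (is_derive_affine c d x).
by apply: (@is_derive_eq _ _ _ _ _ _ _ _ H); ring.
Qed.

Lemma is_derive_sin_affine (c d x : R) :
  is_derive x 1 (fun x : R => sin (c * x + d)) (c * cos (c * x + d)).
Proof.
have H := @is_derive1_comp R sin _ x _ _ (is_derive_sin _) (is_derive_affine c d x).
by apply: (@is_derive_eq _ _ _ _ _ _ _ _ H); ring.
Qed.

Lemma is_derive_wave j d x : is_derive x 1 (wave j d) (j%:R * wave j (d + pi / 2) x).
Proof.
have H := is_derive_cos_affine j%:R d x.
by apply: (@is_derive_eq _ _ _ _ _ _ _ _ H); rewrite /wave addrA cosDpihalf; ring.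
Qed.

Lemma cos_circle : circle_fun (@cos R).
Proof. by move=> x; rewrite mulr_natl cosD2pi. Qed.

Lemma sin_circle : circle_fun (@sin R).
Proof. by move=> x; rewrite mulr_natl sinD2pi. Qed.

Lemma wave_circle j d : circle_fun (wave j d).
Proof.
move=> x; rewrite /wave -[RHS](circle_fun_int (j : int) _ cos_circle).
by congr cos; rewrite pmulrn; ring.
Qed.

Lemma trig_poly_derive n T : trig_poly n T -> circle_fun T /\
  exists2 T', trig_poly n T' & forall x, is_derive x 1 T (T' x).
Proof.
move: T; apply: trig_poly_ind.
- move=> T U [pT [T' tT dT]] [pU [U' tU dU]]; split.
    by move=> x /=; rewrite pT pU.
  exists (T' \+ U'); first exact: trig_polyD.
  by move=> x; exact: is_deriveD.
- move=> c T [pT [T' tT dT]]; split; first by move=> x; rewrite pT.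
  exists (fun x => c * T' x); first exact: trig_polyZ.
  by move=> x; exact: is_deriveZ.
- move=> j d jn; split; first exact: wave_circle.
  exists (fun x => j%:R * wave j (d + pi / 2) x); last exact: is_derive_wave.
  by apply: trig_polyZ; exact: trig_poly_wave.
Qed.

Lemma trig_poly_circle n T : trig_poly n T -> circle_fun T.
Proof. by move=> /trig_poly_derive[]. Qed.

Lemma trig_poly_derive1 n T : trig_poly n T -> trig_poly n (derive1 T).
Proof. by move=> /trig_poly_derive[_ [T' tT' dT]]; rewrite (derive1_eq dT). Qed.

Lemma trig_poly_smooth p n T : trig_poly n T -> smooth p T.
Proof.
elim: p T => [|p IH] T tT; have [pT [T' tT' dT]] := trig_poly_derive tT.
  by split => //; exact: is_derive_continuous dT.
exact: smooth_intro pT dT (IH _ tT').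
Qed.

Lemma trig_poly_derive1n p n T : trig_poly n T -> trig_poly n (derive1n p T).
Proof.
elim: p T => [|p IH] T tT //.
by rewrite derive1Sn; apply: IH; exact: trig_poly_derive1.
Qed.

Lemma trig_polyB n T U : trig_poly n T -> trig_poly n U -> trig_poly n (T \- U).
Proof.
move=> tT tU; have := trig_polyD tT (trig_polyZ (-1) tU); congr (trig_poly _).
by apply/funext => x /=; rewrite mulN1r.
Qed.

Lemma itg_period f a b : circle_fun f -> continuous f ->
  itg f a (a + 2 * pi) = itg f b (b + 2 * pi).
Proof.
move=> pf cf; have [G dG] := continuous_primitive cf.
have pi0 := @pi_gt0 R.
rewrite !(itg_FTC2 _ cf dG); [|lra|lra].
apply: (is_derive_0_is_cst (f := fun x => G (x + 2 * pi) - G x)) => x.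
have H := is_deriveB (is_derive_shift (dG (x + 2 * pi))) (dG x).
by apply: (@is_derive_eq _ _ _ _ _ _ _ _ H); rewrite pf subrr.
Qed.

Lemma itg_pi f x : circle_fun f -> continuous f ->
  itg f (- pi) pi = itg f (x - pi) (x + pi).
Proof.
move=> pf cf.
have := itg_period (- pi) (x - pi) pf cf.
have -> : - pi + 2 * pi = pi :> R by ring.
by have -> : x - pi + 2 * pi = x + pi by ring.
Qed.

Lemma itg_sin (l : int) c :
  itg (fun u => sin (l%:~R * u + c)) (- pi) pi = if l == 0 then 2 * pi * sin c else 0.
Proof.
have pi0 := @pi_gt0 R.
have pp : - pi <= pi :> R by lra.
have [->|l0] := eqVneq l 0.
  have -> : (fun u : R => sin (0%:~R * u + c)) = cst (sin c).
    by apply/funext => u; rewrite mul0r add0r.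
  by rewrite [LHS]itg_cst//; ring.
have l0R : l%:~R != 0 :> R by rewrite intr_eq0.
have cs : continuous (fun u : R => sin (l%:~R * u + c)).
  by apply: is_derive_continuous; exact: is_derive_sin_affine.
have dG (u : R) : is_derive u 1 (fun u => - l%:~R^-1 * cos (l%:~R * u + c)) (sin (l%:~R * u + c)).
  have H := is_deriveZ (- l%:~R^-1) (is_derive_cos_affine l%:~R c u).
  by apply: (@is_derive_eq _ _ _ _ _ _ _ _ H); rewrite /GRing.scale/=; field.
rewrite (itg_FTC2 pp cs dG) -mulrBr.
have <- : cos (l%:~R * - pi + c + l%:~R * (2 * pi)) = cos (l%:~R * pi + c).
  by congr cos; ring.
by rewrite (circle_fun_int _ _ cos_circle) subrr mulr0.
Qed.

Lemma locint_sum (I : Type) (r : seq I) (F : I -> R -> R) : (forall i, locint (F i)) ->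
  locint (fun x => \sum_(i <- r) F i x).
Proof.
move=> Fi; elim: r => [|i r IH].
  by apply: continuous_locint; under eq_fun do rewrite big_nil; move=> x; exact: cvg_cst.
by have := locintD (Fi i) IH; congr locint; apply/funext => x; rewrite big_cons.
Qed.

Lemma itg_sum (I : Type) (r : seq I) (F : I -> R -> R) a b : a <= b -> (forall i, locint (F i)) ->
  itg (fun x => \sum_(i <- r) F i x) a b = \sum_(i <- r) itg (F i) a b.
Proof.
move=> ab Fi; elim: r => [|i r IH].
  under eq_fun do rewrite big_nil.
  by rewrite big_nil itg_cst// mul0r.
rewrite big_cons -IH -itgD//; last exact: locint_sum.
by congr itg; apply/funext => x; rewrite big_cons.
Qed.

(** The derivative of a trigonometric polynomial of degree at most N is its
    integral against this kernel, divided by pi; by orthogonality the k-th term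
    extracts the frequency k. *)
Definition dkernel N : R -> R := fun t => \sum_(0 <= k < N.+1) k%:R * sin (k%:R * t).

Lemma dkernel_bound N t : `|dkernel N t| <= N%:R * N.+1%:R.
Proof.
apply: le_trans (ler_norm_sum _ _ _) _.
have -> : N%:R * N.+1%:R = \sum_(0 <= k < N.+1) N%:R :> R.
  by rewrite sumr_const_nat subn0 mulr_natr.
rewrite big_nat [X in _ <= X]big_nat; apply: ler_sum => k /andP[_ kN].
rewrite normrM normr_nat; apply: le_trans (_ : k%:R * 1 <= _).
  by rewrite ler_wpM2l// sin_max.
by rewrite mulr1 ler_nat -ltnS.
Qed.

Lemma wave_dkernel j d N x u : wave j d u * dkernel N (u - x) =
  \sum_(0 <= k < N.+1) (k%:R / 2) * (sin ((k%:Z + j%:Z)%:~R * u + (d - k%:R * x))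
     + sin ((k%:Z - j%:Z)%:~R * u + (- (k%:R * x) - d))).
Proof.
rewrite /dkernel mulr_sumr; apply: eq_bigr => k _.
rewrite /wave intrD intrB !pmulrn.
have -> : ((k : int)%:~R + (j : int)%:~R) * u + (d - (k : int)%:~R * x) = k%:~R * (u - x) + (j%:~R * u + d) :> R.
  by ring.
have -> : ((k : int)%:~R - (j : int)%:~R) * u + (- ((k : int)%:~R * x) - d) = k%:~R * (u - x) - (j%:~R * u + d) :> R.
  by ring.
rewrite (sinD (k%:~R * (u - x))) (sinB (k%:~R * (u - x))).
by field.
Qed.

Lemma itg_wave_dkernel j d N x : (j <= N)%N ->
  itg (fun u => wave j d u * dkernel N (u - x)) (- pi) pi = pi * derive1 (wave j d) x.
Proof.
move=> jN; have pi0 := @pi_gt0 R.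
have pp : - pi <= pi :> R by lra.
under eq_fun do rewrite wave_dkernel.
have cs (l : int) c : locint (fun u : R => sin (l%:~R * u + c)).
  by apply: continuous_locint; apply: is_derive_continuous; exact: is_derive_sin_affine.
rewrite itg_sum//; last first.
  by move=> k; apply: locintZ; apply: locintD; exact: cs.
rewrite (derive1_eq (is_derive_wave j d)).
have E k : itg (fun u => k%:R / 2 * (sin ((k%:Z + j%:Z)%:~R * u + (d - k%:R * x)) +
     sin ((k%:Z - j%:Z)%:~R * u + (- (k%:R * x) - d)))) (- pi) pi =
     if k == j then pi * (j%:R * wave j (d + pi / 2) x) else 0.
  rewrite itgZ; last by apply: locintD; exact: cs.
  rewrite itgD// !itg_sin subr_eq0 eqz_nat.
  have [->|k0] := eqVneq k 0%N.
    rewrite mul0r mul0r; case: eqP => // <-; by rewrite mul0r mulr0.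
  rewrite addn_eq0 (negbTE k0)/= add0r eqz_nat.
  case: eqP => [->|]; last by rewrite mulr0.
  rewrite /wave addrA cosDpihalf -opprD sinN addrC.
  by field.
under eq_bigr do rewrite E.
rewrite (bigD1_seq j); [|by rewrite mem_index_iota ltnS|exact: iota_uniq].
by rewrite /= eqxx big1 ?addr0// => k /negbTE ->.
Qed.

Lemma continuous_sum (I : Type) (r : seq I) (F : I -> R -> R) :
  (forall i, continuous (F i)) -> continuous (fun x => \sum_(i <- r) F i x).
Proof.
move=> Fc; elim: r => [|i r IH].
  have -> : (fun x : R => \sum_(i <- [::]) F i x) = cst 0.
    by apply/funext => x; rewrite big_nil.
  by move=> x; exact: cvg_cst.
have -> : (fun x : R => \sum_(j <- i :: r) F j x) = F i \+ (fun x : R => \sum_(j <- r) F j x).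
  by apply/funext => x; rewrite big_cons.
by move=> x; apply: cvgD; [exact: Fc|exact: IH].
Qed.

Lemma continuous_dkernel N x : continuous (fun u => dkernel N (u - x)).
Proof.
apply: continuous_sum => k.
have -> : (fun u : R => k%:R * sin (k%:R * (u - x))) =
    (fun u : R => k%:R * sin (k%:R * u + - (k%:R * x))).
  by apply/funext => v; rewrite mulrBr.
have cs : continuous (fun u : R => sin (k%:R * u + - (k%:R * x))).
  exact: (is_derive_continuous (is_derive_sin_affine _ _)).
by move=> u; apply: cvgM; [exact: cvg_cst|exact: cs].
Qed.

Lemma itg_dkernel N P x : trig_poly N P ->
  itg (fun u => P u * dkernel N (u - x)) (- pi) pi = pi * derive1 P x.
Proof.
move=> tP; suff [_ //] : smooth 1 P /\
  itg (fun u => P u * dkernel N (u - x)) (- pi) pi = pi * derive1 P x.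
have L T : smooth 1 T -> locint (fun u => T u * dkernel N (u - x)).
  move=> sT; apply: continuous_locint => u.
  apply: cvgM; [exact: (smooth_continuous sT)|exact: continuous_dkernel].
move: P tP; apply: trig_poly_ind.
- move=> T U [sT hT] [sU hU].
  have sTU : smooth 1 (T \+ U).
    have := smoothB sT (smoothZ (-1) sU); congr (smooth 1).
    by apply/funext => t /=; rewrite mulN1r opprK.
  split=> //.
  have -> : derive1 (T \+ U) = derive1 T \+ derive1 U.
    by apply: derive1_eq => t; exact: is_deriveD (smooth_is_derive t sT) (smooth_is_derive t sU).
  rewrite /= mulrDr -hT -hU -itgD; [|exact: L|exact: L].
  by congr itg; apply/funext => t /=; rewrite mulrDl.
- move=> c T [sT hT]; split; first exact: smoothZ.
  rewrite (derive1Z c sT) mulrCA -hT -itgZ; last exact: L.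
  by congr itg; apply/funext => t; rewrite mulrA.
- move=> j d jN; split; last exact: itg_wave_dkernel.
  exact: (trig_poly_smooth _ (trig_poly_wave d (leqnn j))).
Qed.

End TrigPoly.

(** * The Fejer and Jackson kernels *)

Section Kernels.
Context {R : realType}.
Implicit Types (T U f g w phi : R -> R) (a b c d x y t : R) (n m N j k : nat).

Definition csum n : R -> R := fun t => \sum_(0 <= k < n) cos (k%:R * t).
Definition ssum n : R -> R := fun t => \sum_(0 <= k < n) sin (k%:R * t).
(** As a sum of two squares, n times the usual Fejer kernel: the squared
    modulus of the sum of exp (i k t) over k < n. *)
Definition fejer n : R -> R := fun t => csum n t * csum n t + ssum n t * ssum n t.

Lemma trig_poly_csum n : trig_poly n (csum n).
Proof.
exists (fun k => if (k < n)%N then 1 else 0), (fun=> 0); apply/funext => t.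
rewrite big_nat_recr//= ltnn !mul0r !addr0.
by apply: eq_big_nat => k /andP[_ ->]; rewrite mul1r mul0r addr0.
Qed.

Lemma trig_poly_ssum n : trig_poly n (ssum n).
Proof.
exists (fun=> 0), (fun k => if (k < n)%N then 1 else 0); apply/funext => t.
rewrite big_nat_recr//= ltnn !mul0r !addr0.
by apply: eq_big_nat => k /andP[_ ->]; rewrite mul1r mul0r add0r.
Qed.

Lemma trig_poly_fejer n : trig_poly (n + n) (fejer n).
Proof.
have c := trig_poly_csum n; have s := trig_poly_ssum n.
exact: trig_polyD (trig_polyM c c) (trig_polyM s s).
Qed.

Lemma fejerN n t : fejer n (- t) = fejer n t.
Proof.
have cN : csum n (- t) = csum n t.
  by apply: eq_bigr => k _; rewrite mulrN cosN.
have sN : ssum n (- t) = - ssum n t.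
  by rewrite /ssum -sumrN; apply: eq_bigr => k _; rewrite mulrN sinN.
by rewrite /fejer cN sN mulrNN.
Qed.

Lemma fejer0 n : fejer n 0 = n%:R ^+ 2.
Proof.
have c0 : csum n 0 = n%:R.
  rewrite /csum (eq_bigr (fun=> 1)); last by move=> k _; rewrite mulr0 cos0.
  by rewrite sumr_const_nat subn0.
have s0 : ssum n 0 = 0.
  by rewrite /ssum big1// => k _; rewrite mulr0 sin0.
by rewrite /fejer c0 s0 mulr0 addr0 expr2.
Qed.

Lemma fejer_ge0 n t : 0 <= fejer n t.
Proof. by rewrite /fejer -!expr2 addr_ge0// sqr_ge0. Qed.

(** Multiplication by |1 - exp (i t)|^2 telescopes the geometric sum to
    |1 - exp (i n t)|^2. *)
Lemma fejer_mul n t : fejer n t * (2 - 2 * cos t) = 2 - 2 * cos (n%:R * t).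
Proof.
have E : csum n t - (csum n t * cos t - ssum n t * sin t) = 1 - cos (n%:R * t) /\
   ssum n t - (csum n t * sin t + ssum n t * cos t) = - sin (n%:R * t).
  elim: n => [|n [IH1 IH2]].
    have -> : csum 0 t = 0 by rewrite /csum big_geq.
    have -> : ssum 0 t = 0 by rewrite /ssum big_geq.
    by rewrite !mul0r cos0 sin0; split; ring.
  have -> : csum n.+1 t = csum n t + cos (n%:R * t) by rewrite /csum big_nat_recr.
  have -> : ssum n.+1 t = ssum n t + sin (n%:R * t) by rewrite /ssum big_nat_recr.
  have -> : n.+1%:R * t = n%:R * t + t by rewrite -natr1 mulrDl mul1r.
  rewrite cosD sinD; split.
    have -> : 1 - (cos (n%:R * t) * cos t - sin (n%:R * t) * sin t) =
      1 - cos (n%:R * t) + (cos (n%:R * t) - (cos (n%:R * t) * cos t - sin (n%:R * t) * sin t)) by ring.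
    by rewrite -IH1; ring.
  have -> : - (sin (n%:R * t) * cos t + cos (n%:R * t) * sin t) =
      - sin (n%:R * t) + (sin (n%:R * t) - (sin (n%:R * t) * cos t + cos (n%:R * t) * sin t)) by ring.
  by rewrite -IH2; ring.
case: E => E1 E2.
have cs1 := cos2Dsin2 t; have cs2 := cos2Dsin2 (n%:R * t).
have -> : 2 - 2 * cos (n%:R * t) = (1 - cos (n%:R * t)) ^+ 2 + (- sin (n%:R * t)) ^+ 2.
  have -> : (1 - cos (n%:R * t)) ^+ 2 + (- sin (n%:R * t)) ^+ 2 =
    1 - 2 * cos (n%:R * t) + (cos (n%:R * t) ^+ 2 + sin (n%:R * t) ^+ 2) by ring.
  by rewrite cs2; ring.
rewrite -E1 -E2 /fejer.
have -> : 2 - 2 * cos t = 1 - 2 * cos t + (cos t ^+ 2 + sin t ^+ 2) by rewrite cs1; ring.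
ring.
Qed.

Lemma csum_le n t : `|csum n t| <= n%:R.
Proof.
apply: le_trans (ler_norm_sum _ _ _) _.
apply: (@le_trans _ _ (\sum_(0 <= k < n) 1)); last by rewrite sumr_const_nat subn0.
by apply: ler_sum => k _; exact: cos_max.
Qed.

Lemma ssum_le n t : `|ssum n t| <= n%:R.
Proof.
apply: le_trans (ler_norm_sum _ _ _) _.
apply: (@le_trans _ _ (\sum_(0 <= k < n) 1)); last by rewrite sumr_const_nat subn0.
by apply: ler_sum => k _; exact: sin_max.
Qed.

Lemma fejer_le n t : fejer n t <= 2 * n%:R ^+ 2.
Proof.
rewrite /fejer -!expr2 mulr_natl mulr2n.
by apply: lerD; rewrite -[X in X <= _]real_normK ?num_real// ler_pXn2r ?nnegrE ?csum_le ?ssum_le.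
Qed.

(** A lower bound of the cosine on [-1, 1], used in place of sharp constants.
    *)
Definition kap : R := cos 1.

Lemma kap_gt0 : 0 < kap. Proof. exact: cos1_gt0. Qed.
Lemma kap_le1 : kap <= 1. Proof. exact: cos_le1. Qed.

Lemma kap_le_cos t : `|t| <= 1 -> kap <= cos t.
Proof.
move=> t1; rewrite -(cos_norm t) /kap.
have pi2 := @pi_ge2 R; have := normr_ge0 t => t0.
by rewrite leNgt ltr_cos ?in_itv/= -?leNgt//; apply/andP; split; lra.
Qed.

Lemma sin_lower y : 0 <= y <= pi / 2 -> kap / 2 * y <= sin y.
Proof.
move=> /andP[y0 y2]; have k0 := kap_gt0.
have pi2 := @pi_ge2 R.
have S z : 0 <= z <= 1 -> kap * z <= sin z.
  move=> /andP[z0 z1].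
  have := @MVT_segment R sin cos 0 z z0 (fun x _ => is_derive_sin x).
  case; first by apply: continuous_subspaceT => x; exact: continuous_sin.
  move=> e; rewrite in_itv/= => /andP[e0 ez]; rewrite sin0 !subr0 => ->.
  by rewrite ler_wpM2r// kap_le_cos// ger0_norm// (le_trans ez).
have [y1|y1] := leP y 1.
  have := S y; rewrite y0 y1 => /(_ isT); have : 0 <= kap * y by rewrite mulr_ge0// ltW.
  lra.
have s1 := S 1; rewrite ler01 lexx mulr1 in s1.
have : sin 1 <= sin y.
  by rewrite leNgt ltr_sin ?in_itv/= -?leNgt ?(ltW y1)//; apply/andP; split; lra.
move: (s1 isT) => s1'.
have p4 : pi / 2 <= 2 :> R by exact: ltW (@pihalf_lt2 R).
have : kap / 2 * y <= kap / 2 * 2 by rewrite ler_pM2l; lra.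
lra.
Qed.

(** 2 - 2 cos t is 4 sin^2 (t/2), and the sine is bounded below by a line on
    [0, pi/2]. *)
Lemma cos_upper t : `|t| <= pi -> (kap / 2) ^+ 2 * t ^+ 2 <= 2 - 2 * cos t.
Proof.
move=> tpi.
have -> : 2 - 2 * cos t = 4 * sin (`|t| / 2) ^+ 2.
  rewrite -(cos_norm t) [in LHS](_ : `|t| = (`|t| / 2) *+ 2); last by rewrite mulr2n -splitr.
  by rewrite cos_mulr2n sin2cos2 mulr2n; ring.
have k0 := kap_gt0; have t0 := normr_ge0 t.
have : (kap / 2) * (`|t| / 2) <= sin (`|t| / 2).
  by apply: sin_lower; apply/andP; split; lra.
have L0 : 0 <= (kap / 2) * (`|t| / 2) by rewrite mulr_ge0; lra.
move=> H; have : ((kap / 2) * (`|t| / 2)) ^+ 2 <= sin (`|t| / 2) ^+ 2.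
  by rewrite ler_pXn2r ?nnegrE// (le_trans L0).
have -> : (kap / 2 * (`|t| / 2)) ^+ 2 = (kap / 2) ^+ 2 * (`|t| ^+ 2) / 4 by field.
rewrite real_normK ?num_real//; lra.
Qed.

Definition fejer_cst : R := 16 / kap ^+ 2.

Lemma fejer_cst_ge : 16 <= fejer_cst.
Proof.
rewrite /fejer_cst ler_pdivlMr ?exprn_gt0 ?kap_gt0//.
have : kap ^+ 2 <= 1 by rewrite exprn_ile1// ?(ltW kap_gt0)// kap_le1.
lra.
Qed.

(** On [-pi, pi] the factor 2 - 2 cos t is at least a multiple of t^2, while
    its product with the kernel stays below 4. *)
Lemma fejer_decay n t : `|t| <= pi -> fejer n t * t ^+ 2 <= fejer_cst.
Proof.
move=> tpi; have := cos_upper tpi => H.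
have F0 := fejer_ge0 n t; have := fejer_mul n t => E.
have : fejer n t * ((kap / 2) ^+ 2 * t ^+ 2) <= 4.
  apply: le_trans (ler_wpM2l F0 H) _; rewrite E.
  by have := cos_geN1 (n%:R * t); lra.
have k2 : 0 < kap ^+ 2 by rewrite exprn_gt0// kap_gt0.
rewrite /fejer_cst ler_pdivlMr//.
have -> : fejer n t * ((kap / 2) ^+ 2 * t ^+ 2) = fejer n t * t ^+ 2 * kap ^+ 2 / 4 by field.
lra.
Qed.

(** The kernel is even. *)
Lemma derive1_fejer0 n : derive1 (fejer n) 0 = 0.
Proof.
have sF := trig_poly_smooth 1 (trig_poly_fejer n).
have d0 := smooth_is_derive (0 : R) sF.
have dN : is_derive (0 : R) 1 (fun t : R => - t) (-1).
  exact: is_deriveNid.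
have dF : is_derive (- (0 : R)) 1 (fejer n) (derive1 (fejer n) 0) by rewrite oppr0.
have := @is_derive1_comp R (fejer n) (fun t => - t) 0 _ _ dF dN.
have -> : fejer n \o (fun t => - t) = fejer n by apply/funext => t /=; exact: fejerN.
move=> [_ E1]; case: d0 => _ E2.
move: E1; rewrite E2 mulrN1; lra.
Qed.

(** On the shell between radii 2^j del and 2^(j+1) del the kernel w is at most
    M (j+1), and the shell is contained in the ball of the larger radius. *)
Lemma shell_bound phi w x (del : R) (M : nat -> R) J :
  continuous phi -> continuous w -> 0 < del ->
  (forall t, `|t| <= del -> `|w t| <= M 0%N) ->
  (forall j t, (j < J)%N -> 2 ^+ j * del <= `|t| -> `|t| <= 2 ^+ j.+1 * del -> `|w t| <= M j.+1) ->
  itg (fun u => `|phi u * w (u - x)|) (x - 2 ^+ J * del) (x + 2 ^+ J * del) <=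
  \sum_(0 <= j < J.+1) M j * itg (fun u => `|phi u|) (x - 2 ^+ j * del) (x + 2 ^+ j * del).
Proof.
move=> cphi cw d0 H0.
have ca : locint (fun u => `|phi u|) by apply: locint_abs; exact: continuous_locint.
have cpw : locint (fun u => `|phi u * w (u - x)|).
  apply: locint_abs; apply: continuous_locint => u; apply: cvgM; first exact: cphi.
  have -> : (fun u => w (u - x)) = w \o (fun u => u - x) by [].
  apply: continuous_comp; last exact: cw.
  by apply: cvgB; [exact: cvg_id|exact: cvg_cst].
have B a b Mj : (forall u, a <= u <= b -> `|w (u - x)| <= Mj) ->
    itg (fun u => `|phi u * w (u - x)|) a b <= Mj * itg (fun u => `|phi u|) a b.
  move=> Hu; rewrite -itgZ//; apply: itg_le => //; first exact: locintZ.
  by move=> u /Hu; rewrite normrM mulrC => H; rewrite ler_wpM2r.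
elim: J => [|J IH] HJ.
  rewrite big_nat1; apply: B => u /andP[u1 u2]; apply: H0.
  by rewrite ler_norml; move: u1 u2; rewrite expr0 mul1r => u1 u2; apply/andP; split; lra.
rewrite big_nat_recr//=.
set L := 2 ^+ J * del.
have -> : 2 ^+ J.+1 * del = 2 * L by rewrite exprS mulrA.
have L0 : 0 < L by rewrite mulr_gt0// exprn_gt0.
have HL t : L <= `|t| -> `|t| <= 2 * L -> `|w t| <= M J.+1.
  by move=> t1 t2; apply: (HJ J) => //; rewrite exprS -mulrA.
have M0 : 0 <= M J.+1.
  by apply: le_trans (normr_ge0 (w L)) (HL L _ _); rewrite gtr0_norm//; lra.
have e1 : x - 2 * L <= x - L by lra.
have e2 : x - L <= x + L by lra.
have e3 : x + L <= x + 2 * L by lra.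
rewrite (itg_split cpw e1 (le_trans e2 e3)) (itg_split cpw e2 e3).
rewrite (itg_split ca e1 (le_trans e2 e3)) (itg_split ca e2 e3).
have b1 : itg (fun u => `|phi u * w (u - x)|) (x - 2 * L) (x - L) <=
    M J.+1 * itg (fun u => `|phi u|) (x - 2 * L) (x - L).
  apply: B => u /andP[u1 u2]; apply: HL; have -> : `|u - x| = x - u.
  - by rewrite ler0_norm; lra.
  - lra.
  - by rewrite ler0_norm; lra.
  - lra.
have b3 : itg (fun u => `|phi u * w (u - x)|) (x + L) (x + 2 * L) <=
    M J.+1 * itg (fun u => `|phi u|) (x + L) (x + 2 * L).
  apply: B => u /andP[u1 u2]; apply: HL; have -> : `|u - x| = u - x.
  - by rewrite ger0_norm; lra.
  - lra.
  - by rewrite ger0_norm; lra.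
  - lra.
have b2 := IH (fun j t jJ => HJ j t (ltnW jJ)).
have pos : 0 <= M J.+1 * itg (fun u => `|phi u|) (x - L) (x + L).
  by rewrite mulr_ge0// itg_ge0.
rewrite -/L in b2; lra.
Qed.

(** The smallest radius is comparable to 1/n and doubling it a whole number of
    times reaches pi exactly, so that the shells exhaust one period. *)
Lemma dyadic_scale n : (0 < n)%N -> exists J, exists2 del : R,
  0 < del <= pi / n%:R & 2 ^+ J * del = pi /\ forall j, 2 ^+ j <= n%:R * (2 ^+ j * del).
Proof.
move=> n0; have pi2 := @pi_ge2 R.
have n0R : 0 < n%:R :> R by rewrite ltr0n.
have /andP[l u] := trunc_log_bounds (isT : (1 < 2)%N) n0.
exists (trunc_log 2 n).+1.
have P0 k : 0 < 2 ^+ k :> R by rewrite exprn_gt0.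
exists (pi / 2 ^+ (trunc_log 2 n).+1).
  rewrite divr_gt0 ?pi_gt0//= ler_wpM2l ?pi_ge0// lef_pV2 ?posrE//.
  by rewrite -natrX ler_nat ltnW.
split; first by rewrite mulrCA divff ?mulr1// gt_eqF.
move=> j; rewrite mulrCA ler_peMr ?(ltW (P0 _))//.
rewrite mulrA ler_pdivlMr// mul1r.
have : 2 ^+ (trunc_log 2 n) <= n%:R :> R by rewrite -natrX ler_nat.
rewrite exprS => h; apply: (@le_trans _ _ (n%:R * 2)); last by rewrite ler_wpM2l ?(ltW n0R).
by rewrite mulrC ler_wpM2r.
Qed.

(** A kernel of height M with polynomial decay of order p on the scale 1/n acts
    like a sum of integrals over dyadic balls; the coefficients 2^(-jp) make up
    for the growth 2^j of the balls as soon as p is at least 2. *)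
Lemma kernel_bound n p phi w x (del M : R) J : continuous phi -> continuous w ->
  (0 < n)%N -> 0 < del -> 2 ^+ J * del = pi ->
  (forall j, 2 ^+ j <= n%:R * (2 ^+ j * del)) ->
  (forall t, `|t| <= pi -> `|w t| <= M /\ `|w t| * (n%:R * `|t|) ^+ p <= M) ->
  `|itg (fun u => phi u * w (u - x)) (x - pi) (x + pi)| <=
  \sum_(0 <= j < J.+1) (2 ^+ p * M / (2 ^+ j) ^+ p) *
     itg (fun u => `|phi u|) (x - 2 ^+ j * del) (x + 2 ^+ j * del).
Proof.
move=> cphi cw n0 d0 Jd nd wM; have pi0 := @pi_gt0 R.
have P0 k : 0 < 2 ^+ k :> R by rewrite exprn_gt0.
have M0 : 0 <= M.
  have h0 : `|0 : R| <= pi by rewrite normr0 ltW.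
  by have [H _] := wM _ h0; exact: le_trans (normr_ge0 _) H.
have djpi j : (j <= J)%N -> 2 ^+ j * del <= pi.
  by move=> jJ; rewrite -Jd ler_pM2r// ler_weXn2l// ler1n.
have cpw : locint (fun u => phi u * w (u - x)).
  apply: continuous_locint => u; apply: cvgM; first exact: cphi.
  have -> : (fun u => w (u - x)) = w \o (fun u => u - x) by [].
  apply: continuous_comp; last exact: cw.
  by apply: cvgB; [exact: cvg_id|exact: cvg_cst].
apply: le_trans (itg_abs _ _ cpw) _.
rewrite -[in X in X <= _]Jd; apply: shell_bound => //.
  move=> t td; have [|H _] := wM t.
    by apply: le_trans td _; have := djpi 0%N isT; rewrite expr0 mul1r.
  apply: le_trans H _; rewrite expr0 expr1n divr1 ler_peMl//.
  by rewrite exprn_ege1// ler1n.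
move=> j t jJ t1 t2; have [|_ H] := wM t.
  by apply: le_trans t2 _; exact: djpi.
have -> : 2 ^+ p * M / (2 ^+ j.+1) ^+ p = M / (2 ^+ j) ^+ p.
  rewrite exprS exprMn invfM [2 ^+ p * M]mulrC -mulrA mulrA mulrA mulfK ?gt_eqF// ?exprn_gt0//.
rewrite ler_pdivlMr ?exprn_gt0//; apply: le_trans H.
rewrite ler_wpM2l//; apply: lerXn2r; rewrite ?nnegrE ?(ltW (P0 _)) ?mulr_ge0//.
by apply: le_trans (nd j) _; rewrite ler_wpM2l.
Qed.

Lemma geometric_le2 J : \sum_(0 <= j < J) (2 ^+ j)^-1 <= 2 :> R.
Proof.
have P0 k : 0 < 2 ^+ k :> R by rewrite exprn_gt0.
have E k : \sum_(0 <= j < k) (2 ^+ j)^-1 = 2 - 2 / 2 ^+ k :> R.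
  elim: k => [|k IH]; first by rewrite big_geq// expr0 divr1 subrr.
  by rewrite big_nat_recr//= IH exprS; field; rewrite gt_eqF.
by rewrite E gerBl// divr_ge0// ltW.
Qed.

(** The square of the Fejer kernel decays like t^-4; the Fejer kernel itself
    decays too slowly for a first-order estimate. *)
Definition jackson n : R -> R := fejer n \* fejer n.

Lemma trig_poly_jackson n : trig_poly (n + n + (n + n)) (jackson n).
Proof. by apply: trig_polyM; exact: trig_poly_fejer. Qed.

Definition jmass n : R := itg (jackson n) (- pi) pi.

Lemma continuous_jackson n : continuous (jackson n).
Proof. exact: smooth_continuous (trig_poly_smooth 0 (trig_poly_jackson n)). Qed.

(** For |t| <= 1/n every cosine in the kernel is at least kap, which gives a
    height of order n^4 on an interval of length 2/n. *)
Lemma jmass_ge n : (0 < n)%N -> 2 * kap ^+ 4 * n%:R ^+ 3 <= jmass n.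
Proof.
move=> n0; have n0R : 0 < n%:R :> R by rewrite ltr0n.
have pi2 := @pi_ge2 R; have k0 := kap_gt0.
have cj : continuous (jackson n) by exact: continuous_jackson.
have j0 t : 0 <= jackson n t by rewrite /jackson/= -expr2 sqr_ge0.
pose e : R := n%:R^-1.
have e0 : 0 < e by rewrite invr_gt0.
have e1 : e <= 1 by rewrite invf_le1// ler1n.
have ep : - e <= e by lra.
apply: le_trans (itg_sub (continuous_locint cj) j0 (a := - pi) (b := pi) (c := - e) (d := e) _ ep _); [|lra|lra].
have -> : 2 * kap ^+ 4 * n%:R ^+ 3 = (kap ^+ 2 * n%:R ^+ 2) ^+ 2 * (e - - e).
  by rewrite /e; field; rewrite gt_eqF.
rewrite -itg_cst//; apply: itg_le.
- by apply: continuous_locint => t; exact: cvg_cst.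
- exact: continuous_locint.
move=> t te; rewrite /jackson/= -expr2; apply: lerXn2r; rewrite ?nnegrE ?fejer_ge0//.
  by rewrite mulr_ge0 ?exprn_ge0// ltW.
have cs : kap * n%:R <= csum n t.
  rewrite /csum mulr_natr.
  have -> : kap *+ n = \sum_(0 <= k < n) kap by rewrite sumr_const_nat subn0.
  rewrite big_nat [X in _ <= X]big_nat; apply: ler_sum => k /andP[_ kn].
  apply: kap_le_cos; rewrite normrM normr_nat.
  have te' : `|t| <= e by rewrite ler_norml.
  apply: le_trans (ler_wpM2l _ te') _; first by rewrite ler0n.
  by rewrite /e ler_pdivrMr// mul1r ler_nat ltnW.
rewrite /fejer -exprMn -!expr2; apply: le_trans (_ : csum n t ^+ 2 <= _).
  by apply: lerXn2r; rewrite ?nnegrE ?(le_trans _ cs)// mulr_ge0// ltW.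
by rewrite lerDl sqr_ge0.
Qed.

Lemma jmass_gt0 n : (0 < n)%N -> 0 < jmass n.
Proof.
move=> n0; apply: lt_le_trans (jmass_ge n0).
by rewrite !mulr_gt0 ?exprn_gt0 ?kap_gt0 ?ltr0n.
Qed.

Lemma jackson_bound n t : (0 < n)%N -> `|t| <= pi ->
  `|jackson n t| <= fejer_cst ^+ 2 * n%:R ^+ 4 /\
  `|jackson n t| * (n%:R * `|t|) ^+ 4 <= fejer_cst ^+ 2 * n%:R ^+ 4.
Proof.
move=> n0 tpi; have f0 := fejer_ge0 n t; have fc := fejer_cst_ge.
rewrite /jackson/= -expr2 normrX ger0_norm//.
have -> : fejer_cst ^+ 2 * n%:R ^+ 4 = (fejer_cst * n%:R ^+ 2) ^+ 2 by ring.
have c0 : 0 <= fejer_cst * n%:R ^+ 2 by rewrite mulr_ge0 ?exprn_ge0//; lra.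
split; first apply: lerXn2r; rewrite ?nnegrE//.
  apply: le_trans (fejer_le n t) _; rewrite ler_wpM2r ?exprn_ge0//; lra.
have -> : fejer n t ^+ 2 * (n%:R * `|t|) ^+ 4 = (fejer n t * (`|t| ^+ 2) * n%:R ^+ 2) ^+ 2 by ring.
apply: lerXn2r; rewrite ?nnegrE// ?mulr_ge0 ?exprn_ge0//.
by rewrite ler_wpM2r ?exprn_ge0// real_normK ?num_real// fejer_decay.
Qed.

(** The derivative kernel contributes n^2 and no decay; the Fejer factor
    supplies height n^2 and decay of order 2. *)
Lemma bernstein_kernel_bound n t : (0 < n)%N -> `|t| <= pi ->
  `|fejer n t * dkernel (3 * n) t| <= 12 * fejer_cst * n%:R ^+ 4 /\
  `|fejer n t * dkernel (3 * n) t| * (n%:R * `|t|) ^+ 2 <= 12 * fejer_cst * n%:R ^+ 4.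
Proof.
move=> n0 tpi; have f0 := fejer_ge0 n t; have fc := fejer_cst_ge.
have n1 : 1 <= n%:R :> R by rewrite ler1n.
have db : `|dkernel (3 * n) t| <= 12 * n%:R ^+ 2.
  apply: le_trans (dkernel_bound _ _) _.
  rewrite -natr1 natrM; nra.
rewrite normrM ger0_norm//.
have F1 : fejer n t <= fejer_cst * n%:R ^+ 2.
  apply: le_trans (fejer_le n t) _; rewrite ler_wpM2r ?exprn_ge0//; lra.
have F2 : fejer n t * (n%:R * `|t|) ^+ 2 <= fejer_cst * n%:R ^+ 2.
  have -> : fejer n t * (n%:R * `|t|) ^+ 2 = (fejer n t * (`|t| ^+ 2)) * n%:R ^+ 2 by ring.
  by rewrite ler_wpM2r ?exprn_ge0// real_normK ?num_real// fejer_decay.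
have -> : 12 * fejer_cst * n%:R ^+ 4 = fejer_cst * n%:R ^+ 2 * (12 * n%:R ^+ 2) by ring.
split; first by apply: ler_pM.
by rewrite mulrAC; apply: ler_pM => //; rewrite mulr_ge0// exprn_ge0// mulr_ge0.
Qed.

End Kernels.

(** * Bernstein's and Jackson's inequalities *)

Section BernsteinJackson.
Context {R : realType} (X : set (R -> R)) (N : (R -> R) -> R).
Context (hX : banach_lattice X N) (hA : assumptionA X N).
Context (C : R) (C_ge1 : 1 <= C).
Context (steklov_le : forall h f, 0 < h -> X f -> N (steklov h f) <= C * N f).
Implicit Types (f g T : R -> R) (x y h del : R) (n m : nat).

(** Pointwise domination by averages of |g| at several scales passes to norms
    by the uniform bound for Steklov averages. *)
Lemma norm_sum_steklov (r : seq nat) (c h : nat -> R) f g : X f -> X g ->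
  (forall j, 0 <= c j) -> (forall j, 0 < h j) ->
  (forall x, `|f x| <= \sum_(j <- r) c j * steklov (h j) (fun t => `|g t|) x) ->
  N f <= (\sum_(j <- r) c j) * C * N g.
Proof.
move=> Xf Xg c0 h0 H; have Xa := lat_abs hX Xg.
have XS j : X (steklov (h j) (fun t => `|g t|)) by exact: (proj1 hA).
have S (l : seq nat) : X (fun x => \sum_(j <- l) c j * steklov (h j) (fun t => `|g t|) x) /\
    N (fun x => \sum_(j <- l) c j * steklov (h j) (fun t => `|g t|) x) <= (\sum_(j <- l) c j) * C * N g.
  elim: l => [|j l [IHX IHN]].
    have -> : (fun x : R => \sum_(j <- [::]) c j * steklov (h j) (fun t => `|g t|) x) = cst 0.
      by apply/funext => x; rewrite big_nil.
    split; first exact: (lat_cst hX).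
    by rewrite (norm0 hX) big_nil !mul0r.
  have -> : (fun x : R => \sum_(i <- j :: l) c i * steklov (h i) (fun t => `|g t|) x) =
     (fun x : R => c j * steklov (h j) (fun t => `|g t|) x) \+
     (fun x : R => \sum_(i <- l) c i * steklov (h i) (fun t => `|g t|) x).
    by apply/funext => x; rewrite big_cons.
  have Xj := lat_scale hX (c j) (XS j).
  split; first exact: (lat_add hX).
  apply: le_trans (norm_add hX Xj IHX) _.
  rewrite big_cons !mulrDl lerD// (norm_scale hX)// ger0_norm// -mulrA ler_wpM2l//.
  by rewrite -(norm_abs hX Xg); exact: steklov_le.
have [XF NF] := S r.
apply: le_trans NF; apply: (proj2 (lat_dom hX (bl_measurable hX Xf) XF _)) => x.
exact: le_trans (H x) (ler_norm _).
Qed.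

Lemma trig_poly_lat n T : trig_poly n T -> X T.
Proof. by move=> tT; exact: (smooth_lat hX (trig_poly_smooth 0 tT)). Qed.

Definition bernstein_cst : R := 12 * 16 * fejer_cst * C.

Lemma bernstein_cst_ge0 : 0 <= bernstein_cst.
Proof.
have fc := @fejer_cst_ge R; have C0 : 0 <= C by exact: le_trans ler01 C_ge1.
by rewrite /bernstein_cst; apply: mulr_ge0 => //; apply: mulr_ge0; lra.
Qed.

(** For fixed x put P u = T u * fejer n (x - u), a polynomial of degree 3n.
    Since the Fejer kernel has value n^2 and derivative 0 at the origin, D P
    x = n^2 D T x, and integrating P against the derivative kernel expresses
    D T x as an integral of T against a kernel localized at scale 1/n. The
    shells then bound |D T| by averages of |T|. *)
Lemma bernstein n T : (0 < n)%N -> trig_poly n T ->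
  N (derive1 T) <= bernstein_cst * n%:R * N T.
Proof.
move=> n0 tT; have pi2 := @pi_ge2 R.
have n0R : 0 < n%:R :> R by rewrite ltr0n.
have fc := @fejer_cst_ge R.
have [J [del /andP[d0 dn] [Jd nd]]] := @dyadic_scale R n n0.
have sT := trig_poly_smooth 1 tT.
have cT := smooth_continuous sT.
have sF := trig_poly_smooth 1 (@trig_poly_fejer R n).
have cw : continuous (fun t : R => fejer n t * dkernel (3 * n) t).
  move=> t; apply: cvgM; first exact: (smooth_continuous sF).
  have -> : dkernel (3 * n) = (fun u : R => dkernel (3 * n) (u - 0)).
    by apply/funext => u; rewrite subr0.
  exact: continuous_dkernel.
have P0 k : 0 < 2 ^+ k :> R by rewrite exprn_gt0.
pose M : R := 12 * fejer_cst * n%:R ^+ 4.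
pose c j : R := (n%:R ^- 2 * pi^-1) * (2 ^+ 2 * M / (2 ^+ j) ^+ 2) * (2 * (2 ^+ j * del)).
have key x : `|derive1 T x| <= \sum_(0 <= j < J.+1) c j * steklov (2 * (2 ^+ j * del)) (fun t => `|T t|) x.
  pose P u := T u * fejer n (x - u).
  have tP : trig_poly (3 * n) P.
    have := trig_polyM tT (trig_poly_reflect x (@trig_poly_fejer R n)).
    by have -> : (n + (n + n) = 3 * n)%N by rewrite !mulSn mul0n addn0.
  have E := itg_dkernel x tP.
  have dP : derive1 P x = n%:R ^+ 2 * derive1 T x.
    have d1 := smooth_is_derive x sT.
    have d2 : is_derive x 1 (fun u => fejer n (x - u)) 0.
      have a1 : is_derive x 1 (fun u : R => x - u) (-1).
        have H := is_deriveB (is_derive_cst x x (1 : R)) (is_derive_id x (1 : R)).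
        by apply: (@is_derive_eq _ _ _ _ _ _ _ _ H); rewrite sub0r.
      have a2 : is_derive (x - x) 1 (fejer n) 0.
        by rewrite subrr; have := smooth_is_derive (0 : R) sF; rewrite derive1_fejer0.
      have H := @is_derive1_comp R (fejer n) (fun u : R => x - u) x _ _ a2 a1.
      by apply: (@is_derive_eq _ _ _ _ _ _ _ _ H); rewrite mul0r.
    have H : is_derive x 1 P _ := is_deriveM d1 d2.
    case: H => _; rewrite [in X in _ -> X = _]derive1E => ->.
    by rewrite /GRing.scale/= mulr0 add0r subrr fejer0.
  have cP : continuous (fun u => P u * dkernel (3 * n) (u - x)).
    move=> u; apply: cvgM; last exact: continuous_dkernel.
    exact: (smooth_continuous (trig_poly_smooth 0 tP)).
  have pP : circle_fun (fun u => P u * dkernel (3 * n) (u - x)).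
    move=> u; rewrite (trig_poly_circle tP); congr (_ * _).
    rewrite /dkernel; apply: eq_bigr => k _; congr (_ * _).
    rewrite -[RHS](circle_fun_int (k : int) _ (@sin_circle R)); congr sin.
    by rewrite pmulrn; ring.
  rewrite dP (itg_pi x pP cP) in E.
  have -> : derive1 T x = n%:R ^- 2 * pi^-1 *
     itg (fun u => P u * dkernel (3 * n) (u - x)) (x - pi) (x + pi).
    by rewrite E; field; rewrite !gt_eqF//; lra.
  have -> : (fun u => P u * dkernel (3 * n) (u - x)) =
      (fun u => T u * (fun t => fejer n t * dkernel (3 * n) t) (u - x)).
    by apply/funext => u; rewrite /P -fejerN opprB mulrA.
  have q0 : 0 <= n%:R ^- 2 * pi^-1 :> R by rewrite mulr_ge0 ?invr_ge0 ?exprn_ge0 ?pi_ge0.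
  rewrite normrM ger0_norm//.
  have := kernel_bound (p := 2) x cT cw n0 d0 Jd nd (fun t => @bernstein_kernel_bound R n t n0).
  move=> /(ler_wpM2l q0)/le_trans; apply.
  rewrite mulr_sumr le_eqVlt; apply/orP; left; apply/eqP; apply: eq_bigr => j _.
  rewrite steklovE /c -/M.
  have -> : 2 * (2 ^+ j * del) / 2 = 2 ^+ j * del by field.
  field; rewrite !gt_eqF ?exprn_gt0//; lra.
have Xd := trig_poly_lat (trig_poly_derive1 tT).
have A1 : 0 <= 12 * fejer_cst * n%:R ^+ 4 :> R.
  by apply: mulr_ge0; [apply: mulr_ge0; lra|exact: exprn_ge0].
have c0 j : 0 <= c j.
  rewrite /c; apply: mulr_ge0; last by rewrite !mulr_ge0 ?(ltW (P0 _)) ?(ltW d0).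
  apply: mulr_ge0; first by rewrite mulr_ge0 ?invr_ge0 ?exprn_ge0 ?pi_ge0.
  apply: divr_ge0; first by apply: mulr_ge0 => //; exact: exprn_ge0.
  by apply: exprn_ge0; exact: ltW.
have h0 j : 0 < 2 * (2 ^+ j * del) by rewrite !mulr_gt0.
apply: le_trans (norm_sum_steklov Xd (trig_poly_lat tT) c0 h0 key) _.
apply: ler_wpM2r; first exact: (norm_ge0 hX (trig_poly_lat tT)).
have -> : bernstein_cst * n%:R = (12 * 16 * fejer_cst * n%:R) * C by rewrite /bernstein_cst; ring.
apply: ler_wpM2r; first exact: le_trans ler01 C_ge1.
have -> : \sum_(0 <= j < J.+1) c j = (12 * 8 * fejer_cst * n%:R ^+ 2 * del / pi) * \sum_(0 <= j < J.+1) (2 ^+ j)^-1.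
  rewrite mulr_sumr; apply: eq_bigr => j _; rewrite /c /M; field.
  by rewrite !gt_eqF ?exprn_gt0//; lra.
have fn0 : 0 <= fejer_cst * n%:R :> R by apply: mulr_ge0; lra.
have A0 : 0 <= 12 * 8 * fejer_cst * n%:R ^+ 2 * del / pi.
  have -> : 12 * 8 * fejer_cst * n%:R ^+ 2 * del / pi = 12 * 8 * (fejer_cst * n%:R) * (n%:R * (del / pi)) by ring.
  apply: mulr_ge0; first by lra.
  by rewrite mulr_ge0 ?divr_ge0 ?pi_ge0 ?(ltW d0) ?(ltW n0R).
apply: le_trans (ler_wpM2l A0 (geometric_le2 _)) _.
have -> : 12 * 8 * fejer_cst * n%:R ^+ 2 * del / pi * 2 = (12 * 16 * fejer_cst * n%:R) * (n%:R * del / pi).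
  by field; lra.
apply: ler_piMr; first by rewrite -mulrA; lra.
by rewrite ler_pdivrMr ?mul1r; [rewrite -ler_pdivlMl// mulrC|lra].
Qed.

Lemma bernstein_iter n p T : (0 < n)%N -> trig_poly n T ->
  N (derive1n p T) <= (bernstein_cst * n%:R) ^+ p * N T.
Proof.
move=> n0; elim: p T => [|p IH] T tT; first by rewrite expr0 mul1r.
rewrite derive1Sn; apply: le_trans (IH _ (trig_poly_derive1 tT)) _.
rewrite exprSr -mulrA ler_wpM2l ?bernstein// exprn_ge0// mulr_ge0// bernstein_cst_ge0.
by [].
Qed.

Definition jackson_mean n g : R -> R :=
  fun x => (jmass n)^-1 * itg (fun u => g u * jackson n (x - u)) (- pi) pi.

Lemma continuous_reflect g k x : continuous g -> continuous k ->
  continuous (fun u : R => g u * k (x - u)).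
Proof.
move=> cg ck u; apply: cvgM; first exact: cg.
have -> : (fun u => k (x - u)) = k \o (fun u => x - u) by [].
apply: continuous_comp; last exact: ck.
by apply: cvgB; [exact: cvg_cst|exact: cvg_id].
Qed.

Lemma itg_by_parts f g : smooth 1 f -> smooth 1 g ->
  itg (fun u => derive1 f u * g u) (- pi) pi = - itg (fun u => f u * derive1 g u) (- pi) pi.
Proof.
move=> sf sg; have pi0 := @pi_gt0 R.
have cf := smooth_continuous sf; have cg := smooth_continuous sg.
have cf' := smooth_continuous (smooth_derive1 sf).
have cg' := smooth_continuous (smooth_derive1 sg).
have c1 : continuous (fun u => derive1 f u * g u) by move=> u; apply: cvgM; [exact: cf'|exact: cg].
have c2 : continuous (fun u => f u * derive1 g u) by move=> u; apply: cvgM; [exact: cf|exact: cg'].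
have dfg (u : R) : is_derive u 1 (f \* g) (((fun u => derive1 f u * g u) \+ (fun u => f u * derive1 g u)) u).
  have H := is_deriveM (smooth_is_derive u sf) (smooth_is_derive u sg).
  by apply: (@is_derive_eq _ _ _ _ _ _ _ _ H); rewrite /GRing.scale/=; ring.
apply/eqP; rewrite -addr_eq0 -itgD; [|exact: continuous_locint|exact: continuous_locint].
have pp : - pi <= pi :> R by lra.
have c3 : continuous ((fun u => derive1 f u * g u) \+ (fun u => f u * derive1 g u)).
  by move=> u; apply: cvgD; [exact: c1|exact: c2].
rewrite (itg_FTC2 pp c3 dfg) /=.
have E : pi = - pi + 2 * pi :> R by ring.
by rewrite {1 2}E (smooth_circle sf) (smooth_circle sg) subrr.
Qed.

(** Convolution with one wave produces a combination of two waves, the addition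
    theorem for the cosine. *)
Lemma reflect_wave g j d x : continuous g ->
  itg (fun u => g u * wave j d (x - u)) (- pi) pi =
  cos (j%:R * x) * itg (fun u => g u * wave j (- d) u) (- pi) pi
  + sin (j%:R * x) * itg (fun u => g u * wave j (- d - pi / 2) u) (- pi) pi.
Proof.
move=> cg; have cw e : continuous (fun u => g u * wave j e u).
  by move=> u; apply: cvgM; [exact: cg|exact: (smooth_continuous (trig_poly_smooth 0 (trig_poly_wave e (leqnn j))))].
have li e : locint (fun u => g u * wave j e u) by exact: continuous_locint.
rewrite -!itgZ// -itgD; [|exact: locintZ|exact: locintZ].
congr itg; apply/funext => u /=; rewrite /wave.
have -> : j%:R * (x - u) + d = j%:R * x - (j%:R * u - d) by ring.
have -> : j%:R * u + (- d - pi / 2) = (j%:R * u - d) - pi / 2 by ring.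
rewrite cosBpihalf cosB; ring.
Qed.

(** Convolution with a trigonometric polynomial yields a trigonometric
    polynomial, and its derivative may be put on the other factor by periodic
    integration by parts. Both are checked on waves, where the convolution is
    explicit. *)
Lemma reflect_derive n k g : trig_poly n k -> continuous g ->
  trig_poly n (fun x => itg (fun u => g u * k (x - u)) (- pi) pi) /\
  (smooth 1 g -> forall x,
     is_derive x 1 (fun x => itg (fun u => g u * k (x - u)) (- pi) pi)
       (itg (fun u => derive1 g u * k (x - u)) (- pi) pi)).
Proof.
move=> tk cg.
suff [_ //] : continuous k /\ (trig_poly n (fun x => itg (fun u => g u * k (x - u)) (- pi) pi) /\
  (smooth 1 g -> forall x, is_derive x 1 (fun x => itg (fun u => g u * k (x - u)) (- pi) pi)
     (itg (fun u => derive1 g u * k (x - u)) (- pi) pi))).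
have L f T (x : R) : continuous f -> continuous T -> locint (fun u => f u * T (x - u)).
  by move=> cf cT; apply: continuous_locint; exact: continuous_reflect.
have cD : smooth 1 g -> continuous (derive1 g).
  by move=> sg; exact: smooth_continuous (smooth_derive1 sg).
move: k tk; apply: trig_poly_ind.
- move=> T U [cT [tT dT]] [cU [tU dU]].
  have E f : continuous f -> (fun x => itg (fun u => f u * (T \+ U) (x - u)) (- pi) pi) =
     (fun x => itg (fun u => f u * T (x - u)) (- pi) pi) \+ (fun x => itg (fun u => f u * U (x - u)) (- pi) pi).
    move=> cf; apply/funext => x /=; rewrite -itgD; [|exact: L|exact: L].
    by congr itg; apply/funext => u /=; rewrite mulrDr.
  split; first by move=> x; apply: cvgD; [exact: cT|exact: cU].
  rewrite E//; split; first exact: trig_polyD.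
  move=> sg x; have := E _ (cD sg) => /(congr1 (fun F => F x)) ->.
  exact: is_deriveD (dT sg x) (dU sg x).
- move=> c T [cT [tT dT]].
  have E f : continuous f -> (fun x => itg (fun u => f u * (c * T (x - u))) (- pi) pi) =
     (fun x => c * itg (fun u => f u * T (x - u)) (- pi) pi).
    move=> cf; apply/funext => x /=; rewrite -itgZ; last exact: L.
    by congr itg; apply/funext => u /=; rewrite mulrCA.
  split; first by move=> x; apply: cvgM; [exact: cvg_cst|exact: cT].
  rewrite E//; split; first exact: trig_polyZ.
  move=> sg x; have := E _ (cD sg) => /(congr1 (fun F => F x)) ->.
  exact: is_deriveZ (dT sg x).
- move=> j d jn; split.
    exact: (smooth_continuous (trig_poly_smooth 0 (trig_poly_wave d (leqnn j)))).
  pose a f := itg (fun u => f u * wave j (- d) u) (- pi) pi.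
  pose b f := itg (fun u => f u * wave j (- d - pi / 2) u) (- pi) pi.
  have E f : continuous f -> (fun x => itg (fun u => f u * wave j d (x - u)) (- pi) pi) =
      (fun x => a f * wave j 0 x + b f * wave j (- (pi / 2)) x).
    move=> cf; apply/funext => x; rewrite reflect_wave// /wave addr0 cosBpihalf -/(a f) -/(b f).
    by ring.
  have W (e : R) : smooth 1 (wave j e) by exact: trig_poly_smooth (trig_poly_wave e (leqnn j)).
  have lw (e : R) : locint (fun u => g u * wave j e u).
    apply: continuous_locint => u; apply: cvgM; first exact: cg.
    exact: (smooth_continuous (W e)).
  have ab : smooth 1 g -> a (derive1 g) = j%:R * b g.
    move=> sg; rewrite /a itg_by_parts// (derive1_eq (is_derive_wave j (- d))) /b.
    rewrite -itgZ; last exact: lw.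
    rewrite -[in LHS]mulN1r -itgZ; last first.
      have := locintZ j%:R (lw (- d + pi / 2)); congr locint; apply/funext => u; ring.
    congr itg; apply/funext => u.
    rewrite /wave addrA cosDpihalf.
    have -> : j%:R * u + (- d - pi / 2) = (j%:R * u - d) - pi / 2 by ring.
    by rewrite cosBpihalf; ring.
  have ba : smooth 1 g -> b (derive1 g) = - j%:R * a g.
    move=> sg; rewrite /b itg_by_parts// (derive1_eq (is_derive_wave j (- d - pi / 2))) /a.
    rewrite -itgZ; last exact: lw.
    rewrite -[in LHS]mulN1r -itgZ; last first.
      have := locintZ j%:R (lw (- d - pi / 2 + pi / 2)); congr locint; apply/funext => u; ring.
    by congr itg; apply/funext => u; rewrite subrK; ring.
  rewrite E//; split.
    by apply: trig_polyD; apply: trig_polyZ; exact: trig_poly_wave.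
  move=> sg x; have := E _ (cD sg) => /(congr1 (fun F => F x)) ->.
  have H := is_deriveD (is_deriveZ (a g) (is_derive_wave j 0 x)) (is_deriveZ (b g) (is_derive_wave j (- (pi / 2)) x)).
  apply: (@is_derive_eq _ _ _ _ _ _ _ _ H).
  rewrite /GRing.scale/= ab// ba// /wave add0r addNr !addr0.
  by rewrite cosDpihalf cosBpihalf; ring.
Qed.

Lemma trig_poly_jackson_mean n g : continuous g ->
  trig_poly (n + n + (n + n)) (jackson_mean n g).
Proof.
by move=> cg; apply: trig_polyZ; exact: (proj1 (reflect_derive (@trig_poly_jackson R n) cg)).
Qed.

Lemma smooth_op_sub_jackson_mean n : smooth_op (fun g => g \- jackson_mean n g).
Proof.
apply: smooth_op_sub; first exact: smooth_op_id.
split; first by move=> p g /smooth_continuous cg; exact: trig_poly_smooth (trig_poly_jackson_mean n cg).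
move=> g sg; apply: derive1_eq => x; apply: is_deriveZ.
exact: (proj2 (reflect_derive (@trig_poly_jackson R n) (smooth_continuous sg)) sg).
Qed.

Definition jackson_cst : R := 64 * fejer_cst ^+ 2 * pi ^+ 2 / kap ^+ 4 * C.

Lemma jackson_cst_ge0 : 0 <= jackson_cst.
Proof.
have C0 : 0 <= C by exact: le_trans ler01 C_ge1.
have fc := @fejer_cst_ge R; have k0 := @kap_gt0 R.
rewrite /jackson_cst; apply: mulr_ge0 => //; apply: divr_ge0; last by rewrite exprn_ge0// ltW.
by apply: mulr_ge0; [apply: mulr_ge0 => //; rewrite sqr_ge0|rewrite sqr_ge0].
Qed.

(** After normalization the kernel has mass 1, so the error at x is the
    integral of g u - g x against it. On the ball of radius 2^j del that
    difference is at most the integral of |D g|, which supplies one more factor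
    2^j del; the decay of order 4 leaves a convergent sum and a total factor
    1/n. *)
Lemma jackson_first n g : (0 < n)%N -> smooth 1 g ->
  N (g \- jackson_mean n g) <= (jackson_cst / n%:R) * N (derive1 g).
Proof.
move=> n0 sg; have pi2 := @pi_ge2 R; have pi0 := @pi_gt0 R.
have n0R : 0 < n%:R :> R by rewrite ltr0n.
have k0 := @kap_gt0 R.
have [J [del /andP[d0 dn] [Jd nd]]] := @dyadic_scale R n n0.
have cg := smooth_continuous sg.
have cj : continuous (jackson n : R -> R) by exact: continuous_jackson.
have pj : circle_fun (jackson n : R -> R) by exact: trig_poly_circle (@trig_poly_jackson R n).
have jN (t : R) : jackson n (- t) = jackson n t by rewrite /jackson/= fejerN.
have m0 := @jmass_gt0 R n n0.
have P0 k : 0 < 2 ^+ k :> R by rewrite exprn_gt0.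
pose M : R := fejer_cst ^+ 2 * n%:R ^+ 4.
have M0 : 0 <= M by rewrite mulr_ge0 ?sqr_ge0 ?exprn_ge0.
pose h j : R := 2 * (2 ^+ j * del).
have h0 j : 0 < h j by rewrite !mulr_gt0.
pose c j : R := (jmass n)^-1 * (2 ^+ 4 * M / (2 ^+ j) ^+ 4) * (h j * h j).
have c0 j : 0 <= c j.
  rewrite /c; apply: mulr_ge0; last by rewrite mulr_ge0 ?(ltW (h0 j)).
  apply: mulr_ge0; first by rewrite invr_ge0 ltW.
  by apply: divr_ge0; [apply: mulr_ge0 => //; exact: exprn_ge0|apply: exprn_ge0; exact: ltW].
have key x : `|(g \- jackson_mean n g) x| <= \sum_(0 <= j < J.+1) c j * steklov (h j) (fun t => `|derive1 g t|) x.
  rewrite /= distrC.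
  have c1 : continuous (fun u => g u * jackson n (x - u)) by exact: continuous_reflect.
  have p1 : circle_fun (fun u => g u * jackson n (x - u)).
    move=> u; rewrite (smooth_circle sg) opprD addrA; congr (_ * _).
    by rewrite -[LHS]pj subrK.
  have c2 : continuous (fun u => jackson n (u - x)).
    move=> u; have -> : (fun u => jackson n (u - x)) = jackson n \o (fun u => u - x) by [].
    apply: continuous_comp; last exact: cj.
    by apply: cvgB; [exact: cvg_id|exact: cvg_cst].
  have c3 : continuous (fun u => g u - g x) by move=> u; apply: cvgB; [exact: cg|exact: cvg_cst].
  have mx : jmass n = itg (fun u => jackson n (u - x)) (x - pi) (x + pi).
    have [G dG] := continuous_primitive cj.
    have dGx (u : R) : is_derive u 1 (fun u => G (u - x)) (jackson n (u - x)) by exact: is_derive_shift.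
    rewrite /jmass (itg_FTC2 _ cj dG); last by lra.
    rewrite (itg_FTC2 _ c2 dGx); last by lra.
    have -> : x + pi - x = pi by ring.
    by have -> : x - pi - x = - pi by ring.
  have -> : jackson_mean n g x - g x = (jmass n)^-1 *
      itg (fun u => (g u - g x) * jackson n (u - x)) (x - pi) (x + pi).
    rewrite /jackson_mean (itg_pi x p1 c1).
    have -> : g x = (jmass n)^-1 * itg (fun u => g x * jackson n (u - x)) (x - pi) (x + pi).
      rewrite itgZ; last exact: continuous_locint.
      by rewrite -mx mulrCA mulVf ?mulr1// gt_eqF.
    rewrite -mulrBr -itgB; [|exact: continuous_locint|apply: locintZ; exact: continuous_locint].
    congr (_ * _); congr itg; apply/funext => u /=; rewrite -[x - u]opprB jN mulrBl.
    by congr (_ - _); congr (_ * _); rewrite itgZ; [rewrite -mx mulrCA mulVf ?mulr1// gt_eqF|exact: continuous_locint].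
  rewrite normrM gtr0_norm ?invr_gt0//.
  have iv0 : 0 <= (jmass n)^-1 :> R by rewrite invr_ge0 ltW.
  have := kernel_bound (p := 4) x c3 cj n0 d0 Jd nd (fun t => @jackson_bound R n t n0).
  move=> /(ler_wpM2l iv0)/le_trans; apply.
  rewrite mulr_sumr; apply: ler_sum => j _; rewrite -/M.
  have K0 : 0 <= 2 ^+ 4 * M / (2 ^+ j) ^+ 4.
    by apply: divr_ge0; [apply: mulr_ge0 => //; exact: exprn_ge0|apply: exprn_ge0; exact: ltW].
  set S := steklov (h j) _ x.
  have -> : c j * S = (jmass n)^-1 * ((2 ^+ 4 * M / (2 ^+ j) ^+ 4) * (h j * (h j * S))).
    by rewrite /c !mulrA.
  apply: (ler_wpM2l iv0); apply: (ler_wpM2l K0).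
  have hh : x + 2 ^+ j * del - (x - 2 ^+ j * del) = h j by rewrite /h; ring.
  have xle : x - 2 ^+ j * del <= x + 2 ^+ j * del.
    by have := h0 j; rewrite /h; lra.
  have := itg_bound (locint_abs (continuous_locint c3)) xle (M := h j * S).
  rewrite hh => H; apply: le_trans (ler_norm _) _; apply: le_trans (H _) _.
    move=> t /andP[t1 t2]; rewrite normr_id; apply: smooth_var => //.
      by have := h0 j; rewrite /h; lra.
    by rewrite /h; apply/andP; split; lra.
  by rewrite mulrC.
have sV := so_smooth (smooth_op_sub_jackson_mean n) sg.
apply: le_trans (norm_sum_steklov (smooth_lat hX sV) (smooth_lat hX (smooth_derive1 sg)) c0 h0 key) _.
apply: ler_wpM2r; first exact: (norm_ge0 hX (smooth_lat hX (smooth_derive1 sg))).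
rewrite /jackson_cst mulrAC; apply: ler_wpM2r; first exact: le_trans ler01 C_ge1.
have -> : \sum_(0 <= j < J.+1) c j = (jmass n)^-1 * (64 * fejer_cst ^+ 2 * n%:R ^+ 4 * del ^+ 2) * \sum_(0 <= j < J.+1) ((2 ^+ j) ^- 2).
  rewrite mulr_sumr; apply: eq_bigr => j _; rewrite /c /M /h; field.
  by rewrite !gt_eqF.
have gs : \sum_(0 <= j < J.+1) ((2 ^+ j) ^- 2) <= 2 :> R.
  apply: le_trans (geometric_le2 J.+1); apply: ler_sum => j _.
  rewrite lef_pV2 ?posrE ?exprn_gt0//; rewrite expr2 ler_peMl ?(ltW (P0 j))//.
  by rewrite exprn_ege1// ler1n.
have B0 : 0 <= (jmass n)^-1 * (64 * fejer_cst ^+ 2 * n%:R ^+ 4 * del ^+ 2).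
  apply: mulr_ge0; first by rewrite invr_ge0 ltW.
  have -> : 64 * fejer_cst ^+ 2 * n%:R ^+ 4 * del ^+ 2 = 64 * (fejer_cst * n%:R ^+ 2 * del) ^+ 2 by ring.
  by rewrite mulr_ge0// sqr_ge0.
apply: le_trans (ler_wpM2l B0 gs) _.
have jm := @jmass_ge R n n0.
have d2 : n%:R ^+ 2 * del ^+ 2 <= pi ^+ 2.
  rewrite -exprMn; apply: lerXn2r; rewrite ?nnegrE ?mulr_ge0 ?pi_ge0 ?(ltW d0)//.
  by rewrite mulrC -ler_pdivlMr.
rewrite [X in X <= _]mulrC mulrCA mulrC ler_pdivrMr//.
apply: (@le_trans _ _ (64 * fejer_cst ^+ 2 * pi ^+ 2 / kap ^+ 4 / n%:R * (2 * kap ^+ 4 * n%:R ^+ 3))); last first.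
  rewrite ler_wpM2l// divr_ge0// divr_ge0 ?exprn_ge0 ?(ltW k0)//.
  by rewrite mulr_ge0 ?sqr_ge0// mulr_ge0// sqr_ge0.
have -> : 64 * fejer_cst ^+ 2 * pi ^+ 2 / kap ^+ 4 / n%:R * (2 * kap ^+ 4 * n%:R ^+ 3) =
   (2 * 64 * (fejer_cst * n%:R) ^+ 2) * pi ^+ 2 :> R.
  by field; rewrite !gt_eqF.
have -> : 2 * (64 * fejer_cst ^+ 2 * n%:R ^+ 4 * del ^+ 2) = (2 * 64 * (fejer_cst * n%:R) ^+ 2) * (n%:R ^+ 2 * del ^+ 2) by ring.
by rewrite ler_wpM2l// mulr_ge0 ?sqr_ge0// mulr_ge0.
Qed.

End BernsteinJackson.

(** * Power rates and a lacunary recursion *)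

Section Rates.
Context {R : realType}.
Implicit Types (a : nat -> R) (alpha beta A K L M : R) (n m b : nat).

Lemma rate_gt0 n alpha : (0 < n)%N -> 0 < (n%:R : R) `^ alpha.
Proof. by move=> n0; rewrite powR_gt0// ltr0n. Qed.

(** n is at most 2 b times the integer quotient of n by b, so passing from n to
    n/b costs a constant in any power rate. *)
Lemma le_rate_div n b alpha : 0 <= alpha -> (0 < b)%N -> (b <= n)%N ->
  (n %/ b)%:R `^ (- alpha) <= (2 * b)%:R `^ alpha * (n%:R : R) `^ (- alpha).
Proof.
move=> a0 b0 bn; have q0 : (0 < n %/ b)%N by rewrite divn_gt0.
have n0 : (0 < n)%N by exact: leq_trans bn.
have nq : (n <= 2 * b * (n %/ b))%N.
  apply: leq_trans (ltnW (ltn_ceil n b0)) _.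
  rewrite mulSn -mulnA mul2n -addnn [(b * _)%N]mulnC leq_add2r.
  by rewrite leq_pmull.
rewrite !powRN ler_pdivlMr ?rate_gt0//.
rewrite mulrC ler_pdivrMr ?rate_gt0// -powRM// -natrM.
by apply: ge0_ler_powR; rewrite ?nnegrE// ler_nat.
Qed.

Lemma exp_rate n s alpha : (0 < n)%N ->
  n%:R ^+ s * n%:R `^ (- alpha) = (n%:R : R) `^ (s%:R - alpha).
Proof.
move=> n0; rewrite -powR_mulrn// -powRD//.
by apply/implyP => _; rewrite pnatr_eq0 -lt0n.
Qed.

Lemma exp_rateV n s alpha : (0 < n)%N ->
  n%:R ^- s * n%:R `^ (s%:R - alpha) = (n%:R : R) `^ (- alpha).
Proof.
move=> n0; rewrite -exp_rate// mulrA mulVf ?mul1r//.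
by rewrite expf_neq0// pnatr_eq0 -lt0n.
Qed.

(** If b^beta >= 2 L, the inductive bound K (n/b)^beta contributes at most half
    of K n^beta, which leaves room for A n^beta when K >= 2 A. The finitely
    many small n are absorbed into K. *)
Lemma lacunary beta L : 0 < beta -> 0 <= L -> exists2 b, (2 <= b)%N &
  forall a A n1, 0 <= A ->
    (forall n, (n1 <= n)%N -> (b <= n)%N -> a n <= A * n%:R `^ beta + L * a (n %/ b)%N) ->
    exists2 K, 0 <= K & forall n, (0 < n)%N -> a n <= K * n%:R `^ beta.
Proof.
move=> b0 L0.
pose b := maxn 2 (Num.truncn ((2 * L) `^ beta^-1)).+1.
have b2 : (2 <= b)%N by rewrite leq_max.
have bgt : (0 < b)%N by exact: leq_trans b2.
have bL : 2 * L <= b%:R `^ beta.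
  have -> : 2 * L = ((2 * L) `^ beta^-1) `^ beta.
    by rewrite -powRrM mulVf ?gt_eqF// powRr1// mulr_ge0.
  apply: ge0_ler_powR; rewrite ?nnegrE ?powR_ge0 ?(ltW b0)//.
  apply: ltW; apply: lt_le_trans (truncnS_gt _) _.
  by rewrite ler_nat leq_max leqnn orbT.
exists b => // a A n1 A0 rec.
pose n2 := maxn n1 b.
pose S := \sum_(0 <= i < n2) `|a i|.
have S0 : 0 <= S by apply: sumr_ge0.
exists (2 * A + S); first by rewrite addr_ge0// mulr_ge0.
elim/ltn_ind => n IH n0.
have nb0 : 0 <= (n%:R : R) `^ beta by exact: powR_ge0.
have [nn2|n2n] := ltnP n n2.
  apply: le_trans (ler_norm _) _; apply: (@le_trans _ _ (S * 1)).
    rewrite mulr1 /S (bigD1_seq n); [|by rewrite mem_index_iota|exact: iota_uniq].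
    by rewrite /= lerDl sumr_ge0.
  apply: ler_pM => //; first by rewrite lerDr mulr_ge0.
  have : 1 `^ beta <= (n%:R : R) `^ beta.
    by apply: ge0_ler_powR; rewrite ?nnegrE ?(ltW b0)// ler1n.
  by rewrite powR1.
have bn : (b <= n)%N by apply: leq_trans n2n; rewrite leq_maxr.
have q0 : (0 < n %/ b)%N by rewrite divn_gt0.
apply: le_trans (rec n (leq_trans (leq_maxl _ _) n2n) bn) _.
have IHq := IH _ (ltn_Pdiv b2 n0) q0.
have qb : L * (n %/ b)%:R `^ beta <= 2^-1 * n%:R `^ beta.
  apply: (@le_trans _ _ (2^-1 * (b%:R `^ beta * (n %/ b)%:R `^ beta))).
    rewrite mulrA ler_wpM2r ?powR_ge0//; lra.
  rewrite ler_wpM2l// -powRM// -natrM.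
  by apply: ge0_ler_powR; rewrite ?nnegrE ?(ltW b0)// ler_nat mulnC leq_divM.
have K0 : 0 <= 2 * A + S by lra.
have : L * a (n %/ b)%N <= (2 * A + S) * (2^-1 * n%:R `^ beta).
  apply: le_trans (ler_wpM2l L0 IHq) _.
  by rewrite mulrCA ler_wpM2l.
have : 0 <= S * (n%:R : R) `^ beta by rewrite mulr_ge0.
rewrite mulrDl => SS.
lra.
Qed.

(** Nonnegativity is asked only for n > 0: at n = 0 there is no information on
    the nodes or on the operator. *)
Lemma bigO_rateP (F : nat -> R) alpha : (forall n, (0 < n)%N -> 0 <= F n) ->
  ((fun n => F n : R^o) =O_\oo (fun n => n%:R `^ (- alpha) : R^o)) <->
  exists2 M, 0 <= M & exists n0, forall n, (n0 <= n)%N -> F n <= M * n%:R `^ (- alpha).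
Proof.
move=> F0; split.
  move=> /eqO_exP [M [M0 H]].
  have [n0 _ Hn] := H.
  exists M; first exact: ltW.
  exists n0 => n nn0; apply: le_trans (ler_norm _) _; have := Hn n nn0.
  by rewrite /= [`|_ `^ _|]ger0_norm// powR_ge0.
move=> [M M0 [n0 H]]; apply/eqO_exP; exists (M + 1); first exact: ltr_wpDl M0 ltr01.
exists n0.+1 => // n /= nn0; rewrite !ger0_norm ?powR_ge0//; last first.
  by apply: F0; exact: leq_trans nn0.
apply: le_trans (H n (ltnW nn0)) _; by rewrite ler_wpM2r ?powR_ge0// lerDl ler01.
Qed.

End Rates.

(** * A smoothing operator built from differences of averages *)

Section Smoothing.
Context {R : realType} (X : set (R -> R)) (N : (R -> R) -> R).
Context (hX : banach_lattice X N) (hA : assumptionA X N).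
Context (C : R) (C_ge1 : 1 <= C).
Context (steklov_le : forall h f, 0 < h -> X f -> N (steklov h f) <= C * N f).
Implicit Types (f g : R -> R) (x y h : R) (n m p k s : nat).

Local Notation lop := (lattice_op X N).

Lemma lattice_op0 : lop (fun=> fun=> 0) 0.
Proof.
split=> //.
- split.
    move=> p g _; have := trig_poly_smooth p (trig_polyZ 0 (trig_poly_wave (n := 0) (j := 0) (0 : R) isT)).
    by congr smooth; apply/funext => x; rewrite mul0r.
  by move=> g _; apply: derive1_eq.
- by move=> f _; exact: (lat_cst hX).
- by move=> f _; rewrite (norm0 hX) mul0r.
- by move=> f g _ _; apply/funext => x /=; rewrite subr0.
Qed.

Lemma lattice_opD S T c d : lop S c -> lop T d -> lop (fun g => S g \+ T g) (c + d).
Proof.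
move=> hS hT.
have H := lattice_op_sub hX hS (lattice_op_sub hX lattice_op0 hT).
rewrite add0r in H; move: H; congr (lattice_op _ _ _).
by apply/funext => g; apply/funext => x /=; rewrite sub0r opprK.
Qed.

Lemma lo_add T c f g : lop T c -> X f -> X g -> T (f \+ g) = T f \+ T g.
Proof.
move=> hT Xf Xg.
have X0 : X (fun=> 0) by exact: (lat_cst hX).
have T0 : T (fun=> 0) = fun=> 0.
  have E : (fun=> 0) \- (fun=> 0) = (fun=> 0) :> (R -> R) by apply/funext => x /=; rewrite subrr.
  by have := lo_sub hT X0 X0; rewrite E => ->; apply/funext => x /=; rewrite subrr.
have E : f \+ g = f \- ((fun=> 0) \- g) by apply/funext => x /=; rewrite sub0r opprK.
rewrite E (lo_sub hT Xf (lat_sub hX X0 Xg)) (lo_sub hT X0 Xg) T0.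
by apply/funext => x /=; rewrite sub0r opprK.
Qed.

Lemma diff_iterS A k g : diff_iter A k.+1 g = diff_iter A k g \- A (diff_iter A k g).
Proof. by []. Qed.

Lemma diff_iter_comm A c k g : lop A c -> X g ->
  A (diff_iter A k g) = diff_iter A k (A g).
Proof.
move=> hA'; elim: k g => [|k IH] g Xg //.
have XD := lo_lat (lattice_op_diff_iter hX k hA') Xg.
by rewrite !diff_iterS (lo_sub hA' XD (lo_lat hA' XD)) IH.
Qed.

(** The sum of (I - A)^i over i < k, the operator P for which I - (I - A)^k = A
    P. *)
Fixpoint geom_op A k : (R -> R) -> R -> R :=
  if k is k'.+1 then fun g => geom_op A k' g \+ diff_iter A k' g else fun _ _ => 0.

Definition geom_cst c k : R := \sum_(0 <= i < k) (1 + c) ^+ i.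

Lemma lattice_op_geom_op A c k : lop A c -> lop (geom_op A k) (geom_cst c k).
Proof.
move=> hA'; elim: k => [|k IH]; first by rewrite /geom_cst big_geq//; exact: lattice_op0.
by rewrite /geom_cst big_nat_recr//=; apply: lattice_opD => //; exact: lattice_op_diff_iter.
Qed.

(** The telescoping identity for a geometric sum of powers of I - A. *)
Lemma sub_diff_iter A c k g : lop A c -> X g ->
  g \- diff_iter A k g = A (geom_op A k g).
Proof.
move=> hA' Xg; elim: k => [|k IH].
  have X0 : X (fun=> 0) by exact: (lat_cst hX).
  have := lo_sub hA' X0 X0.
  have -> : (fun=> 0) \- (fun=> 0) = (fun=> 0) :> (R -> R) by apply/funext => x /=; rewrite subrr.
  by rewrite /= => ->; apply/funext => x /=; rewrite !subrr.
have XD := lo_lat (lattice_op_diff_iter hX k hA') Xg.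
have XG := lo_lat (lattice_op_geom_op k hA') Xg.
rewrite diff_iterS /= (lo_add hA' XG XD) -IH.
by apply/funext => x /=; ring.
Qed.

Lemma geom_op_comm A c k g : lop A c -> X g ->
  A (geom_op A k g) = geom_op A k (A g).
Proof.
move=> hA' Xg; have XAg := lo_lat hA' Xg.
rewrite -(sub_diff_iter k hA' Xg); elim: k => [|k IH].
  by apply/funext => x /=; rewrite subrr.
rewrite diff_iterS /= -IH -(diff_iter_comm k hA' Xg).
by apply/funext => x /=; ring.
Qed.

Section Scale.
Context (h : R) (h_gt0 : 0 < h) (s : nat).

Local Notation A := (steklov_dot h).
Let lopA : lop A (2 * C) := lattice_op_steklov_dot hX hA C_ge1 steklov_le h_gt0.

(** The derivative of A' g is a difference quotient of g. Translations need not
    be bounded on X, but after a second averaging the quotient is a difference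
    of the averages over [h, 2h] and [0, h], which are bounded operators. *)
Lemma smooth_steklov_dot2 p g : smooth p g -> smooth p.+1 (A (A g)) /\
  N (derive1n p.+1 (A (A g))) <= 6 * C / h * N (derive1n p g).
Proof.
have h0 : 0 < h by exact: h_gt0.
have base (k : R -> R) : smooth 0 k ->
    (forall x, is_derive x 1 (A (A k)) (h^-1 * (avg h (2 * h) k \- avg 0 h k) x)).
  move=> sk x; have sAk := so_smooth (lo_smooth_op lopA) sk.
  have EA u : A u = avg 0 h u by rewrite steklov_dot_avg.
  rewrite (EA (A k)).
  have H := is_derive_avg x (ltW h_gt0) (smooth_continuous sAk).
  apply: (@is_derive_eq _ _ _ _ _ _ _ _ H).
  rewrite subr0 addr0 (EA k) /=; congr (_ * (_ - _)).
  rewrite /avg addr0 subr0.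
  have -> : 2 * h - h = h by ring.
  by have -> : x + h + h = x + 2 * h by ring.
have h2 : h < 2 * h by lra.
have sm (k : R -> R) p' : smooth p' k -> smooth p' (fun x => h^-1 * (avg h (2 * h) k \- avg 0 h k) x).
  by move=> sk; apply: smoothZ; apply: smoothB; apply: (smooth_avg hX hA) => //.
move=> sg; have soA := lo_smooth_op lopA.
have soAA := smooth_op_comp soA soA.
split.
  elim: p g sg => [|p IH] g sg.
    apply: smooth_intro (base _ sg) (sm _ _ sg).
    exact: smooth_circle (so_smooth soAA sg).
  have sAAg := so_smooth soAA sg.
  apply: (smooth_intro (smooth_circle sAAg) (fun x => smooth_is_derive x sAAg)).
  have s1 : smooth 1 g by apply: smooth_leq sg.
  have D1 : derive1 (A (A g)) = A (A (derive1 g)) by exact: (so_derive1 soAA s1).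
  by rewrite D1; apply: IH; exact: smooth_derive1.
have sk : smooth 0 (derive1n p g) by apply: smooth_derive1n; rewrite addn0.
have Dp : derive1n p (A (A g)) = A (A (derive1n p g)) by exact: (so_derive1n soAA sg).
rewrite derive1nS Dp (derive1_eq (base _ sk)).
set k := derive1n p g in sk *.
have Xk := smooth_lat hX sk.
have Xa1 : X (avg h (2 * h) k) by apply: (lat_avg hX hA).
have Xa2 : X (avg 0 h k) by apply: (lat_avg hX hA).
rewrite (norm_scale hX); last exact: (lat_sub hX).
rewrite gtr0_norm ?invr_gt0//.
have -> : 6 * C / h * N k = h^-1 * (4 * C * N k + 2 * C * N k) by field; rewrite gt_eqF.
rewrite ler_wpM2l ?invr_ge0 ?(ltW h_gt0)//.
apply: le_trans (norm_sub hX Xa1 Xa2) _; apply: lerD.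
  have -> : 4 * C = (4 * h) / (2 * h - h) * C by field; lra.
  by apply: (norm_avg_le hX hA steklov_le) => //; lra.
have -> : 2 * C = (2 * h) / (h - 0) * C by field; lra.
by apply: (norm_avg_le hX hA steklov_le) => //; lra.
Qed.

(** I - (I - A')^s: it smooths because it contains a factor A', and it changes
    f only by the difference (I - A')^s f. *)
Definition smoother : (R -> R) -> R -> R := fun g => g \- diff_iter A s g.

Lemma lattice_op_smoother : lop smoother (1 + (1 + 2 * C) ^+ s).
Proof.
apply: (lattice_op_sub hX); first exact: lattice_op_id.
exact: (lattice_op_diff_iter hX s lopA).
Qed.

Lemma smoother_smooth0 f : X f -> smooth 0 (smoother f).
Proof.
move=> Xf; have XU := lo_lat lattice_op_smoother Xf.
split=> //; first exact: (proj1 (bl_measurable hX XU)).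
rewrite /smoother (sub_diff_iter s lopA Xf).
have -> : A (geom_op A s f) = avg 0 h (geom_op A s f) by rewrite steklov_dot_avg.
apply: continuous_avg; last exact: ltW.
exact: (lat_locint hX (lo_lat (lattice_op_geom_op s lopA) Xf)).
Qed.

(** U^2 = A'^2 P^2, since P commutes with A'. *)
Lemma smoother2 p g : smooth p g -> smooth p.+1 (smoother (smoother g)) /\
  N (derive1n p.+1 (smoother (smoother g))) <=
    6 * C * geom_cst (2 * C) s ^+ 2 / h * N (derive1n p g).
Proof.
move=> sg; have Xg := smooth_lat hX sg.
have lopP := lattice_op_geom_op s lopA.
pose P := geom_op A s.
have E : smoother (smoother g) = A (A (P (P g))).
  have XPg := lo_lat lopP Xg; have XAPg := lo_lat lopA XPg.
  rewrite /smoother (sub_diff_iter s lopA Xg) (sub_diff_iter s lopA XAPg).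
  by rewrite -(geom_op_comm s lopA XPg).
have soP := smooth_op_comp (lo_smooth_op lopP) (lo_smooth_op lopP).
have sPP : smooth p (P (P g)) by exact: (so_smooth soP sg).
have [s1 n1] := smooth_steklov_dot2 sPP.
rewrite E; split=> //; apply: le_trans n1 _.
have C0 : 0 <= C by exact: le_trans ler01 C_ge1.
have -> : 6 * C * geom_cst (2 * C) s ^+ 2 / h * N (derive1n p g) =
   6 * C / h * (geom_cst (2 * C) s * (geom_cst (2 * C) s * N (derive1n p g))).
  by field; rewrite gt_eqF.
rewrite ler_wpM2l ?divr_ge0 ?mulr_ge0 ?(ltW h_gt0)//.
have Xd : X (derive1n p g).
  by apply: (smooth_lat hX (p := 0)); apply: smooth_derive1n; rewrite addn0.
have Dp : derive1n p (P (P g)) = P (P (derive1n p g)) by exact: (so_derive1n soP sg).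
rewrite Dp.
apply: le_trans (lo_norm lopP (lo_lat lopP Xd)) _.
by rewrite ler_wpM2l ?(lo_ge0 lopP)// (lo_norm lopP).
Qed.

(** One application of U makes f continuous, and every further pair of
    applications gains a derivative; hence the exponent 2p + 1. *)
Lemma iter_smoother p f : X f -> smooth p (iter (p * 2).+1 smoother f) /\
  N (derive1n p (iter (p * 2).+1 smoother f)) <=
    (6 * C * geom_cst (2 * C) s ^+ 2 / h) ^+ p * ((1 + (1 + 2 * C) ^+ s) * N f).
Proof.
move=> Xf; have lopP := lattice_op_geom_op s lopA.
have C0 : 0 <= C by exact: le_trans ler01 C_ge1.
elim: p => [|p [IHs IHn]].
  rewrite mul0n expr0 mul1r /=; split; first exact: smoother_smooth0.
  exact: (lo_norm lattice_op_smoother).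
have [s2 n2] := smoother2 IHs.
have E : iter (p.+1 * 2).+1 smoother f = smoother (smoother (iter (p * 2).+1 smoother f)) by [].
rewrite E; split=> //; apply: le_trans n2 _.
rewrite (exprS _ p) -[X in _ <= X]mulrA; apply: ler_wpM2l => //.
by rewrite divr_ge0 ?(ltW h_gt0)// mulr_ge0 ?sqr_ge0// mulr_ge0.
Qed.

(** f - U^(k+1) f = (f - U f) + U (f - U^k f), and f - U f is the difference
    that appears on the right. *)
Lemma norm_sub_iter_smoother k f : X f ->
  N (f \- iter k smoother f) <=
  (\sum_(0 <= i < k) (1 + (1 + 2 * C) ^+ s) ^+ i) * N (diff_iter A s f).
Proof.
move=> Xf; have lU := lattice_op_smoother.
have XD := lo_lat (lattice_op_diff_iter hX s lopA) Xf.
elim: k => [|k IH].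
  rewrite big_geq// mul0r /=.
  have -> : f \- f = (fun=> 0) by apply/funext => x /=; rewrite subrr.
  by rewrite (norm0 hX).
have Xk := lo_lat (lattice_op_iter k lU) Xf.
have Xs := lat_sub hX Xf Xk.
have -> : f \- iter k.+1 smoother f = diff_iter A s f \+ smoother (f \- iter k smoother f).
  rewrite (lo_sub lU Xf Xk) iterS; apply/funext => x /=.
  by rewrite /smoother /=; ring.
apply: le_trans (norm_add hX XD (lo_lat lU Xs)) _.
rewrite big_nat_recl//= mulrDl expr0 mul1r lerD2l.
apply: le_trans (lo_norm lU Xs) _.
apply: le_trans (ler_wpM2l (lo_ge0 lU) IH) _.
rewrite mulrA ler_wpM2r ?(norm_ge0 hX)//.
by rewrite mulr_sumr; apply: ler_sum => i _; rewrite exprS.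
Qed.

End Scale.
End Smoothing.

(** * Inverse and direct estimates for polynomial approximation *)

Section ApproximationRates.
Context {R : realType} (X : set (R -> R)) (N : (R -> R) -> R).
Context (hX : banach_lattice X N) (hA : assumptionA X N).
Context (C : R) (C_ge1 : 1 <= C).
Context (steklov_le : forall h f, 0 < h -> X f -> N (steklov h f) <= C * N f).
Implicit Types (f g : R -> R) (x y h : R) (n m p k s : nat).

Lemma smooth_lat_derive1n p g : smooth p g -> X (derive1n p g).
Proof.
by move=> sg; apply: (smooth_lat hX (p := 0)); apply: smooth_derive1n; rewrite addn0.
Qed.

(** T_n - T_(n/b) is a polynomial of degree n and norm O(n^-alpha), so
    Bernstein bounds its s-th derivative by O(n^(s-alpha)). This gives a
    recursion for N (D^s T_n) with coefficient 1. *)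
Lemma inverse_rate f (T : nat -> R -> R) s (alpha M : R) n1 : X f ->
  0 < alpha -> alpha < s%:R -> 0 <= M ->
  (forall n, (0 < n)%N -> trig_poly n (T n)) ->
  (forall n, (n1 <= n)%N -> (0 < n)%N -> N (f \- T n) <= M * n%:R `^ (- alpha)) ->
  exists2 K, 0 <= K &
    forall n, (0 < n)%N -> N (derive1n s (T n)) <= K * n%:R `^ (s%:R - alpha).
Proof.
move=> Xf a0 as' M0 tT fT.
have b0 : 0 < s%:R - alpha by rewrite subr_gt0.
have [b b2 H] := lacunary b0 (ler01 : 0 <= 1 :> R).
have bgt : (0 < b)%N by exact: leq_trans b2.
pose B := bernstein_cst C; have B0 : 0 <= B by exact: (bernstein_cst_ge0 C_ge1).
pose q : R := (2 * b)%:R `^ alpha.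
have q0 : 0 <= q by exact: powR_ge0.
apply: (H (fun n => N (derive1n s (T n))) (B ^+ s * (M + M * q)) (b * n1.+1)%N).
  by apply: mulr_ge0; [exact: exprn_ge0|apply: addr_ge0 => //; exact: mulr_ge0].
move=> n nn bn; set m := (n %/ b)%N.
have n0 : (0 < n)%N by exact: leq_trans bn.
have mn1 : (n1.+1 <= m)%N by rewrite leq_divRL// mulnC.
have m0 : (0 < m)%N by exact: leq_trans mn1.
have mn : (m <= n)%N by exact: leq_div.
have tn := tT n n0; have tm := tT m m0.
have tm' := trig_poly_leq mn tm.
have Xn := trig_poly_lat hX tn; have Xm := trig_poly_lat hX tm.
have sn := trig_poly_smooth s tn; have sm := trig_poly_smooth s tm.
have n1n : (n1 <= n)%N by exact: leq_trans (ltnW mn1) mn.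
have D : N (T n \- T m) <= (M + M * q) * n%:R `^ (- alpha).
  have -> : T n \- T m = (f \- T m) \- (f \- T n) by apply/funext => x /=; ring.
  apply: le_trans (norm_sub hX (lat_sub hX Xf Xm) (lat_sub hX Xf Xn)) _.
  rewrite addrC mulrDl lerD ?fT//.
  apply: le_trans (fT m (ltnW mn1) m0) _; rewrite -mulrA ler_wpM2l//.
  exact: le_rate_div (ltW a0) bgt bn.
rewrite mul1r.
apply: le_trans (norm_triangle hX (smooth_lat_derive1n sn) (smooth_lat_derive1n sm)) _.
rewrite addrC lerD2r -(derive1nB sn sm).
apply: le_trans (bernstein_iter hX hA C_ge1 steklov_le s n0 (trig_polyB tn tm')) _.
rewrite -exp_rate// exprMn.
have -> : B ^+ s * (M + M * q) * (n%:R ^+ s * n%:R `^ (- alpha)) =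
   B ^+ s * n%:R ^+ s * ((M + M * q) * n%:R `^ (- alpha)) by ring.
by rewrite ler_wpM2l// mulr_ge0 ?exprn_ge0.
Qed.

(** The polynomial is g - (I - V)^s g, where V is the Jackson mean. It is a
    polynomial because each factor I - V changes its argument by a polynomial,
    and the error (I - V)^s g gains a factor O(1/n) per derivative. *)
Lemma jackson_smooth s n g : (0 < n)%N -> smooth s g ->
  exists2 T, trig_poly (n + n + (n + n)) T &
    X T /\ N (g \- T) <= (jackson_cst C / n%:R) ^+ s * N (derive1n s g).
Proof.
move=> n0 sg; pose E g := g \- jackson_mean n g.
have soE : smooth_op E by exact: smooth_op_sub_jackson_mean.
have n0R : 0 < n%:R :> R by rewrite ltr0n.
exists (g \- iter s E g).
  elim: s sg => [|s IH] sg.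
    have := trig_polyZ 0 (trig_poly_wave (0 : R) (leq0n (n + n + (n + n)))).
    by congr trig_poly; apply/funext => x; rewrite mul0r /= subrr.
  have sE := so_smooth (smooth_op_iter s soE) sg.
  have := trig_polyD (IH (smoothS sg)) (trig_poly_jackson_mean n (smooth_continuous sE)).
  by congr trig_poly; apply/funext => x /=; rewrite /E /=; ring.
have sEs := so_smooth (smooth_op_iter s soE) sg.
split; first exact: (lat_sub hX (smooth_lat hX sg) (smooth_lat hX sEs)).
have -> : g \- (g \- iter s E g) = iter s E g by apply/funext => x /=; ring.
have H := @norm_iter_smooth R N E 1 s (jackson_cst C / n%:R) g soE.
rewrite muln1 in H; apply: H => //.
  by rewrite divr_ge0 ?(jackson_cst_ge0 C_ge1)// ltW.
move=> k sk; rewrite derive1n1.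
exact: (jackson_first hX hA C_ge1 steklov_le n0 sk).
Qed.

(** F_n = W_n f, with W_n a power of the smoother at scale gamma/n, is close to
    f. Its s-th derivative is split along F_n = W_n (f - F_m) + W_n F_m with
    m = n/b: the first part is rough but small, and W_n turns it into O(n^s)
    O(n^-alpha); on the second, D^s commutes with W_n, which leaves a constant
    times N (D^s F_m). The lacunary recursion, now with a coefficient larger
    than 1, then applies. Finally F_j with j = n/4 is approximated by
    polynomials of degree 4 j <= n. *)
Lemma direct_rate f (gamma alpha M : R) s n0 : X f -> 0 < gamma ->
  0 < alpha -> alpha < s%:R -> 0 <= M ->
  (forall n, (n0 <= n)%N -> (0 < n)%N ->
     N (diff_iter (steklov_dot (gamma / n%:R)) s f) <= M * n%:R `^ (- alpha)) ->
  exists n1, exists2 M', 0 <= M' & forall n, (n1 <= n)%N ->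
    exists2 T, trig_poly n T & X T /\ N (f \- T) <= M' * n%:R `^ (- alpha).
Proof.
move=> Xf g0 a0 as' M0 fM.
have C0 : 0 <= C by exact: le_trans ler01 C_ge1.
pose cU : R := 1 + (1 + 2 * C) ^+ s.
have cU0 : 0 <= cU by rewrite addr_ge0// exprn_ge0// addr_ge0// mulr_ge0.
pose K1 : R := \sum_(0 <= i < (s * 2).+1) cU ^+ i.
have K10 : 0 <= K1 by apply: sumr_ge0 => i _; exact: exprn_ge0.
pose cP : R := 6 * C * geom_cst (2 * C) s ^+ 2.
have cP0 : 0 <= cP by rewrite mulr_ge0 ?sqr_ge0// mulr_ge0.
pose W n : (R -> R) -> R -> R := iter (s * 2).+1 (smoother (gamma / n%:R) s).
pose F n := W n f.
have h0 n : (0 < n)%N -> 0 < gamma / n%:R by move=> n0'; rewrite divr_gt0// ltr0n.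
have lW n : (0 < n)%N -> lattice_op X N (W n) (cU ^+ (s * 2).+1).
  move=> n0'; apply: (lattice_op_iter _ _).
  exact: (lattice_op_smoother hX hA C_ge1 steklov_le (h0 n n0') s).
have fF n : (n0 <= n)%N -> (0 < n)%N -> N (f \- F n) <= K1 * M * n%:R `^ (- alpha).
  move=> nn n0'; apply: le_trans (norm_sub_iter_smoother hX hA C_ge1 steklov_le (h0 n n0') s _ Xf) _.
  by rewrite -[X in _ <= X]mulrA; apply: ler_wpM2l => //; exact: fM.
have b0 : 0 < s%:R - alpha by rewrite subr_gt0.
have L0 : 0 <= cU ^+ (s * 2).+1 by exact: exprn_ge0.
have [b b2 H] := lacunary b0 L0.
have bgt : (0 < b)%N by exact: leq_trans b2.
pose q : R := (2 * b)%:R `^ alpha.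
have q0 : 0 <= q by exact: powR_ge0.
have smW n g : (0 < n)%N -> X g -> smooth s (W n g) /\
    N (derive1n s (W n g)) <= (cP / gamma) ^+ s * cU * n%:R ^+ s * N g.
  move=> n0' Xg; have [s1 n1] := iter_smoother hX hA C_ge1 steklov_le (h0 n n0') s s Xg.
  split=> //; apply: le_trans n1 _.
  rewrite le_eqVlt; apply/orP; left; apply/eqP; rewrite -/cU.
  have -> : 6 * C * geom_cst (2 * C) s ^+ 2 / (gamma / n%:R) = cP / gamma * n%:R.
    by rewrite /cP; field; rewrite !gt_eqF// ltr0n.
  by rewrite exprMn; ring.
have XF n : (0 < n)%N -> X (F n) by move=> n0'; exact: (lo_lat (lW n n0') Xf).
have [K K0 HK] : exists2 K, 0 <= K & forall n, (0 < n)%N ->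
    N (derive1n s (F n)) <= K * n%:R `^ (s%:R - alpha).
  apply: (H (fun n => N (derive1n s (F n))) ((cP / gamma) ^+ s * cU * (K1 * M * q)) (b * n0.+1)%N).
    apply: mulr_ge0; last by rewrite !mulr_ge0.
    by rewrite mulr_ge0// exprn_ge0// divr_ge0// ltW.
  move=> n nn bn; set m := (n %/ b)%N.
  have n0' : (0 < n)%N by exact: leq_trans bn.
  have mn0 : (n0.+1 <= m)%N by rewrite leq_divRL// mulnC.
  have m0 : (0 < m)%N by exact: leq_trans mn0.
  have Xd := lat_sub hX Xf (XF m m0).
  have [sFm _] := smW m f m0 Xf.
  have [sd nd] := smW n _ n0' Xd.
  have [sWF _] := smW n _ n0' (XF m m0).
  have [sFn _] := smW n f n0' Xf.
  apply: le_trans (norm_triangle hX (smooth_lat_derive1n sFn) (smooth_lat_derive1n sWF)) _.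
  rewrite addrC -(derive1nB sFn sWF) -(lo_sub (lW n n0') Xf (XF m m0)).
  apply: lerD.
    apply: le_trans nd _.
    rewrite -(exp_rate s alpha n0').
    have E : (cP / gamma) ^+ s * cU * (K1 * M * q) * (n%:R ^+ s * n%:R `^ (- alpha)) =
       (cP / gamma) ^+ s * cU * n%:R ^+ s * (K1 * M * (q * n%:R `^ (- alpha))) by ring.
    rewrite E; apply: ler_wpM2l.
      by rewrite !mulr_ge0// exprn_ge0// divr_ge0// ltW.
    apply: le_trans (fF m (ltnW mn0) m0) _.
    apply: ler_wpM2l; first exact: mulr_ge0.
    exact: le_rate_div (ltW a0) bgt bn.
  have Dw : derive1n s (W n (F m)) = W n (derive1n s (F m)).
    exact: (so_derive1n (lo_smooth_op (lW n n0')) sFm).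
  rewrite Dw; exact: (lo_norm (lW n n0') (smooth_lat_derive1n sFm)).
exists (4 * n0.+1)%N, ((K1 * M + jackson_cst C ^+ s * K) * (2 * 4)%:R `^ alpha).
  rewrite mulr_ge0 ?powR_ge0// addr_ge0 ?mulr_ge0// exprn_ge0//.
  exact: (jackson_cst_ge0 C_ge1).
move=> n nn; set j := (n %/ 4)%N.
have jn0 : (n0.+1 <= j)%N by rewrite leq_divRL// mulnC.
have j0 : (0 < j)%N by exact: leq_trans jn0.
have j0R : 0 < j%:R :> R by rewrite ltr0n.
have n4 : (4 <= n)%N by apply: leq_trans nn; rewrite leq_pmulr.
have [sF _] := smW j f j0 Xf.
have [T tT [XT nT]] := jackson_smooth j0 sF.
exists T.
  apply: trig_poly_leq tT.
  have -> : (j + j + (j + j) = j * 4)%N by ring.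
  exact: leq_divM.
split=> //.
have -> : f \- T = (f \- F j) \+ (F j \- T) by apply/funext => x /=; ring.
apply: le_trans (norm_add hX (lat_sub hX Xf (XF j j0)) (lat_sub hX (XF j j0) XT)) _.
apply: (@le_trans _ _ ((K1 * M + jackson_cst C ^+ s * K) * j%:R `^ (- alpha))).
  rewrite mulrDl; apply: lerD; first exact: (fF j (ltnW jn0) j0).
  apply: le_trans nT _; rewrite expr_div_n -(exp_rateV s alpha j0).
  have E : jackson_cst C ^+ s * K * (j%:R ^- s * j%:R `^ (s%:R - alpha)) =
     jackson_cst C ^+ s / j%:R ^+ s * (K * j%:R `^ (s%:R - alpha)) by ring.
  rewrite E; apply: ler_wpM2l; last exact: HK.
  by rewrite divr_ge0 ?exprn_ge0 ?(jackson_cst_ge0 C_ge1)// ltW.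
rewrite -[X in _ <= X]mulrA; apply: ler_wpM2l.
  by rewrite addr_ge0 ?mulr_ge0// exprn_ge0// (jackson_cst_ge0 C_ge1).
exact: (le_rate_div (b := 4) (ltW a0) isT n4).
Qed.

End ApproximationRates.

(** * Differences of polynomials in both norms *)

Section SamplingDifferences.
Context {R : realType} (X : set (R -> R)) (N : (R -> R) -> R).
Context (hX : banach_lattice X N) (hA : assumptionA X N).
Context (C : R) (C_ge1 : 1 <= C).
Context (steklov_le : forall h f, 0 < h -> X f -> N (steklov h f) <= C * N f).
Context (gamma gamma' : R) (gamma_gt0 : 0 < gamma) (gamma'_gt0 : 0 < gamma').
Implicit Types (f g T : R -> R) (x y h : R) (n m p k r s : nat).

Let C0 : 0 <= C. Proof. exact: le_trans ler01 C_ge1. Qed.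
Let B0 : 0 <= bernstein_cst C. Proof. exact: bernstein_cst_ge0. Qed.
Let g0 : 0 <= gamma. Proof. exact: ltW. Qed.
Let g'0 : 0 <= gamma'. Proof. exact: ltW. Qed.

Lemma norm_diff_iter_smooth s h g : 0 < h -> smooth s g ->
  N (diff_iter (steklov_dot h) s g) <= (2 * h * C) ^+ s * N (derive1n s g).
Proof.
move=> h0 sg; have c0 := C0.
have soE : smooth_op (fun g => g \- steklov_dot h g).
  apply: smooth_op_sub; first exact: smooth_op_id.
  exact: lo_smooth_op (lattice_op_steklov_dot hX hA C_ge1 steklov_le h0).
have H := @norm_iter_smooth R N _ 1 s (2 * h * C) g soE.
rewrite muln1 in H; apply: H => //.
  by rewrite !mulr_ge0// ltW.
by move=> k sk; rewrite derive1n1; exact: (norm_sub_steklov_dot hX hA C_ge1 steklov_le h0 sk).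
Qed.

Lemma norm_diff_iter_smooth2 r h g : 0 < h -> smooth (r * 2) g ->
  N (diff_iter (steklov h) r g) <= (h ^+ 2 * C) ^+ r * N (derive1n (r * 2) g).
Proof.
move=> h0 sg; have c0 := C0.
have soE : smooth_op (fun g => g \- steklov h g).
  apply: smooth_op_sub; first exact: smooth_op_id.
  exact: lo_smooth_op (lattice_op_steklov hX hA C_ge1 steklov_le h0).
apply: (@norm_iter_smooth R N _ 2 r (h ^+ 2 * C) g soE) => //.
  by rewrite mulr_ge0// sqr_ge0.
by move=> k sk; exact: (norm_sub_steklov hX hA C_ge1 steklov_le h0 sk).
Qed.

(** The constant of the Marcinkiewicz-Zygmund type inequality dnorm
    T <= mz_cst * N T for polynomials of degree n. *)
Definition mz_cst : R := 1 + 2 * gamma' * C * bernstein_cst C.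

Lemma mz_cst_ge0 : 0 <= mz_cst.
Proof.
have c0 := C0; have b0 := B0; have g1 := g'0.
rewrite /mz_cst; apply: addr_ge0 => //; do ! apply: mulr_ge0 => //.
Qed.

Definition diff_cst r : R := (1 + 2 * gamma' / gamma) * C * geom_cst C r.

Lemma diff_cst_ge0 r : 0 <= diff_cst r.
Proof.
have c0 := C0; have gp := g0; have gp' := g'0.
apply: mulr_ge0; last by apply: sumr_ge0 => i _; rewrite exprn_ge0// addr_ge0.
by rewrite mulr_ge0// addr_ge0// divr_ge0// mulr_ge0.
Qed.

Section Level.
Context (n m : nat) (xs : nat -> R) (n_gt0 : (0 < n)%N).
Context (hx : sampling_nodes gamma gamma' n m xs).

Local Notation dnorm := (discrete_norm N m xs).
Local Notation A := (steklov (gamma / n%:R)).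

Let n0R : 0 < n%:R :> R. Proof. by rewrite ltr0n. Qed.
Let h0 : 0 < gamma / n%:R. Proof. exact: divr_gt0. Qed.

(** The variation of T across a cell of length O(1/n) is compensated by the
    factor n in Bernstein's inequality. *)
Lemma dnorm_trig_poly T : trig_poly n T -> dnorm T <= mz_cst * N T.
Proof.
move=> tT; have sT := trig_poly_smooth 1 tT.
have c0 := C0; have b0 := B0; have g1 := g'0; have n0 := n0R.
apply: le_trans (dnorm_smooth hX hA steklov_le gamma_gt0 gamma'_gt0 n_gt0 hx sT) _.
rewrite /mz_cst [X in _ <= X]mulrDl mul1r lerD2l.
have H := bernstein_iter hX hA C_ge1 steklov_le 1 n_gt0 tT.
rewrite derive1n1 expr1 in H.
have -> : 2 * gamma' * C * bernstein_cst C * N T =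
    2 * gamma' / n%:R * C * (bernstein_cst C * n%:R * N T) by field; rewrite gt_eqF.
apply: ler_wpM2l => //.
by rewrite mulr_ge0// divr_ge0 ?(ltW n0)// mulr_ge0.
Qed.

(** Two derivatives per factor I - A give h^(2r) times N (D^(2r) T); Bernstein
    trades the 2r - s surplus derivatives for n^(2r-s), which leaves n^-s. The
    derivative required by the discrete norm is compensated in the same way. *)
Lemma dnorm_diff_iter_trig_poly r s T : (s <= 2 * r)%N -> trig_poly n T ->
  dnorm (diff_iter A r T) <=
  mz_cst * (gamma ^+ 2 * C) ^+ r * bernstein_cst C ^+ (2 * r - s) *
    (n%:R ^- s * N (derive1n s T)).
Proof.
move=> sr tT.
have h0' := h0; have n0' := n0R.
have c1 := C0; have b0 := B0; have g1 := g'0.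
have soD : smooth_op (diff_iter A r).
  apply: smooth_op_diff_iter.
  exact: lo_smooth_op (lattice_op_steklov hX hA C_ge1 steklov_le h0').
have sT := trig_poly_smooth (r * 2).+1 tT.
have sD := so_smooth soD (trig_poly_smooth 1 tT).
apply: le_trans (dnorm_smooth hX hA steklov_le gamma_gt0 gamma'_gt0 n_gt0 hx sD) _.
have D1 : derive1 (diff_iter A r T) = diff_iter A r (derive1 T).
  exact: (so_derive1 soD (trig_poly_smooth 1 tT)).
rewrite D1.
set a := N (derive1n (r * 2) T).
have t2 := trig_poly_derive1n (r * 2) tT.
have a0 : 0 <= a by exact: (norm_ge0 hX (trig_poly_lat hX t2)).
have le0 : N (diff_iter A r T) <= ((gamma / n%:R) ^+ 2 * C) ^+ r * a.
  by apply: (norm_diff_iter_smooth2 h0'); exact: trig_poly_smooth tT.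
have le1 : N (diff_iter A r (derive1 T)) <=
    ((gamma / n%:R) ^+ 2 * C) ^+ r * (bernstein_cst C * n%:R * a).
  apply: le_trans (norm_diff_iter_smooth2 h0' (trig_poly_smooth (r * 2) (trig_poly_derive1 tT))) _.
  apply: ler_wpM2l; first by rewrite exprn_ge0// mulr_ge0// sqr_ge0.
  rewrite -derive1Sn derive1nS -derive1n1.
  have := bernstein_iter hX hA C_ge1 steklov_le 1 n_gt0 t2.
  by rewrite expr1.
have le2 : a <= (bernstein_cst C * n%:R) ^+ (2 * r - s) * N (derive1n s T).
  have -> : a = N (derive1n (2 * r - s) (derive1n s T)).
    by rewrite -derive1nD subnK// /a mulnC.
  exact: (bernstein_iter hX hA C_ge1 steklov_le _ n_gt0 (trig_poly_derive1n s tT)).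
have e0 : 0 <= ((gamma / n%:R) ^+ 2 * C) ^+ r by rewrite exprn_ge0// mulr_ge0// sqr_ge0.
have c0 : 0 <= 2 * gamma' / n%:R * C by rewrite mulr_ge0// divr_ge0 ?(ltW n0')// mulr_ge0.
apply: le_trans (lerD le0 (ler_wpM2l c0 le1)) _.
have -> : ((gamma / n%:R) ^+ 2 * C) ^+ r * a +
    2 * gamma' / n%:R * C * (((gamma / n%:R) ^+ 2 * C) ^+ r * (bernstein_cst C * n%:R * a)) =
    mz_cst * ((gamma / n%:R) ^+ 2 * C) ^+ r * a.
  by rewrite /mz_cst; field; rewrite gt_eqF.
apply: le_trans (ler_wpM2l (mulr_ge0 mz_cst_ge0 e0) le2) _.
rewrite le_eqVlt; apply/orP; left; apply/eqP.
have E1 : ((gamma / n%:R) ^+ 2 * C) ^+ r = (gamma ^+ 2 * C) ^+ r * n%:R ^- (2 * r).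
  by rewrite (exprM _ 2 r) -exprVn -exprMn; congr (_ ^+ r); field; rewrite gt_eqF.
have E2 : n%:R ^- (2 * r) * n%:R ^+ (2 * r - s) = n%:R ^- s :> R.
  rewrite -{1}(subnK sr) exprD invfM mulrAC mulVf ?mul1r//.
  by rewrite expf_neq0// gt_eqF.
have shuffle (u v w y z t : R) : u * (v * w) * (y * z * t) = u * v * y * (w * z * t).
  by ring.
by rewrite E1 -E2 [(bernstein_cst C * _) ^+ _]exprMn shuffle.
Qed.

(** Each factor I - A changes the argument by an average at scale gamma/n,
    whose discrete norm is bounded by the lattice norm. *)
Lemma dnorm_diff_iter_near r g : X g ->
  dnorm (diff_iter A r g) <= dnorm g + diff_cst r * N g /\
  dnorm g <= dnorm (diff_iter A r g) + diff_cst r * N g.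
Proof.
move=> Xg; have c1 := C0; have gp := g0; have gp' := g'0.
have lA := lattice_op_steklov hX hA C_ge1 steklov_le h0.
elim: r => [|r [IH1 IH2]].
  by rewrite /diff_cst /geom_cst big_geq// mulr0 mul0r addr0.
have lD := lattice_op_diff_iter hX r lA.
have XD := lo_lat lD Xg.
rewrite diff_iterS; set u := diff_iter A r g in IH1 IH2 XD *.
have Nu : N u <= (1 + C) ^+ r * N g by exact: (lo_norm lD).
have c0 : 0 <= (1 + 2 * gamma' / gamma) * C.
  by rewrite mulr_ge0// addr_ge0// divr_ge0// mulr_ge0.
have Au : dnorm (A u) <= (1 + 2 * gamma' / gamma) * C * (1 + C) ^+ r * N g.
  apply: le_trans (dnorm_steklov hX hA steklov_le gamma_gt0 gamma'_gt0 n_gt0 hx XD) _.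
  by rewrite -[X in _ <= X]mulrA; apply: ler_wpM2l.
have E : diff_cst r.+1 * N g = diff_cst r * N g + (1 + 2 * gamma' / gamma) * C * (1 + C) ^+ r * N g.
  by rewrite /diff_cst /geom_cst big_nat_recr//=; ring.
have B1 := dnormB hX m xs u (A u).
have B2 := dnorm_triangle hX m xs u (u \- A u).
have E2 : u \- (u \- A u) = A u by apply/funext => x /=; ring.
rewrite E2 in B2; rewrite E; split; lra.
Qed.

End Level.
End SamplingDifferences.

(** * The two implications *)

Section SamplingRates.
Context {R : realType} (X : set (R -> R)) (N : (R -> R) -> R).
Context (hX : banach_lattice X N) (hA : assumptionA X N).
Context (C : R) (C_ge1 : 1 <= C).
Context (steklov_le : forall h f, 0 < h -> X f -> N (steklov h f) <= C * N f).
Context (gamma gamma' : R) (gamma_gt0 : 0 < gamma) (gamma'_gt0 : 0 < gamma').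
Context (m : nat -> nat) (x : nat -> nat -> R) (G : nat -> (R -> R) -> R -> R).
Context (hx : forall n, (0 < n)%N -> sampling_nodes gamma gamma' n (m n) (x n)).
Context (hG : forall n f, (0 < n)%N -> X f -> trig_poly n (G n f)).
Context (r s : nat) (le_s_2r : (s <= 2 * r)%N).
Context (f : R -> R) (Xf : X f) (alpha : R) (alpha_gt0 : 0 < alpha) (alpha_lt : alpha < s%:R).

Local Notation dnorm n := (discrete_norm N (m n) (x n)).
Local Notation Adot n := (steklov_dot (gamma / n%:R)).
Local Notation A n := (steklov (gamma / n%:R)).

Let h_gt0 n : (0 < n)%N -> 0 < gamma / n%:R.
Proof. by move=> n0; rewrite divr_gt0// ltr0n. Qed.

(** Both differences are applied to f = (f - G_n f) + G_n f: they are bounded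
    on the first summand, which is small, and gain n^-s on the second, whose
    s-th derivative is O(n^(s-alpha)). *)
Lemma smoothness_of_sampling_rate (M : R) n0 : 0 <= M ->
  (forall n, (n0 <= n)%N ->
     N (f \- G n f) + dnorm n (f \- G n f) <= M * n%:R `^ (- alpha)) ->
  exists2 M', 0 <= M' & forall n, (n0.+1 <= n)%N ->
    N (diff_iter (Adot n) s f) + dnorm n (diff_iter (A n) r f) <=
    M' * n%:R `^ (- alpha).
Proof.
move=> M0 H; have c0 : 0 <= C by exact: le_trans ler01 C_ge1.
have g0 : 0 <= gamma by exact: ltW gamma_gt0.
have H1 n : (n0 <= n)%N -> (0 < n)%N -> N (f \- G n f) <= M * n%:R `^ (- alpha).
  move=> nn _; apply: le_trans (H n nn).
  by rewrite lerDl (dnorm_ge0 hX).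
have H2 n : (n0 <= n)%N -> (0 < n)%N -> dnorm n (f \- G n f) <= M * n%:R `^ (- alpha).
  move=> nn n0'; apply: le_trans (H n nn).
  by rewrite lerDr (norm_ge0 hX)//; exact: (lat_sub hX Xf (trig_poly_lat hX (hG n0' Xf))).
have [K K0 HK] := inverse_rate hX hA C_ge1 steklov_le Xf alpha_gt0 alpha_lt M0
   (fun n n0' => hG n0' Xf) H1.
pose e1 := (2 * gamma * C) ^+ s.
pose e2 := mz_cst C gamma' * (gamma ^+ 2 * C) ^+ r * bernstein_cst C ^+ (2 * r - s).
pose c1 := (1 + 2 * C) ^+ s.
pose c2 := diff_cst C gamma gamma' r.
have e10 : 0 <= e1 by rewrite exprn_ge0// !mulr_ge0.
have e20 : 0 <= e2.
  rewrite /e2; apply: mulr_ge0; last by rewrite exprn_ge0// (bernstein_cst_ge0 C_ge1).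
  apply: mulr_ge0; first exact: (mz_cst_ge0 C_ge1 gamma'_gt0).
  by rewrite exprn_ge0// mulr_ge0// sqr_ge0.
have c10 : 0 <= c1 by rewrite exprn_ge0// addr_ge0// mulr_ge0.
have c20 : 0 <= c2 by exact: (diff_cst_ge0 C_ge1 gamma_gt0 gamma'_gt0).
exists (e1 * K + c1 * M + (e2 * K + (M + c2 * M))).
  by do ![assumption|apply: addr_ge0|apply: mulr_ge0].
move=> n nn; have n0' : (0 < n)%N by exact: leq_trans nn.
have n00 : (n0 <= n)%N by exact: ltnW.
set T := G n f; have tT : trig_poly n T by exact: hG.
have XT := trig_poly_lat hX tT; have Xe := lat_sub hX Xf XT.
have h0 := h_gt0 n0'.
have lDd := lattice_op_diff_iter hX s (lattice_op_steklov_dot hX hA C_ge1 steklov_le h0).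
have lD := lattice_op_diff_iter hX r (lattice_op_steklov hX hA C_ge1 steklov_le h0).
set q := n%:R `^ (- alpha).
have q0 : 0 <= q by exact: powR_ge0.
have q1 : n%:R ^- s * N (derive1n s T) <= K * q.
  rewrite /q -(exp_rateV s alpha n0') mulrCA; apply: ler_wpM2l; last exact: HK.
  by rewrite invr_ge0 exprn_ge0.
have smooth_part : N (diff_iter (Adot n) s f) <= e1 * K * q + c1 * M * q.
  apply: le_trans (norm_triangle hX (lo_lat lDd Xf) (lo_lat lDd XT)) _.
  rewrite -(lo_sub lDd Xf XT); apply: lerD.
    apply: le_trans (norm_diff_iter_smooth hX hA C_ge1 steklov_le h0 (trig_poly_smooth s tT)) _.
    have -> : 2 * (gamma / n%:R) * C = 2 * gamma * C / n%:R by ring.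
    by rewrite expr_div_n -[X in X <= _]mulrA -[X in _ <= X]mulrA; apply: ler_wpM2l.
  apply: le_trans (lo_norm lDd Xe) _.
  by rewrite -[X in _ <= X]mulrA; apply: ler_wpM2l => //; exact: H1.
have discrete_part : dnorm n (diff_iter (A n) r f) <= e2 * K * q + (M + c2 * M) * q.
  apply: le_trans (dnorm_triangle hX _ _ _ (diff_iter (A n) r T)) _.
  rewrite -(lo_sub lD Xf XT); apply: lerD.
    apply: le_trans (dnorm_diff_iter_trig_poly hX hA C_ge1 steklov_le gamma_gt0
      gamma'_gt0 n0' (hx n0') le_s_2r tT) _.
    by rewrite -[X in _ <= X]mulrA; apply: ler_wpM2l.
  apply: le_trans (proj1 (dnorm_diff_iter_near hX hA C_ge1 steklov_le gamma_gt0
    gamma'_gt0 n0' (hx n0') r Xe)) _.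
  rewrite [X in _ <= X]mulrDl -[X in _ <= _ + X]mulrA; apply: lerD; first exact: H2.
  by apply: ler_wpM2l => //; exact: H1.
by apply: le_trans (lerD smooth_part discrete_part) _; rewrite -!mulrDl.
Qed.

Context (K1 K3 : R) (K1_gt0 : 0 < K1) (K3_gt0 : 0 < K3).
Context (G_sub : forall n g k, G n (g \- k) = G n g \- G n k).
Context (hK1 : forall n g, (0 < n)%N -> X g -> N (G n g) <= K1 * dnorm n g).
Context (hK3 : forall n T, (0 < n)%N -> trig_poly n T ->
  N (T \- G n T) <= K3 * n%:R ^- s * N (derive1n s T)).

(** The near-best polynomial T_n is compared with G_n f through
    T_n - G_n f = (T_n - G_n T_n) - G_n (f - T_n). Boundedness of G_n refers to
    the discrete norm of f - T_n, for which closeness in X is not enough; it is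
    recovered from the difference (I - A)^r (f - T_n). *)
Lemma sampling_rate_of_smoothness (M : R) n0 : 0 <= M ->
  (forall n, (n0 <= n)%N ->
    N (diff_iter (Adot n) s f) + dnorm n (diff_iter (A n) r f) <=
    M * n%:R `^ (- alpha)) ->
  exists2 M', 0 <= M' & exists n1, forall n, (n1 <= n)%N ->
     N (f \- G n f) + dnorm n (f \- G n f) <= M' * n%:R `^ (- alpha).
Proof.
move=> M0 H; have C0 : 0 <= C by exact: le_trans ler01 C_ge1.
have g0 : 0 <= gamma by exact: ltW gamma_gt0.
have H1 n : (n0 <= n)%N -> (0 < n)%N ->
    N (diff_iter (Adot n) s f) <= M * n%:R `^ (- alpha).
  move=> nn _; apply: le_trans (H n nn).
  by rewrite lerDl (dnorm_ge0 hX).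
have H2 n : (n0 <= n)%N -> (0 < n)%N ->
    dnorm n (diff_iter (A n) r f) <= M * n%:R `^ (- alpha).
  move=> nn n0'; apply: le_trans (H n nn); rewrite lerDr (norm_ge0 hX)//.
  exact: (lo_lat (lattice_op_diff_iter hX s
    (lattice_op_steklov_dot hX hA C_ge1 steklov_le (h_gt0 n0'))) Xf).
have [n1 [L L0 HL]] := direct_rate hX hA C_ge1 steklov_le Xf gamma_gt0 alpha_gt0 alpha_lt M0 H1.
have t0 n : trig_poly n (fun=> 0 : R).
  have := trig_polyZ 0 (trig_poly_wave (0 : R) (leq0n n)).
  by congr trig_poly; apply/funext => y; rewrite mul0r.
(* below the threshold n1 the zero polynomial serves as a placeholder *)
have /choice[T HT] : forall n, exists T, trig_poly n T /\
    ((n1 <= n)%N -> N (f \- T) <= L * n%:R `^ (- alpha)).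
  move=> n; have [n1n|n1n] := leqP n1 n; last by exists (fun=> 0).
  by have [T tT [_ nT]] := HL n n1n; exists T.
have tT n : trig_poly n (T n) by exact: (proj1 (HT n)).
have [K K0 HK] := inverse_rate hX hA C_ge1 steklov_le Xf alpha_gt0 alpha_lt L0
   (fun n _ => tT n) (fun n nn _ => proj2 (HT n) nn).
pose e2 := mz_cst C gamma' * (gamma ^+ 2 * C) ^+ r * bernstein_cst C ^+ (2 * r - s).
pose c2 := diff_cst C gamma gamma' r.
pose c3 := mz_cst C gamma'.
have c30 : 0 <= c3 by exact: (mz_cst_ge0 C_ge1 gamma'_gt0).
have e20 : 0 <= e2.
  rewrite /e2; apply: mulr_ge0; last by rewrite exprn_ge0// (bernstein_cst_ge0 C_ge1).
  by apply: mulr_ge0 => //; rewrite exprn_ge0// mulr_ge0// sqr_ge0.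
have c20 : 0 <= c2 by exact: (diff_cst_ge0 C_ge1 gamma_gt0 gamma'_gt0).
have k10 : 0 <= K1 by exact: ltW.
have k30 : 0 <= K3 by exact: ltW.
pose D := M + e2 * K + c2 * L.
have D0 : 0 <= D by do ![assumption|apply: addr_ge0|apply: mulr_ge0].
pose E := K3 * K + K1 * D.
have E0 : 0 <= E by do ![assumption|apply: addr_ge0|apply: mulr_ge0].
exists (L + E + (D + c3 * E)); first by do ![assumption|apply: addr_ge0|apply: mulr_ge0].
(* the successor excludes n = 0 *)
exists (maxn n0 n1).+1 => n nn.
have n0' : (0 < n)%N by exact: leq_trans nn.
have n0n : (n0 <= n)%N by rewrite (leq_trans (leq_maxl n0 n1))// ltnW.
have n1n : (n1 <= n)%N by rewrite (leq_trans (leq_maxr n0 n1))// ltnW.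
have h0 := h_gt0 n0'.
have lD := lattice_op_diff_iter hX r (lattice_op_steklov hX hA C_ge1 steklov_le h0).
set q := n%:R `^ (- alpha).
have q0 : 0 <= q by exact: powR_ge0.
have tTn := tT n; have XT := trig_poly_lat hX tTn; have Xd := lat_sub hX Xf XT.
have tG := hG n0' Xf; have XG := trig_poly_lat hX tG.
have fT : N (f \- T n) <= L * q by exact: (proj2 (HT n) n1n).
have q1 : n%:R ^- s * N (derive1n s (T n)) <= K * q.
  rewrite /q -(exp_rateV s alpha n0') mulrCA; apply: ler_wpM2l; last exact: HK.
  by rewrite invr_ge0 exprn_ge0.
have dfT : dnorm n (f \- T n) <= D * q.
  apply: le_trans (proj2 (dnorm_diff_iter_near hX hA C_ge1 steklov_le gamma_gt0
    gamma'_gt0 n0' (hx n0') r Xd)) _.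
  rewrite /D [X in _ <= X]mulrDl; apply: lerD; last first.
    by rewrite -[X in _ <= X]mulrA; apply: ler_wpM2l.
  rewrite (lo_sub lD Xf XT) [X in _ <= X]mulrDl.
  apply: le_trans (dnormB hX _ _ _ _) _; apply: lerD; first exact: H2.
  apply: le_trans (dnorm_diff_iter_trig_poly hX hA C_ge1 steklov_le gamma_gt0
    gamma'_gt0 n0' (hx n0') le_s_2r tTn) _.
  by rewrite -[X in _ <= X]mulrA; apply: ler_wpM2l.
have TG : N (T n \- G n f) <= E * q.
  have XGT := trig_poly_lat hX (hG n0' XT).
  have -> : T n \- G n f = (T n \- G n (T n)) \- G n (f \- T n).
    by rewrite G_sub; apply/funext => y /=; ring.
  apply: le_trans (norm_sub hX (lat_sub hX XT XGT) (trig_poly_lat hX (hG n0' Xd))) _.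
  rewrite /E [X in _ <= X]mulrDl; apply: lerD.
    apply: le_trans (hK3 n0' tTn) _.
    by rewrite -[X in X <= _]mulrA -[X in _ <= X]mulrA; apply: ler_wpM2l.
  apply: le_trans (hK1 n0' Xd) _.
  by rewrite -[X in _ <= X]mulrA; apply: ler_wpM2l.
have split_err : f \- G n f = (f \- T n) \+ (T n \- G n f).
  by apply/funext => y /=; ring.
have norm_part : N (f \- G n f) <= (L + E) * q.
  rewrite split_err [X in _ <= X]mulrDl.
  apply: le_trans (norm_add hX Xd (lat_sub hX XT XG)) _; exact: lerD.
have discrete_part : dnorm n (f \- G n f) <= (D + c3 * E) * q.
  have := dnorm_triangle hX (m n) (x n) (f \- G n f) (f \- T n).
  have -> : (f \- G n f) \- (f \- T n) = T n \- G n f by apply/funext => y /=; ring.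
  move=> /le_trans; apply; rewrite [X in _ <= X]mulrDl; apply: lerD => //.
  apply: le_trans (dnorm_trig_poly hX hA C_ge1 steklov_le gamma_gt0 gamma'_gt0 n0'
    (hx n0') (trig_polyB tTn tG)) _.
  by rewrite -[X in _ <= X]mulrA; apply: ler_wpM2l.
by rewrite [X in _ <= X]mulrDl; apply: lerD.
Qed.

End SamplingRates.

Unset Implicit Arguments.

Theorem corollary3p3 (R : realType)
  (X : set (R -> R)) (N : (R -> R) -> R)
  (hX : banach_lattice X N) (hA : assumptionA X N)
  (r s : nat) (r_gt0 : (0 < r)%N) (s_gt0 : (0 < s)%N) (le_s_2r : (s <= 2 * r)%N)
  (gamma gamma' : R) (gamma_gt0 : 0 < gamma) (gamma'_gt0 : 0 < gamma')
  (m : nat -> nat) (x : nat -> nat -> R) (phi : nat -> nat -> R -> R)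
  (hx : forall n, (0 < n)%N -> sampling_nodes gamma gamma' n (m n) (x n))
  (hphi : forall n k, (0 < n)%N -> (1 <= k <= m n)%N -> circle_fun (phi n k))
  (hG : forall n f, (0 < n)%N -> X f ->
    trig_poly n (sampling_op (m n) (x n) (phi n) f))
  (K1 K3 : R) (K1_gt0 : 0 < K1) (K3_gt0 : 0 < K3)
  (hK1 : forall n f, (0 < n)%N -> X f ->
    N (sampling_op (m n) (x n) (phi n) f)
      <= K1 * discrete_norm N (m n) (x n) f)
  (hK3 : forall n T, (0 < n)%N -> trig_poly n T ->
    N (T \- sampling_op (m n) (x n) (phi n) T)
      <= K3 * n%:R ^- s * N (derive1n s (T : R -> R^o)))
  (f : R -> R) (hf : X f) (alpha : R) (halpha : 0 < alpha < s%:R) :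
  ((fun n : nat =>
      N (f \- sampling_op (m n) (x n) (phi n) f)
      + discrete_norm N (m n) (x n) (f \- sampling_op (m n) (x n) (phi n) f)
      : R^o)
     =O_\oo (fun n : nat => n%:R `^ (- alpha) : R^o))
  <->
  ((fun n : nat =>
      N (diff_iter (steklov_dot (gamma / n%:R)) s f)
      + discrete_norm N (m n) (x n)
          (diff_iter (steklov (gamma / n%:R)) r f)
      : R^o)
     =O_\oo (fun n : nat => n%:R `^ (- alpha) : R^o)).
Proof.
have [C C_ge1 steklov_le] := steklov_bounded hX hA.
have [alpha_gt0 alpha_lt] := andP halpha.
pose G n := sampling_op (m n) (x n) (phi n).
have hGn n g : (0 < n)%N -> X g -> trig_poly n (G n g) by exact: hG.
have G_sub n g k : G n (g \- k) = G n g \- G n k.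
  apply/funext => t /=; rewrite -sumrB; apply: eq_bigr => i _; exact: mulrBl.
have error_ge0 n : (0 < n)%N ->
    0 <= N (f \- G n f) + discrete_norm N (m n) (x n) (f \- G n f).
  move=> n0; apply: addr_ge0; last exact: (dnorm_ge0 hX).
  exact: (norm_ge0 hX (lat_sub hX hf (trig_poly_lat hX (hGn n f n0 hf)))).
have smoothness_ge0 n : (0 < n)%N ->
    0 <= N (diff_iter (steklov_dot (gamma / n%:R)) s f) +
         discrete_norm N (m n) (x n) (diff_iter (steklov (gamma / n%:R)) r f).
  move=> n0; apply: addr_ge0; last exact: (dnorm_ge0 hX).
  have h0 : 0 < gamma / n%:R by rewrite divr_gt0// ltr0n.
  apply: (norm_ge0 hX); apply: (lo_lat _ hf).
  exact: (lattice_op_diff_iter hX s (lattice_op_steklov_dot hX hA C_ge1 steklov_le h0)).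
split => /bigO_rateP.
  move=> /(_ error_ge0)[M M0 [n0 H]]; apply/bigO_rateP => //.
  have [M' M'0 H'] := smoothness_of_sampling_rate hX hA C_ge1 steklov_le gamma_gt0
    gamma'_gt0 hx hGn le_s_2r hf alpha_gt0 alpha_lt M0 H.
  by exists M' => //; exists n0.+1.
move=> /(_ smoothness_ge0)[M M0 [n0 H]]; apply/bigO_rateP => //.
exact: (sampling_rate_of_smoothness hX hA C_ge1 steklov_le gamma_gt0 gamma'_gt0
  hx hGn le_s_2r hf alpha_gt0 alpha_lt K1_gt0 K3_gt0 G_sub hK1 hK3 M0 H).
Qed.
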